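(* Let $\varepsilon>0$ be arbitrary and fixed. For every $s\ge 3$, the two-dimensional incompressible Euler-Oldroyd-B system $$\begin{cases}\partial_t u+u\cdot\nabla u+\nabla p=\nabla\cdot\tau,\\ \partial_t\tau+u\cdot\nabla\tau+Q(\tau,\nabla u)=\frac{1}{\varepsilon^2}\,(D(u)-\tau),\\ \nabla\cdot u=0,\end{cases}$$ on $\mathbb T^2$, with initial data $(u,\tau)|_{t=0}=(u_{\mathrm{in}},\tau_{\mathrm{in}})$, is ill-posed in the Sobolev space $H^s(\mathbb T^2)$ in the sense of Hadamard, i.e. there is no well-defined continuous data-to-solution map in $H^s$ (in the precise sense recalled in the context).
   Context: $\mathbb T^2$ is the two-dimensional torus (of period $2\pi$). The unknowns are the velocity $u:\mathbb T^2\times[0,\infty)\to\mathbb R^2$, the pressure $p$ (scalar), and the stress tensor $\tau:\mathbb T^2\times[0,\infty)\to\mathbb R^{2\times 2}$. Conventions: $(\nabla u)_{ij}=\partial_j u_i$, $(\nabla\cdot\tau)_i=\sum_j\partial_j\tau_{ij}$. Furthermore $$D(u)=\frac{\nabla u+(\nabla u)^\top}{2},\qquad W(u)=\frac{\nabla u-(\nabla u)^\top}{2},$$ $$Q(\tau,\nabla u)=\tau W(u)-W(u)\tau+b\,(\tau D(u)+D(u)\tau),$$ where $b$ is a fixed real parameter. Hadamard well-posedness in $H^s$ means: for every $R>0$ there is $T=T(R)>0$ such that every initial datum $(u_{\mathrm{in}},\tau_{\mathrm{in}})\in H^s(\mathbb T^2)$ with $\nabla\cdot u_{\mathrm{in}}=0$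 and $H^s$-norm at most $R$ has a unique solution $(u,\tau)\in L^\infty(0,T;H^s(\mathbb T^2))$ of the system, and the data-to-solution map $(u_{\mathrm{in}},\tau_{\mathrm{in}})\mapsto(u,\tau)$ is continuous from this set of data (with the $H^s$ topology) to $L^\infty(0,T;H^s(\mathbb T^2))$. The system is ill-posed in $H^s$ in the sense of Hadamard if it is not well-posed in this sense. *)

(* Defs.v *)
From HB Require Import structures.
From mathcomp Require Import all_boot all_order all_algebra.
From mathcomp Require Import all_classical all_reals all_analysis.
From mathcomp Require Import ess_sup_inf.

Set Implicit Arguments.
Unset Strict Implicit.
Unset Printing Implicit Defensive.

Import Order.TTheory GRing.Theory Num.Theory.
Import numFieldNormedType.Exports.

Local Open Scope classical_set_scope.
Local Open Scope ring_scope.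

(* The torus is R^2 modulo 2 pi Z^2: a function on it is a 2 pi-periodic
   function on R * R, integrated over one period cell.  A point of space-time
   is (t, x) : R * (R * R). *)

Definition cell (R : realType) : set (R * R) :=
  `[0, 2 * pi] `*` `[0, 2 * pi].

Definition cylinder (R : realType) (T : R) : set (R * (R * R)) :=
  `]0, T[ `*` @cell R.

Definition area (R : realType) : set (measurableTypeR R * measurableTypeR R) ->
    \bar R :=
  (@lebesgue_measure R \x @lebesgue_measure R)%E.

(* Sigma-finiteness of a product is not inferred canonically; it is needed for
   volume to be a measure. *)
Section area_measure.
Context {R : realType}.

HB.instance Definition _ := Measure.on (@area R).

Let area_sigma_finite : sigma_finite setT (@area R).
Proof.
have /sigma_finiteP[F [TF ndF Foo]] := sigma_finiteT (@lebesgue_measure R).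
exists (fun n => F n `*` F n).
  rewrite -setXTT TF predeqE => -[x y]; split.
    move=> [/= [n _ Fnx] [k _ Fky]]; exists (maxn n k) => //; split.
    - by move: x Fnx; exact/subsetPset/ndF/leq_maxl.
    - by move: y Fky; exact/subsetPset/ndF/leq_maxr.
  by move=> [n _ []/= ? ?]; split; exists n.
move=> k; have [mF Fk] := Foo k.
split; first exact: measurableX.
by rewrite /area product_measure1E// lte_mul_pinfty// ge0_fin_numE.
Qed.

HB.instance Definition _ := Measure_isSigmaFinite.Build _ _ _ (@area R)
  area_sigma_finite.

End area_measure.

Definition volume (R : realType) :
    set (measurableTypeR R * (measurableTypeR R * measurableTypeR R)) ->
    \bar R :=
  (@lebesgue_measure R \x @area R)%E.

Section volume_measure.
Context {R : realType}.
HB.instance Definition _ := Measure.on (@volume R).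
End volume_measure.

Definition unit_x (R : realType) (j : 'I_2) : R * R :=
  if j == 0 then (1, 0) else (0, 1).

Definition unit_t (R : realType) : R * (R * R) := (1, (0, 0)).

(* Serves both for points at t = 0 and for spatial directions in space-time. *)
Definition at_t0 (R : realType) (x : R * R) : R * (R * R) := (0, x).

Definition periodic_x (R : realType) (Y : Type) (f : R * R -> Y) : Prop :=
  forall (j : 'I_2) (x : R * R), f (x + (2 * pi) *: unit_x R j) = f x.

(* Iterated directional derivatives: C^n for all n. *)
Fixpoint is_Cn (R : realType) (V : normedModType R) (n : nat) (f : V -> R) :
    Prop :=
  continuous f /\
  if n is m.+1 then
    forall v : V, (forall x, derivable f x v) /\ is_Cn m (fun x => 'D_v f x)
  else True.

Definition smooth (R : realType) (V : normedModType R) (f : V -> R) : Prop :=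
  forall n, is_Cn n f.

(* C^oo_c([0, T) x torus): no condition at t = 0. *)
Definition test_function (R : realType) (T : R) (phi : R * (R * R) -> R) :
    Prop :=
  [/\ smooth phi,
      forall t, periodic_x (fun x => phi (t, x)) &
      exists2 T', T' < T & forall t x, T' <= t -> phi (t, x) = 0].

Definition L1_cylinder (R : realType) (T : R) (f : R * (R * R) -> R) : Prop :=
  (@volume R).-integrable (cylinder T) (EFin \o f).

Definition weak_dx (R : realType) (T : R) (j : 'I_2)
    (f g : R * (R * R) -> R) : Prop :=
  [/\ L1_cylinder T f, L1_cylinder T g &
      forall phi, test_function T phi ->
        \int[@volume R]_(z in cylinder T) (f z * 'D_(at_t0 (unit_x R j)) phi z)
        = - \int[@volume R]_(z in cylinder T) (g z * phi z)].

(* g is the weak time derivative of f on (0, T), and f has trace f0 at t = 0 *)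
Definition weak_dt (R : realType) (T : R) (f0 : R * R -> R)
    (f g : R * (R * R) -> R) : Prop :=
  [/\ L1_cylinder T f, L1_cylinder T g &
      forall phi, test_function T phi ->
        \int[@volume R]_(z in cylinder T) (f z * 'D_(unit_t R) phi z)
        + \int[@area R]_(x in @cell R) (f0 x * phi (at_t0 x))
        = - \int[@volume R]_(z in cylinder T) (g z * phi z)].

(* The Fourier coefficient fhat(k) is fourier_cos f k - i * fourier_sin f k. *)
Definition phase (R : realType) (k : int * int) (x : R * R) : R :=
  k.1%:~R * x.1 + k.2%:~R * x.2.

Definition fourier_cos (R : realType) (f : R * R -> R) (k : int * int) : R :=
  ((2 * pi) ^+ 2)^-1 * \int[@area R]_(x in @cell R) (f x * cos (phase k x)).

Definition fourier_sin (R : realType) (f : R * R -> R) (k : int * int) : R :=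
  ((2 * pi) ^+ 2)^-1 * \int[@area R]_(x in @cell R) (f x * sin (phase k x)).

(* sum over k of (1 + |k|^2)^s |fhat(k)|^2; meaningful for f in L^2 *)
Definition Hs_norm_sq (R : realType) (s : R) (f : R * R -> R) : \bar R :=
  (\esum_(k in [set: int * int])
    ((1 + k.1%:~R ^+ 2 + k.2%:~R ^+ 2) `^ s
     * (fourier_cos f k ^+ 2 + fourier_sin f k ^+ 2))%:E)%E.

Definition Hs (R : realType) (s : R) (f : R * R -> R) : Prop :=
  [/\ measurable_fun setT f, periodic_x f,
      (\int[@area R]_(x in @cell R) (f x ^+ 2)%:E < +oo)%E &
      (Hs_norm_sq s f < +oo)%E].

(* Pairs (u, tau). *)
Definition state (R : realType) (X : Type) : Type :=
  ((X -> 'cV[R]_2) * (X -> 'M[R]_2))%type.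

Definition state_sub (R : realType) (X : Type) (U V : state R X) : state R X :=
  (fun x => U.1 x - V.1 x, fun x => U.2 x - V.2 x).

Definition slice (R : realType) (U : state R (R * (R * R))) (t : R) :
    state R (R * R) :=
  (fun x => U.1 (t, x), fun x => U.2 (t, x)).

Definition state_Hs (R : realType) (s : R) (U : state R (R * R)) : Prop :=
  (forall i, Hs s (fun x => U.1 x i 0)) /\
  (forall i j, Hs s (fun x => U.2 x i j)).

Definition state_Hs_norm (R : realType) (s : R) (U : state R (R * R)) :
    \bar R :=
  sqrte (\sum_(i < 2) Hs_norm_sq s (fun x => U.1 x i 0)%R
         + \sum_(i < 2) \sum_(j < 2) Hs_norm_sq s (fun x => U.2 x i j))%E.

Definition LinfHs_norm (R : realType) (s T : R) (U : state R (R * (R * R))) :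
    \bar R :=
  ess_sup (@lebesgue_measure R)
    ((fun t => state_Hs_norm s (slice U t)) \_ `]0, T[).

(* Joint measurability in (t, x) makes t |-> slice U t weakly, hence (H^s being
   separable) strongly measurable. *)
Definition LinfHs (R : realType) (s T : R) (U : state R (R * (R * R))) :
    Prop :=
  [/\ forall i, measurable_fun (`]0, T[ `*` [set: R * R])
                  (fun z => U.1 z i 0),
      forall i j, measurable_fun (`]0, T[ `*` [set: R * R])
                    (fun z => U.2 z i j),
      (\forall t \ae @lebesgue_measure R,
         `]0, T[%classic t -> state_Hs s (slice U t)) &
      (LinfHs_norm s T U < +oo)%E].

Definition div_free (R : realType) (v : R * R -> 'cV[R]_2) : Prop :=
  forall psi : R * R -> R, smooth psi -> periodic_x psi ->
    \int[@area R]_(x in @cell R)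
      (\sum_(j < 2) v x j 0 * 'D_(unit_x R j) psi x) = 0.

(* In the next three, G stands for the velocity gradient, G i j = d_j u_i. *)
Definition strain (R : realType) (G : 'M[R]_2) : 'M[R]_2 :=
  2^-1 *: (G + G^T).

Definition vorticity (R : realType) (G : 'M[R]_2) : 'M[R]_2 :=
  2^-1 *: (G - G^T).

Definition Qterm (R : realType) (b : R) (tau G : 'M[R]_2) : 'M[R]_2 :=
  tau *m vorticity G - vorticity G *m tau
  + b *: (tau *m strain G + strain G *m tau).

(* The equations hold almost everywhere, with weak derivatives
   ut, Du, Dp, taut, Dtau j = d_j tau. *)
Definition euler_oldroyd_sol (R : realType) (eps b s T : R)
    (U0 : state R (R * R)) (U : state R (R * (R * R))) : Prop :=
  LinfHs s T U /\
  exists (p : R * (R * R) -> R) (ut Dp : R * (R * R) -> 'cV[R]_2)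
         (Du taut : R * (R * R) -> 'M[R]_2)
         (Dtau : 'I_2 -> R * (R * R) -> 'M[R]_2),
    let u := U.1 in let tau := U.2 in
    [/\ forall i, weak_dt T (fun x => U0.1 x i 0)
                    (fun z => u z i 0) (fun z => ut z i 0),
        forall i j, weak_dt T (fun x => U0.2 x i j)
                      (fun z => tau z i j) (fun z => taut z i j),
        forall i j, weak_dx T j (fun z => u z i 0) (fun z => Du z i j),
        forall i j k, weak_dx T k (fun z => tau z i j)
                        (fun z => Dtau k z i j) &
        forall j, weak_dx T j p (fun z => Dp z j 0)]
    /\ (\forall z \ae @volume R, cylinder T z ->
         [/\ ut z + \sum_(j < 2) u z j 0 *: col j (Du z) + Dp z
             = \sum_(j < 2) col j (Dtau j z),
             taut z + \sum_(j < 2) u z j 0 *: Dtau j z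
             + Qterm b (tau z) (Du z)
             = (eps ^+ 2)^-1 *: (strain (Du z) - tau z) &
             \tr (Du z) = 0]).

Definition admissible (R : realType) (s M : R) (U0 : state R (R * R)) : Prop :=
  [/\ state_Hs s U0, div_free U0.1 & (state_Hs_norm s U0 <= M%:E)%E].

Definition well_posed (R : realType) (eps b s : R) : Prop :=
  forall M : R, 0 < M ->
  exists2 T : R, 0 < T &
  exists Phi : state R (R * R) -> state R (R * (R * R)),
    (forall U0, admissible s M U0 ->
       euler_oldroyd_sol eps b s T U0 (Phi U0) /\
       forall V, euler_oldroyd_sol eps b s T U0 V ->
         \forall z \ae @volume R, cylinder T z ->
           V.1 z = (Phi U0).1 z /\ V.2 z = (Phi U0).2 z) /\
    (forall U0, admissible s M U0 ->
       forall e : R, 0 < e ->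
       exists2 d : R, 0 < d &
         forall V0, admissible s M V0 ->
           (state_Hs_norm s (state_sub V0 U0) < d%:E)%E ->
           (LinfHs_norm s T (state_sub (Phi V0) (Phi U0)) < e%:E)%E).

Definition ill_posed (R : realType) (eps b s : R) : Prop :=
  ~ well_posed eps b s.

(* Main.v *)
Require Import Defs.
From HB Require Import structures.
From mathcomp Require Import all_boot all_order all_algebra.
From mathcomp Require Import all_classical all_reals all_analysis.
From mathcomp Require Import ess_sup_inf measurable_realfun real_interval archimedean ring lra.
Set Implicit Arguments.
Unset Strict Implicit.
Unset Printing Implicit Defensive.
Import Order.TTheory GRing.Theory Num.Theory.
Import numFieldNormedType.Exports.
Local Open Scope classical_set_scope.
Local Open Scope ring_scope.

(** * A1 *)

Section bounded_factor.
Context d (T : measurableType d) (R : realType).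
Variable mu : {measure set T -> \bar R}.

Lemma ae_imp (P Q : T -> Prop) : (\forall x \ae mu, P x) ->
  (forall x, P x -> Q x) -> \forall x \ae mu, Q x.
Proof. by move=> aeP PQ; apply: filterS aeP. Qed.

Lemma ae_and (P Q : T -> Prop) : (\forall x \ae mu, P x) ->
  (\forall x \ae mu, Q x) -> \forall x \ae mu, P x /\ Q x.
Proof. by move=> aeP aeQ; apply: filterS2 aeP aeQ. Qed.

Lemma integrableMb (D : set T) (f g : T -> R) (C : R) : measurable D ->
  mu.-integrable D (EFin \o f) -> measurable_fun D g ->
  (forall x, D x -> `|g x| <= C) ->
  mu.-integrable D (EFin \o (fun x => f x * g x)).
Proof.
move=> mD fi mg gC.
have -> : EFin \o (fun x => f x * g x) = ((EFin \o f) \* (EFin \o g))%E.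
  by apply/funext => x.
apply: integrableMl => //.
exists C; split; first exact: num_real.
by move=> M CM x Dx /=; rewrite (le_trans (gC x Dx))// ltW.
Qed.

Lemma integrable_bounded (D : set T) (g : T -> R) (C : R) : measurable D ->
  (mu D < +oo)%E -> measurable_fun D g -> (forall x, D x -> `|g x| <= C) ->
  mu.-integrable D (EFin \o g).
Proof.
move=> mD Doo mg gC; apply: measurable_bounded_integrable => //.
exists C; split; first exact: num_real.
by move=> M CM x Dx /=; rewrite (le_trans (gC x Dx))// ltW.
Qed.

Lemma integrableDr (D : set T) (f g : T -> R) : measurable D ->
  mu.-integrable D (EFin \o f) -> mu.-integrable D (EFin \o g) ->
  mu.-integrable D (EFin \o (fun x => f x + g x)).
Proof. by move=> mD fi gi; exact: (integrableD mD fi gi). Qed.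

Lemma integrableBr (D : set T) (f g : T -> R) : measurable D ->
  mu.-integrable D (EFin \o f) -> mu.-integrable D (EFin \o g) ->
  mu.-integrable D (EFin \o (fun x => f x - g x)).
Proof. by move=> mD fi gi; exact: (integrableB mD fi gi). Qed.

Lemma integrableZr' (D : set T) (f : T -> R) k : measurable D ->
  mu.-integrable D (EFin \o f) ->
  mu.-integrable D (EFin \o (fun x => k * f x)).
Proof. by move=> mD fi; exact: (integrableZl mD k fi). Qed.

Lemma integrable_sumr (D : set T) I (r : seq I) (P : pred I) (f : I -> T -> R) :
  measurable D ->
  (forall i, P i -> mu.-integrable D (EFin \o f i)) ->
  mu.-integrable D (EFin \o (fun x => \sum_(i <- r | P i) f i x)).
Proof.
move=> mD fi; have := @integrable_sum _ _ _ mu D mD I r P (fun i => EFin \o f i) fi.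
by apply: eq_integrable => // x _ /=; rewrite sumEFin.
Qed.

Lemma Rintegral_sum (D : set T) I (r : seq I) (P : pred I) (f : I -> T -> R) :
  measurable D ->
  (forall i, P i -> mu.-integrable D (EFin \o f i)) ->
  \int[mu]_(x in D) (\sum_(i <- r | P i) f i x) =
  \sum_(i <- r | P i) \int[mu]_(x in D) f i x.
Proof.
move=> mD fi; elim: r => [|a r IH].
  by under eq_Rintegral do rewrite big_nil; rewrite big_nil Rintegral_cst// mul0r.
rewrite big_cons; under eq_Rintegral do rewrite big_cons.
case: ifPn => // Pa; rewrite RintegralD ?IH//; first exact: fi.
exact: integrable_sumr.
Qed.

Lemma Rintegral_ae_eq (D : set T) (f g : T -> R) : measurable D ->
  measurable_fun D f -> measurable_fun D g ->
  (\forall x \ae mu, D x -> f x = g x) ->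
  \int[mu]_(x in D) f x = \int[mu]_(x in D) g x.
Proof.
move=> mD mf mg fg; congr fine; apply: ae_eq_integral => //.
- exact/measurable_EFinP.
- exact/measurable_EFinP.
- by apply: filterS fg => x fgx Dx /=; rewrite fgx.
Qed.

Lemma integrable_ae_eq (D : set T) (f g : T -> R) : measurable D ->
  measurable_fun D g -> mu.-integrable D (EFin \o f) ->
  (\forall x \ae mu, D x -> f x = g x) ->
  mu.-integrable D (EFin \o g).
Proof.
move=> mD mg fi fg; apply/integrableP; split; first exact/measurable_EFinP.
have /integrableP[mf foo] := fi.
rewrite -(@ae_eq_integral _ _ _ mu _ _ (fun x => `|(EFin \o f) x|)%E)//.
- exact: measurableT_comp.
- by do 2 apply: measurableT_comp => //.
- by apply: filterS fg => x fgx Dx /=; rewrite fgx.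
Qed.

Lemma integrable_measR (D : set T) (f : T -> R) :
  mu.-integrable D (EFin \o f) -> measurable_fun D f.
Proof. by move=> /measurable_int/measurable_EFinP. Qed.

End bounded_factor.

Section rectangle_fubini.
Context d1 d2 (T1 : measurableType d1) (T2 : measurableType d2) (R : realType).
Variable m1 : {sigma_finite_measure set T1 -> \bar R}.
Variable m2 : {sigma_finite_measure set T2 -> \bar R}.
Variables (D1 : set T1) (D2 : set T2).
Hypotheses (mD1 : measurable D1) (mD2 : measurable D2).

Lemma ae_section (P : T1 * T2 -> Prop) :
  (\forall z \ae (m1 \x m2)%E, P z) ->
  \forall x \ae m1, \forall y \ae m2, P (x, y).
Proof.
move=> [N [mN N0 PN]].
have mF : measurable_fun setT (fun x => m2 (xsection N x)).
  exact: measurable_fun_xsection.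
have i0 : (\int[m1]_x m2 (xsection N x))%E = 0%E by rewrite -N0.
have /ae_eq_integral_abs := mF => /(_ m1 measurableT).
move=> -[h _].
have : ae_eq m1 setT (fun x => m2 (xsection N x)) (cst 0%E).
  by apply: h; under eq_integral do rewrite gee0_abs//.
apply: filterS => x /(_ I) /= Nx0.
exists (xsection N x); split => //; first exact: measurable_xsection.
by move=> y /= Pxy; apply/mem_set/PN.
Qed.

Let secE (f : T1 * T2 -> R) x y : D1 x ->
  ((EFin \o f) \_ (D1 `*` D2)) (x, y) = ((fun y => (f (x, y))%:E) \_ D2) y.
Proof.
move=> D1x; rewrite !patchE; case: ifPn => [/set_mem[_ /= ?]|h]; first by rewrite mem_set.
by rewrite ifF//; apply: contraNF h => /set_mem D2y; apply/mem_set.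
Qed.

Let secN (f : T1 * T2 -> R) x y : ~ D1 x ->
  ((EFin \o f) \_ (D1 `*` D2)) (x, y) = 0%E.
Proof. by move=> D1x; rewrite patchE ifF//; apply/negP => /set_mem[]. Qed.

Variable f : T1 * T2 -> R.
Hypothesis fi : (m1 \x m2)%E.-integrable (D1 `*` D2) (EFin \o f).

Let fiT : (m1 \x m2)%E.-integrable setT ((EFin \o f) \_ (D1 `*` D2)).
Proof. exact: (integrable_mkcond (EFin \o f) (measurableX mD1 mD2)).1 fi. Qed.

Lemma ae_integrable_section :
  \forall x \ae m1, D1 x -> m2.-integrable D2 (fun y => (f (x, y))%:E).
Proof.
have := ae_integrable1 fiT; apply: filterS => x h D1x.
apply/integrable_mkcond => //; apply: eq_integrable h => // y _.
exact: secE.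
Qed.

Let FE x : (\int[m2]_y ((EFin \o f) \_ (D1 `*` D2)) (x, y))%E =
  ((fun x => \int[m2]_(y in D2) (f (x, y))%:E)%E \_ D1) x.
Proof.
rewrite patchE; case: ifPn => [/set_mem D1x|/negP h].
  by rewrite [RHS]integral_mkcond; apply: eq_integral => y _; rewrite secE.
rewrite (eq_integral (cst 0%E)) ?integral0// => y _; rewrite secN// => D1x.
by apply: h; exact/mem_set.
Qed.

Let intE : m1.-integrable D1 (fun x => \int[m2]_(y in D2) (f (x, y))%:E)%E.
Proof.
apply/integrable_mkcond => //; have := integrable_fubini_F fiT.
by apply: eq_integrable => // x _; rewrite -FE.
Qed.

Let ae_fin : \forall x \ae m1, D1 x ->
  (\int[m2]_(y in D2) (f (x, y))%:E)%E = (\int[m2]_(y in D2) f (x, y))%:E.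
Proof.
apply: filterS ae_integrable_section => x h D1x.
by rewrite fineK//; exact: integrable_fin_num (h D1x).
Qed.

Lemma measurable_Rint_section :
  measurable_fun D1 (fun x => \int[m2]_(y in D2) f (x, y)).
Proof.
rewrite [X in measurable_fun _ X](_ : _ =
  fine \o (fun x => \int[m2]_(y in D2) (f (x, y))%:E)%E)//.
by apply: measurableT_comp; [exact: fine_measurable|exact: measurable_int intE].
Qed.

Lemma integrable_Rint_section :
  m1.-integrable D1 (EFin \o (fun x => \int[m2]_(y in D2) f (x, y))).
Proof.
have mF := measurable_Rint_section.
apply/integrableP; split; first exact/measurable_EFinP.
have /integrableP[mf foo] := intE.
rewrite -(@ae_eq_integral _ _ _ m1 _ _ (fun x => `|\int[m2]_(y in D2) (f (x, y))%:E|)%E)//.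
- exact: measurableT_comp.
- by do 2 apply: measurableT_comp => //.
- by apply: filterS ae_fin => x h D1x /=; rewrite h.
Qed.

Lemma Rint_section :
  \int[(m1 \x m2)%E]_(z in D1 `*` D2) f z =
  \int[m1]_(x in D1) \int[m2]_(y in D2) f (x, y).
Proof.
rewrite /Rintegral; congr fine.
rewrite integral_mkcond -(integral12_prod_meas1 fiT).
rewrite (eq_integral _ _ (fun x _ => FE x)) -integral_mkcond.
apply: ae_eq_integral => //; first exact: measurable_int intE.
  exact/measurable_EFinP/measurable_Rint_section.
Qed.

End rectangle_fubini.

(** * A2 *)

Section rectangle_fubini2.
Context d1 d2 (T1 : measurableType d1) (T2 : measurableType d2) (R : realType).
Variable m1 : {sigma_finite_measure set T1 -> \bar R}.
Variable m2 : {sigma_finite_measure set T2 -> \bar R}.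
Variables (D1 : set T1) (D2 : set T2).
Hypotheses (mD1 : measurable D1) (mD2 : measurable D2).

Lemma integrable_tensor (k : T1 -> R) (h : T2 -> R) :
  m1.-integrable D1 (EFin \o k) -> m2.-integrable D2 (EFin \o h) ->
  (m1 \x m2)%E.-integrable (D1 `*` D2) (EFin \o (fun z => k z.1 * h z.2)).
Proof.
move=> ki hi.
have kiT : m1.-integrable setT (EFin \o (k \_ D1)).
  have := (@integrable_mkcond _ _ _ m1 D1 (EFin \o k) mD1).1 ki.
  by apply: eq_integrable => // x _; rewrite restrict_EFin.
have hiT : m2.-integrable setT (EFin \o (h \_ D2)).
  have := (@integrable_mkcond _ _ _ m2 D2 (EFin \o h) mD2).1 hi.
  by apply: eq_integrable => // x _; rewrite restrict_EFin.
set k' := k \_ D1 in kiT; set h' := h \_ D2 in hiT.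
have mk : measurable_fun setT k' := integrable_measR kiT.
have mh : measurable_fun setT h' := integrable_measR hiT.
have mf : measurable_fun setT (fun z : T1 * T2 => k' z.1 * h' z.2).
  by apply: measurable_funM; apply: measurableT_comp.
have fi : (m1 \x m2)%E.-integrable setT (EFin \o (fun z => k' z.1 * h' z.2)).
  apply/integrable12ltyP; first exact/measurable_EFinP.
  have /integrableP[_ hfin] := hiT; have /integrableP[mk' kfin] := kiT.
  have hE : (\int[m2]_y `|(EFin \o h') y| = (\int[m2]_y `|h' y|)%:E)%E.
    rewrite /Rintegral fineK//.
    by rewrite ge0_fin_numE//; apply: integral_ge0.
  under eq_integral => x _.
    rewrite (eq_integral (fun y => (`|k' x|)%:E * `|(EFin \o h') y|)%E); last first.
      by move=> y _ /=; rewrite normrM EFinM.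
    rewrite ge0_integralZl//; last by do 2 apply: measurableT_comp => //.
    rewrite hE muleC; over.
  rewrite ge0_integralZl//; last first.
  - by rewrite lee_fin; apply: Rintegral_ge0.
  - by do 2 apply: measurableT_comp => //.
  by apply: lte_mul_pinfty => //; rewrite lee_fin; apply: Rintegral_ge0.
have := (@integrable_mkcond _ _ _ (m1 \x m2)%E (D1 `*` D2)
  (EFin \o (fun z => k z.1 * h z.2)) (measurableX mD1 mD2)).
move=> [_]; apply; apply: eq_integrable fi => // -[x y] _ /=.
rewrite /k' /h' !patchE /=; case: (boolP (x \in D1)) => xD; last first.
  rewrite mul0r ifF//; apply/negbTE; apply: contra xD => /set_mem[/= ? _].
  exact: mem_set.
case: (boolP (y \in D2)) => yD; last first.
  rewrite mulr0 ifF//; apply/negbTE; apply: contra yD => /set_mem[/= _ ?].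
  exact: mem_set.
by rewrite ifT//; apply: mem_set; split; exact: set_mem.
Qed.

Variable f : T1 * T2 -> R.
Hypothesis fi : (m1 \x m2)%E.-integrable (D1 `*` D2) (EFin \o f).

Lemma integrable_swap :
  (m2 \x m1)%E.-integrable (D2 `*` D1) (EFin \o (fun z => f (z.2, z.1))) /\
  \int[(m2 \x m1)%E]_(z in D2 `*` D1) f (z.2, z.1) =
  \int[(m1 \x m2)%E]_(z in D1 `*` D2) f z.
Proof.
have fiT := (@integrable_mkcond _ _ _ (m1 \x m2)%E (D1 `*` D2) (EFin \o f)
   (measurableX mD1 mD2)).1 fi.
set F := (EFin \o f) \_ (D1 `*` D2) in fiT.
have mF : measurable_fun setT F := measurable_int _ fiT.
pose G (z : T2 * T1) := F (z.2, z.1).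
have GE z : G z = ((EFin \o (fun z => f (z.2, z.1))) \_ (D2 `*` D1)) z.
  rewrite /G /F !patchE; case: z => x y /=; congr (if _ then _ else _).
  by apply/idP/idP => /set_mem[/= ? ?]; apply: mem_set.
have mG : measurable_fun setT G.
  by apply: (measurableT_comp mF); exact: measurable_swap.
have Gi : (m2 \x m1)%E.-integrable setT G.
  by apply/(integrable12ltyP _ _ mG)/(integrable21ltyP _ _ mF).
split.
  apply/(@integrable_mkcond _ _ _ (m2 \x m1)%E (D2 `*` D1)); first exact: measurableX.
  by apply: eq_integrable Gi => // z _; rewrite -GE.
rewrite /Rintegral; congr fine; rewrite integral_mkcond [RHS]integral_mkcond.
rewrite -(eq_integral _ _ (fun z _ => GE z)).
by rewrite -(integral12_prod_meas1 Gi) -(integral21_prod_meas1 fiT).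
Qed.

End rectangle_fubini2.

Lemma Rint_swap d1 d2 (T1 : measurableType d1) (T2 : measurableType d2) (R : realType)
  (m1 : {sigma_finite_measure set T1 -> \bar R})
  (m2 : {sigma_finite_measure set T2 -> \bar R}) (D1 : set T1) (D2 : set T2)
  (mD1 : measurable D1) (mD2 : measurable D2) (f : T1 * T2 -> R) :
  (m1 \x m2)%E.-integrable (D1 `*` D2) (EFin \o f) ->
  \int[m1]_(x in D1) \int[m2]_(y in D2) f (x, y) =
  \int[m2]_(y in D2) \int[m1]_(x in D1) f (x, y).
Proof.
move=> fi; have [si sE] := integrable_swap mD1 mD2 fi.
by rewrite -(Rint_section mD1 mD2 fi) -sE (Rint_section mD2 mD1 si).
Qed.

Lemma Rintegral_ae_le d (T : measurableType d) (R : realType)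
  (mu : {measure set T -> \bar R}) (D : set T) (f g : T -> R) : measurable D ->
  mu.-integrable D (EFin \o f) -> mu.-integrable D (EFin \o g) ->
  (\forall x \ae mu, D x -> f x <= g x) ->
  \int[mu]_(x in D) f x <= \int[mu]_(x in D) g x.
Proof.
move=> mD fi gi fg; have mf := integrable_measR fi; have mg := integrable_measR gi.
pose m x := Num.max (f x) (g x).
have mm : measurable_fun D m by exact: measurable_maxr.
have gm : \forall x \ae mu, D x -> g x = m x.
  by apply: ae_imp fg _ => x h Dx; rewrite /m max_r// h.
rewrite (Rintegral_ae_eq mD mg mm gm); apply: le_Rintegral => //.
- exact: integrable_ae_eq gi gm.
- by move=> x _; rewrite /m le_max lexx.
Qed.

(** * B1 *)

Section real_line.
Context {R : realType}.
Notation mu := (@lebesgue_measure R).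
Implicit Types (f F : R -> R) (a b x : R).

Lemma measurable_continuous f (D : set (measurableTypeR R)) : continuous f -> measurable_fun D f.
Proof. by move=> cf; apply: measurable_funTS; exact: continuous_measurable_fun. Qed.

Lemma mu_itv_lty a b (c d : bool) :
  (mu [set` Interval (BSide c a) (BSide d b)] < +oo)%E.
Proof. by rewrite lebesgue_measure_itv/=; case: ifP => //; rewrite ltry. Qed.

Lemma continuous_integrable f a b : continuous f ->
  mu.-integrable `[a, b] (EFin \o f).
Proof.
move=> cf; apply: continuous_compact_integrable; first exact: segment_compact.
by apply: continuous_subspaceT.
Qed.

Lemma Rint_FTC f F a b : a <= b -> continuous f ->
  (forall x, is_derive x 1 F (f x)) -> \int[mu]_(x in `[a, b]) f x = F b - F a.
Proof.
rewrite le_eqVlt => /predU1P[->|ab] cf dF.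
  by rewrite set_itv1 Rintegral_set1 subrr.
have cF : continuous F.
  by move=> x; apply/differentiable_continuous/derivable1_diffP; have [] := dF x.
rewrite /Rintegral (@continuous_FTC2 _ f F)//.
- by apply: continuous_subspaceT.
- split.
  + by move=> x _; have [] := dF x.
  + by apply: cvg_at_right_filter; exact: cF.
  + by apply: cvg_at_left_filter; exact: cF.
- by move=> x _; rewrite derive1E; have [_] := dF x.
Qed.

Lemma Rint_itvD f a c b : a <= c -> c <= b ->
  mu.-integrable `[a, b] (EFin \o f) ->
  \int[mu]_(x in `[a, b]) f x =
  \int[mu]_(x in `[a, c]) f x + \int[mu]_(x in `[c, b]) f x.
Proof.
move=> ac cb fi; have := @Rintegral_itvB R f (BLeft a) (BRight b) c fi.
rewrite !bnd_simp => /(_ ac cb) h.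
rewrite -(@Rintegral_itv_obnd_cbnd _ c (BRight b)); last first.
  by apply: integrableS fi => //; apply: subset_itvr; rewrite bnd_simp.
by rewrite -h addrC subrK.
Qed.

Lemma Rint_bound (D : set (measurableTypeR R)) f (C : R) : measurable D -> (mu D < +oo)%E ->
  mu.-integrable D (EFin \o f) -> (forall x, D x -> `|f x| <= C) ->
  `|\int[mu]_(x in D) f x| <= C * fine (mu D).
Proof.
move=> mD Doo fi fC; have H := le_normr_Rintegral mD fi; apply: (le_trans H).
rewrite -Rintegral_cst//; apply: le_Rintegral => //.
- exact: integrable_norm.
- by apply: (@integrable_bounded _ _ _ _ _ _ `|C|).
Qed.

Lemma Rint_bound_itv f a b (C : R) : a <= b ->
  mu.-integrable `[a, b] (EFin \o f) -> (forall x, a <= x <= b -> `|f x| <= C) ->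
  `|\int[mu]_(x in `[a, b]) f x| <= C * (b - a).
Proof.
move=> ab fi fC; have := @Rint_bound `[a, b]%classic f C _ (mu_itv_lty _ _ _ _) fi.
rewrite lebesgue_measure_itv/= lte_fin.
rewrite (_ : fine _ = b - a); last by case: ltgtP ab => //= -> _; rewrite subrr.
by apply => // x /=; rewrite in_itv/=; exact: fC.
Qed.

End real_line.

Section fejer.
Context {R : realType}.
Notation mu := (@lebesgue_measure R).
Implicit Types (f : R -> R) (x y : R).

Definition dirichlet m x : R := 1 + 2 * \sum_(1 <= l < m.+1) cos (l%:R * x).
Definition fejer M x : R := \sum_(0 <= m < M) dirichlet m x.

Lemma dirichletE m x :
  (1 - cos x) * dirichlet m x = cos (m%:R * x) - cos (m.+1%:R * x).
Proof.
elim: m => [|m IH].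
  by rewrite /dirichlet big_geq// mulr0 addr0 mulr1 mul0r cos0 mul1r.
have -> : dirichlet m.+1 x = dirichlet m x + 2 * cos (m.+1%:R * x).
  by rewrite /dirichlet big_nat_recr//=; ring.
rewrite mulrDr IH.
have e1 : m.+2%:R * x = m.+1%:R * x + x by rewrite -[in LHS]natr1 mulrDl mul1r.
have e2 : m%:R * x = m.+1%:R * x - x by rewrite -natr1 mulrDl mul1r addrK.
rewrite e1 e2 !cosD cosN sinN; ring.
Qed.

Lemma fejerE M x : (1 - cos x) * fejer M x = 1 - cos (M%:R * x).
Proof.
rewrite /fejer mulr_sumr.
under eq_bigr do rewrite dirichletE -[_ - _]opprK opprB.
by rewrite sumrN telescope_sumr// opprB mul0r cos0.
Qed.

Lemma cos1_mul x (l : nat) : cos x = 1 -> cos (l%:R * x) = 1.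
Proof.
move=> cx; have sx : sin x = 0 by apply: cos1sin0; rewrite cx normr1.
elim: l => [|l IH]; first by rewrite mul0r cos0.
by rewrite -natr1 mulrDl mul1r cosD cx sx IH; ring.
Qed.

Lemma fejer_ge0 M x : 0 <= fejer M x.
Proof.
have := cos_le1 x; rewrite le_eqVlt => /predU1P[c1|c1].
  apply: sumr_ge0 => m _; rewrite /dirichlet addr_ge0// mulr_ge0// sumr_ge0// => l _.
  by rewrite cos1_mul.
rewrite -(pmulr_rge0 _ (_ : 0 < 1 - cos x)) ?subr_gt0//.
by rewrite fejerE subr_ge0 cos_le1.
Qed.

Lemma fejer_le M x e : 0 < e -> e <= 1 - cos x -> fejer M x <= 2 / e.
Proof.
move=> e0 ex; rewrite ler_pdivlMr// mulrC.
apply: (@le_trans _ _ ((1 - cos x) * fejer M x)).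
  by rewrite ler_wpM2r// fejer_ge0.
by rewrite fejerE; have := cos_geN1 (M%:R * x); lra.
Qed.

Lemma continuous_cos_lin (k t : R) : continuous (fun x : R => cos (k * x + t)).
Proof.
move=> x; apply: (@continuous_comp _ _ _ (fun x : R => k * x + t) cos).
  apply: continuousD; last exact: cst_continuous.
  exact: mulrl_continuous.
exact: continuous_cos.
Qed.

Lemma continuous_sin_lin (k t : R) : continuous (fun x : R => sin (k * x + t)).
Proof.
move=> x; apply: (@continuous_comp _ _ _ (fun x : R => k * x + t) sin).
  apply: continuousD; last exact: cst_continuous.
  exact: mulrl_continuous.
exact: continuous_sin.
Qed.

Lemma continuous_sumr I (r : seq I) (g : I -> R -> R) :
  (forall i, continuous (g i)) -> continuous (fun x => \sum_(i <- r) g i x).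
Proof.
move=> cg; elim: r => [|i r IH].
  by under eq_fun do rewrite big_nil; exact: cst_continuous.
by under eq_fun do rewrite big_cons; move=> x; apply: continuousD; [exact: cg|exact: IH].
Qed.

Lemma continuous_fejer M (s y : R) : continuous (fun x => fejer M (s * x + y)).
Proof.
rewrite /fejer; apply: continuous_sumr => m x; rewrite /dirichlet.
apply: cvgD; first exact: cvg_cst.
apply: cvgM; first exact: cvg_cst.
move: x; apply: continuous_sumr => l.
by under eq_fun do rewrite mulrDr mulrA; exact: continuous_cos_lin.
Qed.

Lemma is_derive_lin (k t x : R) : is_derive x 1 (fun x : R => k * x + t) k.
Proof. by apply: is_derive_eq; rewrite ?scaler0 ?addr0/= /GRing.scale/= mulr1. Qed.

Lemma is_derive_sin_lin (k t x : R) :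
  is_derive x 1 (fun x : R => sin (k * x + t)) (k * cos (k * x + t)).
Proof.
have := is_derive_lin k t x => dl.
rewrite mulrC; exact: (@is_derive1_comp _ sin (fun x => k * x + t)).
Qed.

Lemma is_derive_cos_lin (k t x : R) :
  is_derive x 1 (fun x : R => cos (k * x + t)) (- k * sin (k * x + t)).
Proof.
have := is_derive_lin k t x => dl.
rewrite mulNr mulrC -mulNr; exact: (@is_derive1_comp _ cos (fun x => k * x + t)).
Qed.

Lemma Rint_cos_lin (k t a b : R) : k != 0 -> a <= b ->
  \int[mu]_(x in `[a, b]) cos (k * x + t) = (sin (k * b + t) - sin (k * a + t)) / k.
Proof.
move=> k0 ab; pose F x := k^-1 * sin (k * x + t).
have dF x : is_derive x 1 F (cos (k * x + t)).
  have dl := is_derive_sin_lin k t x.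
  have -> : F = k^-1 \*: (fun x => sin (k * x + t)) by [].
  by apply: is_derive_eq; rewrite /GRing.scale/= mulKf.
by rewrite (Rint_FTC ab (@continuous_cos_lin k t) dF) /F -mulrBr mulrC.
Qed.

Lemma Rint_sin_lin (k t a b : R) : k != 0 -> a <= b ->
  \int[mu]_(x in `[a, b]) sin (k * x + t) = (cos (k * a + t) - cos (k * b + t)) / k.
Proof.
move=> k0 ab; pose F x := - k^-1 * cos (k * x + t).
have dF x : is_derive x 1 F (sin (k * x + t)).
  have dl := is_derive_cos_lin k t x.
  have -> : F = - k^-1 \*: (fun x => cos (k * x + t)) by [].
  by apply: is_derive_eq; rewrite /GRing.scale/= mulNr mulNr mulrN opprK mulKf.
rewrite (Rint_FTC ab (@continuous_sin_lin k t) dF) /F.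
by rewrite !mulNr opprK addrC -mulrBr mulrC.
Qed.

Lemma cos_period (n : nat) (x : R) : cos (x + n%:R * (2 * pi)) = cos x.
Proof.
elim: n => [|n IH]; first by rewrite mul0r addr0.
by rewrite -natr1 mulrDl mul1r addrA {2}[2 * pi]mulr_natl cosD2pi IH.
Qed.

Lemma sin_period (n : nat) (x : R) : sin (x + n%:R * (2 * pi)) = sin x.
Proof.
elim: n => [|n IH]; first by rewrite mul0r addr0.
by rewrite -natr1 mulrDl mul1r addrA {2}[2 * pi]mulr_natl sinD2pi IH.
Qed.

End fejer.

(** * B2 *)

Section fejer_bound.
Context {R : realType}.
Notation mu := (@lebesgue_measure R).
Implicit Types (f : R -> R) (x y : R).

Lemma ae_neq (a : R) : \forall x \ae mu, x <> a.
Proof.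
exists [set a]; split; first exact: measurable_set1.
  exact: lebesgue_measure_set1.
by move=> x /= /contrapT.
Qed.

Lemma measurable_cosl (D : set (measurableTypeR R)) (k : R) :
  measurable_fun D (fun x : R => cos (k * x)).
Proof.
apply: measurable_continuous; have := @continuous_cos_lin R k 0.
by under eq_fun do rewrite addr0.
Qed.

Lemma measurable_sinl (D : set (measurableTypeR R)) (k : R) :
  measurable_fun D (fun x : R => sin (k * x)).
Proof.
apply: measurable_continuous; have := @continuous_sin_lin R k 0.
by under eq_fun do rewrite addr0.
Qed.

Lemma integrable_trig_poly (D : set (measurableTypeR R)) (w : R -> R) m (p0 : R) (p q : nat -> R) :
  measurable D -> mu.-integrable D (EFin \o w) ->
  mu.-integrable D (EFin \o (fun x => w x *
    (p0 + 2 * \sum_(1 <= l < m.+1) (p l * cos (l%:R * x) + q l * sin (l%:R * x))))).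
Proof.
move=> mD wi.
pose C := `|p0| + 2 * \sum_(1 <= l < m.+1) (`|p l| + `|q l|).
apply: (integrableMb (C := C)) => //.
  apply: measurable_funD => //; apply: measurable_funM => //.
  apply: measurable_sum => l.
  by apply: measurable_funD; apply: measurable_funM => //;
    [exact: measurable_cosl|exact: measurable_sinl].
move=> x _; rewrite /C (le_trans (ler_normD _ _))// lerD2l normrM ger0_norm//.
rewrite ler_pM2l// (le_trans (ler_norm_sum _ _ _))// ler_sum// => l _.
rewrite (le_trans (ler_normD _ _))// !normrM lerD// ler_piMr// ?cos_max ?sin_max//.
Qed.

Lemma Rint_trig_poly (D : set (measurableTypeR R)) (w : R -> R) m (p0 : R) (p q : nat -> R) :
  measurable D -> mu.-integrable D (EFin \o w) ->
  \int[mu]_(x in D) (w x *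
    (p0 + 2 * \sum_(1 <= l < m.+1) (p l * cos (l%:R * x) + q l * sin (l%:R * x)))) =
  p0 * \int[mu]_(x in D) w x + 2 * \sum_(1 <= l < m.+1)
    (p l * \int[mu]_(x in D) (w x * cos (l%:R * x)) +
     q l * \int[mu]_(x in D) (w x * sin (l%:R * x))).
Proof.
move=> mD wi.
have ci l : mu.-integrable D (EFin \o (fun x => w x * cos (l%:R * x))).
  by apply: (integrableMb (C := 1)) => // [|x _]; [exact: measurable_cosl|exact: cos_max].
have si l : mu.-integrable D (EFin \o (fun x => w x * sin (l%:R * x))).
  by apply: (integrableMb (C := 1)) => // [|x _]; [exact: measurable_sinl|exact: sin_max].
have li l : mu.-integrable D (EFin \o (fun x =>
   p l * (w x * cos (l%:R * x)) + q l * (w x * sin (l%:R * x)))).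
  by apply: integrableDr => //; exact: integrableZr'.
transitivity (\int[mu]_(x in D) (p0 * w x + 2 * \sum_(1 <= l < m.+1)
   (p l * (w x * cos (l%:R * x)) + q l * (w x * sin (l%:R * x))))).
  apply: eq_Rintegral => x _; rewrite mulrDr [w x * p0]mulrC; congr (_ + _).
  by rewrite mulrCA; congr (_ * _); rewrite mulr_sumr; apply: eq_bigr => l _; ring.
rewrite RintegralD//; last 2 first.
- exact: integrableZr'.
- by apply: integrableZr' => //; exact: integrable_sumr.
rewrite RintegralZl//; congr (_ + _).
rewrite RintegralZl//; last exact: integrable_sumr.
rewrite Rintegral_sum//; congr (_ * _); apply: eq_bigr => l _.
rewrite RintegralD//; last 2 first.
- exact: integrableZr'.
- exact: integrableZr'.
by rewrite !RintegralZl.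
Qed.

Lemma dirichletB m x y : dirichlet m (x - y) =
  1 + 2 * \sum_(1 <= l < m.+1)
    (cos (l%:R * y) * cos (l%:R * x) + sin (l%:R * y) * sin (l%:R * x)).
Proof.
rewrite /dirichlet; congr (_ + _ * _); apply: eq_bigr => l _.
by rewrite mulrBr cosB mulrC [sin _ * _]mulrC.
Qed.

Definition cosmode f (l : nat) := \int[mu]_(x in `[0, 2 * pi]) (f x * cos (l%:R * x)).
Definition sinmode f (l : nat) := \int[mu]_(x in `[0, 2 * pi]) (f x * sin (l%:R * x)).

Definition fourier_partial f m x : R :=
  \int[mu]_(x in `[0, 2 * pi]) f x + 2 * \sum_(1 <= l < m.+1)
    (cosmode f l * cos (l%:R * x) + sinmode f l * sin (l%:R * x)).

Let fi_one a b : mu.-integrable `[a, b] (EFin \o (fun _ => 1)).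
Proof. by apply: continuous_integrable => x; exact: cst_continuous. Qed.

Definition fejer_mass M a b y := \int[mu]_(x in `[a, b]) fejer M (x - y).

Let fejer_intg M a b y : mu.-integrable `[a, b] (EFin \o (fun x => fejer M (x - y))).
Proof.
apply: continuous_integrable; have := @continuous_fejer R M 1 (- y).
by under eq_fun do rewrite mul1r.
Qed.

Let dirichlet_intg m a b y : mu.-integrable `[a, b] (EFin \o (fun x => dirichlet m (x - y))).
Proof.
have := @integrable_trig_poly `[a, b] (fun _ => 1) m 1
  (fun l => cos (l%:R * y)) (fun l => sin (l%:R * y)).
move=> /(_ (measurable_itv _) (fi_one a b)); apply: eq_integrable => // x _ /=.
by rewrite mul1r dirichletB.
Qed.

Lemma fejer_massE M a b y : fejer_mass M a b y =
  \sum_(0 <= m < M) (\int[mu]_(x in `[a, b]) 1 + 2 * \sum_(1 <= l < m.+1)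
    (\int[mu]_(x in `[a, b]) (1 * cos (l%:R * x)) * cos (l%:R * y) +
     \int[mu]_(x in `[a, b]) (1 * sin (l%:R * x)) * sin (l%:R * y))).
Proof.
rewrite /fejer_mass /fejer Rintegral_sum//.
apply: eq_bigr => m _; rewrite -[X in X + _]mul1r.
under [X in _ = _ + 2 * X]eq_bigr do rewrite mulrC [X in _ + X]mulrC.
rewrite -(Rint_trig_poly m 1 (fun l => cos (l%:R * y)) (fun l => sin (l%:R * y)))//.
by apply: eq_Rintegral => x _; rewrite mul1r dirichletB.
Qed.

Lemma Rint_fejer_mass f M a b : mu.-integrable `[0, 2 * pi] (EFin \o f) ->
  \int[mu]_(y in `[0, 2 * pi]) (f y * fejer_mass M a b y) =
  \sum_(0 <= m < M) \int[mu]_(x in `[a, b]) fourier_partial f m x.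
Proof.
move=> fi; under eq_Rintegral do rewrite fejer_massE mulr_sumr.
rewrite Rintegral_sum//; last by move=> m _; exact: integrable_trig_poly.
apply: eq_bigr => m _; rewrite Rint_trig_poly//.
have -> : \int[mu]_(x in `[a, b]) fourier_partial f m x =
    \int[mu]_(x in `[a, b]) (1 * (\int[mu]_(x in `[0, 2 * pi]) f x +
      2 * \sum_(1 <= l < m.+1)
        (cosmode f l * cos (l%:R * x) + sinmode f l * sin (l%:R * x)))).
  by apply: eq_Rintegral => x _; rewrite mul1r.
rewrite Rint_trig_poly//; congr (_ + _); first exact: mulrC.
by congr (_ * _); apply: eq_bigr => l _; rewrite mulrC [X in _ + X]mulrC.
Qed.

Lemma fejer_mass_total M y : fejer_mass M 0 (2 * pi) y = M%:R * (2 * pi).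
Proof.
have p0 : 0 <= 2 * pi :> R by rewrite mulr_ge0// pi_ge0.
rewrite fejer_massE (eq_bigr (fun _ => 2 * pi)) => [|m _].
  by rewrite sumr_const_nat subn0 [RHS]mulr_natl.
rewrite (@Rint_FTC R (fun _ => 1) id 0 _ p0); last by move=> x; exact: cst_continuous.
rewrite big_nat big1 ?mulr0 ?addr0 => [|l /andP[l1 _]]; first by rewrite subr0.
have l0 : l%:R != 0 :> R by rewrite pnatr_eq0 -lt0n.
have -> : \int[mu]_(x in `[0, 2 * pi]) (1 * cos (l%:R * x)) = 0.
  have := @Rint_cos_lin R l%:R 0 0 (2 * pi) l0 p0.
  under eq_Rintegral do rewrite addr0 -[cos _]mul1r.
  by move=> ->; rewrite mulr0 !addr0 -[X in sin X]add0r sin_period sin0 subrr mul0r.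
have -> : \int[mu]_(x in `[0, 2 * pi]) (1 * sin (l%:R * x)) = 0.
  have := @Rint_sin_lin R l%:R 0 0 (2 * pi) l0 p0.
  under eq_Rintegral do rewrite addr0 -[sin _]mul1r.
  by move=> ->; rewrite mulr0 !addr0 -[X in _ - cos X]add0r cos_period cos0 subrr mul0r.
by rewrite !mul0r addr0.
Qed.

Lemma cos_lt1 (z : R) : 0 < `|z| -> `|z| < 2 * pi -> cos z < 1.
Proof.
move=> z0 zp; rewrite -cos_norm; set t := `|z| / 2.
have -> : `|z| = t *+ 2 by rewrite /t -mulr_natr divfK.
rewrite cos_mulr2n cos2sin2.
have st : 0 < sin t.
  by apply: sin_gt0_pi; rewrite /t divr_gt0//= ltr_pdivrMr// mulrC.
have : 0 < sin t ^+ 2 by rewrite exprn_gt0.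
rewrite mulr2n; lra.
Qed.

Lemma fejer_mass_ge0 M a b y : 0 <= fejer_mass M a b y.
Proof. by apply: Rintegral_ge0 => x _; exact: fejer_ge0. Qed.

Lemma fejer_mass_off a b y : 0 <= a -> a <= b -> b <= 2 * pi -> 0 < y < 2 * pi ->
  ~~ (a <= y <= b) -> exists K, forall M, fejer_mass M a b y <= K.
Proof.
move=> a0 ab b2 /andP[y0 y2] yab.
have [c cab cmin] : exists2 c, c \in `[a, b]%R &
    forall t, t \in `[a, b]%R -> 1 - cos (c - y) <= 1 - cos (t - y).
  apply: EVT_min => //; apply: continuous_subspaceT => x.
  apply: cvgB; first exact: cvg_cst.
  by have := @continuous_cos_lin R 1 (- y) x; under eq_fun do rewrite mul1r.
move: cab; rewrite in_itv/= => /andP[ac cb].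
have cy : cos (c - y) < 1.
  apply: cos_lt1; last by rewrite ltr_norml; lra.
  rewrite normr_gt0 subr_eq0; apply: contraNneq yab => <-.
  by rewrite ac cb.
have e0 : 0 < 1 - cos (c - y) by rewrite subr_gt0.
exists (2 / (1 - cos (c - y)) * (b - a)) => M.
rewrite (le_trans (ler_norm _))//; apply: Rint_bound_itv => // x xab.
rewrite ger0_norm ?fejer_ge0//; apply: fejer_le => //; exact: cmin.
Qed.

End fejer_bound.

(** * B3 *)

Section fejer_bound2.
Context {R : realType}.
Notation mu := (@lebesgue_measure R).
Implicit Types (f : R -> R) (x y : R).

Lemma cvg_harmonic_bound (u : nat -> R) (l K : R) :
  (forall n, `|u n - l| <= K * n.+1%:R^-1) -> u @ \oo --> l.
Proof.
move=> ul; apply/(cvg_sub0 (f := u) (g := fun _ => l)); last exact: cvg_cst.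
have K0 : (fun n => K * n.+1%:R^-1) @ \oo --> (0 : R).
  by rewrite -(mulr0 K); apply: cvgM; [exact: cvg_cst|exact: cvg_harmonic].
apply/norm_cvg0P; apply: (squeeze_cvgr _ (cvg_cst 0) K0).
by near=> n; rewrite /= normr_ge0/=; exact: ul.
Unshelve. all: by end_near. Qed.

Definition fejer_mean n a b y : R := fejer_mass n.+1 a b y / (n.+1%:R * (2 * pi)).

Let intg M a b y : mu.-integrable `[a, b] (EFin \o (fun x => fejer M (x - y))).
Proof.
apply: continuous_integrable; have := @continuous_fejer R M 1 (- y).
by under eq_fun do rewrite mul1r.
Qed.

Let twopi_gt0 : 0 < 2 * pi :> R. Proof. by rewrite mulr_gt0// pi_gt0. Qed.

Lemma fejer_mean_total a b y n : 0 <= a -> a <= b -> b <= 2 * pi ->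
  fejer_mean n a b y = 1 - fejer_mean n 0 a y - fejer_mean n b (2 * pi) y.
Proof.
move=> a0 ab b2; have := fejer_mass_total n.+1 y.
rewrite /fejer_mass (@Rint_itvD _ _ 0 a)//; last exact: le_trans ab b2.
rewrite (@Rint_itvD _ _ a b)// -!/(fejer_mass _ _ _ _) => h.
have N0 : n.+1%:R * (2 * pi) != 0 :> R by rewrite mulf_neq0// gt_eqF.
by rewrite /fejer_mean; apply: (mulIf N0); rewrite !mulrBl !divfK// mul1r -h; ring.
Qed.

Lemma fejer_mean_ge0 a b y n : 0 <= fejer_mean n a b y.
Proof. by rewrite /fejer_mean divr_ge0 ?fejer_mass_ge0// mulr_ge0// ltW. Qed.

Lemma fejer_mean_le1 a b y n : 0 <= a -> a <= b -> b <= 2 * pi ->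
  fejer_mean n a b y <= 1.
Proof.
move=> a0 ab b2; rewrite fejer_mean_total//.
have := fejer_mean_ge0 0 a y n; have := fejer_mean_ge0 b (2 * pi) y n; lra.
Qed.

Lemma fejer_mean_off a b y : 0 <= a -> a <= b -> b <= 2 * pi -> 0 < y < 2 * pi ->
  ~~ (a <= y <= b) -> exists K, forall n, fejer_mean n a b y <= K * n.+1%:R^-1.
Proof.
move=> a0 ab b2 y2 /(fejer_mass_off a0 ab b2 y2)[K hK]; exists (K / (2 * pi)) => n.
by rewrite /fejer_mean invfM [X in _ * X]mulrC mulrA ler_wpM2r// ler_wpM2r// invr_ge0 ltW.
Qed.

Lemma fejer_mean_cvg (a b y : R) : 0 <= a -> a <= b -> b <= 2 * pi -> 0 < y < 2 * pi ->
  y <> a -> y <> b -> fejer_mean n a b y @[n --> \oo] --> (\1_`]a, b[ y : R).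
Proof.
move=> a0 ab b2 y2 ya yb; rewrite indicE mem_setE in_itv/=.
have [/andP[ay yb']|ayb] := boolP (a < y < b).
  have [K1 h1] : exists K, forall n, fejer_mean n 0 a y <= K * n.+1%:R^-1.
    apply: fejer_mean_off => //; first exact: le_trans ab b2.
    by rewrite negb_and -!ltNge ay orbT.
  have [K2 h2] : exists K, forall n, fejer_mean n b (2 * pi) y <= K * n.+1%:R^-1.
    apply: fejer_mean_off => //; first exact: le_trans a0 ab.
    by rewrite negb_and -!ltNge yb'.
  apply: (@cvg_harmonic_bound _ _ (K1 + K2)) => n.
  rewrite fejer_mean_total//; have := h1 n; have := h2 n.
  have := fejer_mean_ge0 0 a y n; have := fejer_mean_ge0 b (2 * pi) y n.
  rewrite [X in `|_ - X|](_ : _ = 1)// [(K1 + K2) * _]mulrDl ler_norml; move: (K1 * _) (K2 * _) => *; lra.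
have [|K hK] := fejer_mean_off a0 ab b2 y2.
  apply: contra ayb => /andP[]; rewrite !le_eqVlt => /predU1P[/esym//|->].
  by move=> /predU1P[//|->].
apply: (@cvg_harmonic_bound _ _ K) => n.
by rewrite subr0 ger0_norm ?fejer_mean_ge0.
Qed.

Variables (f : R -> R) (e : R).
Hypothesis fi : mu.-integrable `[0, 2 * pi] (EFin \o f).
Hypothesis fe : forall m x, `|fourier_partial f m x| <= 2 * pi * e.

Lemma continuous_fourier_partial m : continuous (fourier_partial f m).
Proof.
move=> x; apply: cvgD; first exact: cvg_cst.
apply: cvgM; first exact: cvg_cst.
move: x; apply: continuous_sumr => l x.
apply: cvgD; (apply: cvgM; first exact: cvg_cst).
  by have := @continuous_cos_lin R l%:R 0 x; under eq_fun do rewrite addr0.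
by have := @continuous_sin_lin R l%:R 0 x; under eq_fun do rewrite addr0.
Qed.

Lemma continuous_fejer_mass M (a b : R) : continuous (fejer_mass M a b).
Proof.
rewrite (funext (fejer_massE M a b)).
apply: continuous_sumr => m x; apply: cvgD; first exact: cvg_cst.
apply: cvgM; first exact: cvg_cst.
move: x; apply: continuous_sumr => l x.
apply: cvgD; (apply: cvgM; first exact: cvg_cst).
  by have := @continuous_cos_lin R l%:R 0 x; under eq_fun do rewrite addr0.
by have := @continuous_sin_lin R l%:R 0 x; under eq_fun do rewrite addr0.
Qed.

Let fejer_mean_meas n (a b : R) (D : set (measurableTypeR R)) : measurable_fun D (fejer_mean n a b).
Proof.
rewrite /fejer_mean; apply: measurable_funM => //.
by apply: measurable_continuous; exact: continuous_fejer_mass.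
Qed.

Lemma Rint_fejer_mean n a b : 0 <= a -> a <= b -> b <= 2 * pi ->
  `|\int[mu]_(y in `[0, 2 * pi]) (f y * fejer_mean n a b y)| <= e * (b - a).
Proof.
move=> a0 ab b2.
have i1 : mu.-integrable `[0, 2 * pi] (EFin \o (fun y => f y * fejer_mass n.+1 a b y)).
  apply: (integrableMb (C := n.+1%:R * (2 * pi))) => //.
    by apply: measurable_continuous; exact: continuous_fejer_mass.
  move=> x _; rewrite ger0_norm ?fejer_mass_ge0//.
  by rewrite -[leRHS]mul1r -ler_pdivrMr ?mulr_gt0 ?pi_gt0//; exact: fejer_mean_le1.
under eq_Rintegral do rewrite /fejer_mean (mulrA (f _)).
have N0 : 0 < n.+1%:R * (2 * pi) :> R by rewrite mulr_gt0.
rewrite RintegralZr// Rint_fejer_mass// normrM normfV (gtr0_norm N0).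
rewrite ler_pdivrMr// (le_trans (ler_norm_sum _ _ _))//.
apply: (@le_trans _ _ (\sum_(0 <= m < n.+1) 2 * pi * e * (b - a))).
  apply: ler_sum => m _; apply: Rint_bound_itv => //.
  by apply: continuous_integrable; exact: continuous_fourier_partial.
by rewrite sumr_const_nat subn0 -mulr_natl; lra.
Qed.

Lemma Rint_itv_bound a b : 0 <= a -> a <= b -> b <= 2 * pi ->
  `|\int[mu]_(y in `[a, b]) f y| <= e * (b - a).
Proof.
move=> a0 ab b2; pose D := `[0, 2 * pi]%classic : set (measurableTypeR R).
have sub : `]a, b[ `<=` D.
  by move=> x; rewrite /D/= !in_itv/= => /andP[ax xb]; rewrite (le_trans a0 (ltW ax)) (le_trans (ltW xb)).
have mf : measurable_fun D f := integrable_measR fi.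
have lim1 : \int[mu]_(y in `[a, b]) f y = \int[mu]_(y in D) (f y * \1_`]a, b[ y).
  transitivity (\int[mu]_(y in `]a, b[) f y).
    rewrite -Rintegral_itv_bndo_bndc; last first.
      apply: integrableS fi => //; apply: subset_itv => //; rewrite bnd_simp//.
    rewrite -Rintegral_itv_obnd_cbnd//.
    by apply: integrableS fi.
  rewrite Rintegral_mkcond [RHS]Rintegral_mkcond; apply: eq_Rintegral => x _.
  rewrite !patchE indicE; have [xab|xab] := boolP (x \in `]a, b[%classic).
    by rewrite mem_set ?mulr1//; exact/sub/set_mem.
  by case: ifP; rewrite ?mulr0.
pose u n y := (f y * fejer_mean n a b y)%:E.
have [] := @dominated_convergence _ _ _ mu D (measurable_itv _) u
  (fun y => (f y * \1_`]a, b[ y)%:E) (fun y => `|f y|%:E).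
- by move=> n; apply/measurable_EFinP; apply: measurable_funM.
- by apply/measurable_EFinP; apply: measurable_funM.
- apply: ae_imp (ae_and (ae_and (ae_neq a) (ae_neq b)) (ae_and (ae_neq 0) (ae_neq (2 * pi)))) _.
  move=> y [[ya yb] [/eqP y0 /eqP y2]]; rewrite /D/= in_itv/= => /andP[y0' y2'].
  apply: cvg_EFin; first exact: nearW.
  apply: cvgM; first exact: cvg_cst.
  by apply: fejer_mean_cvg => //; rewrite !lt_neqAle eq_sym y0 y0' y2.
- exact: integrable_norm fi.
- apply: aeW => y n _; rewrite /u /= lee_fin normrM ler_piMr//.
  by rewrite ger0_norm ?fejer_mean_ge0 ?fejer_mean_le1.
move=> lint _ lim2.
have lc : \int[mu]_(y in D) (f y * fejer_mean n a b y) @[n --> \oo] -->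
    \int[mu]_(y in D) (f y * \1_`]a, b[ y).
  apply: (@fine_cvg _ _ _ _ (fun n => \int[mu]_(y in D) (f y * fejer_mean n a b y)%:E)%E).
  rewrite fineK; [exact: lim2|].
  have mD : measurable D by exact: measurable_itv.
  exact: (integrable_fin_num mD lint).
rewrite lim1.
have : `|\int[mu]_(y in D) (f y * fejer_mean n a b y)| @[n --> \oo] -->
   `|\int[mu]_(y in D) (f y * \1_`]a, b[ y)| by exact: cvg_norm.
move=> /cvg_lim <-//; apply: limr_le.
  by apply/cvg_ex; eexists; apply: cvg_norm lc.
by apply: nearW => n; exact: Rint_fejer_mean.
Qed.

End fejer_bound2.

(** * B4 *)

Section fourier_bound.
Context {R : realType}.
Notation mu := (@lebesgue_measure R).
Implicit Types (f : R -> R) (x y : R).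

Lemma ae_le_of_Rint_le f (a b e : R) :
  mu.-integrable `[a, b] (EFin \o f) ->
  (forall u v, a < u -> u <= v -> v < b ->
     `|\int[mu]_(y in `[u, v]) f y| <= e * (v - u)) ->
  \forall x \ae mu, `]a, b[%classic x -> `|f x| <= e.
Proof.
move=> fi fe; pose D := `[a, b]%classic : set (measurableTypeR R).
have mD : measurable D by exact: measurable_itv.
pose g := f \_ D.
have gi : mu.-integrable setT (EFin \o g).
  have := (@integrable_mkcond _ (measurableTypeR R) _ mu D (EFin \o f) mD).1 fi.
  by apply: eq_integrable => // x _; rewrite /g restrict_EFin.
have gl : locally_integrable setT g := integrable_locally mD fi.
have gia y : mu.-integrable [set` Interval -oo%O (BRight y)] (EFin \o g).
  by apply: integrableS gi.
have gE u v : a < u -> v < b ->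
    \int[mu]_(y in `[u, v]) g y = \int[mu]_(y in `[u, v]) f y.
  move=> au vb; apply: eq_Rintegral => x /set_mem/=; rewrite in_itv/= => /andP[ux xv].
  by rewrite /g patchE mem_set// /D/= in_itv/= (le_trans (ltW au))// (le_trans xv)// ltW.
apply: ae_imp (FTC1Ny gia gl) _ => x [dF Fg] /=; rewrite in_itv/= => /andP[ax xb].
have -> : f x = g x by rewrite /g patchE mem_set// /D/= in_itv/= !ltW.
rewrite -Fg; set F := (F in derivable F _ _) in dF *.
have Fe u v : a < u -> u <= v -> v < b -> `|F v - F u| <= e * (v - u).
  move=> au uv vb; rewrite /F (Rintegral_itvB (gia v))//.
  rewrite Rintegral_itv_obnd_cbnd; last by apply: integrableS gi.
  by rewrite gE//; exact: fe.
rewrite derive1E.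
have : `|h^-1 *: (F (h *: 1 + x) - F x)| @[h --> 0^'] --> `|'D_1 F x|.
  by apply: cvg_norm; exact: dF.
move=> hc; rewrite -(cvg_lim _ hc)//; apply: limr_le; first by apply/cvg_ex; eexists; exact: hc.
have d0 : 0 < Num.min (x - a) (b - x) by rewrite lt_min !subr_gt0 ax.
near=> t.
have t0 : t != 0 by near: t; exact: nbhs_dnbhs_neq.
have : `|t| < Num.min (x - a) (b - x).
  near: t; apply: dnbhs0_lt; exact: d0.
rewrite lt_min => /andP[ta tb]; rewrite /GRing.scale/= mulr1 normrM normfV.
rewrite ler_pdivrMl ?normr_gt0//.
have [tp|tn] := ltP 0 t.
  rewrite (gtr0_norm tp) mulrC in ta tb *.
  by apply: le_trans (Fe _ _ _ _ _) _; rewrite ?addrK; lra.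
rewrite (ler0_norm tn) in ta tb *.
rewrite distrC mulrC; apply: le_trans (Fe _ _ _ _ _) _; first lra.
- lra.
- lra.
by rewrite opprD addrA addrC addrA addNr add0r.
Unshelve. all: by end_near. Qed.

Theorem fourier_partial_ae_bound f (e : R) :
  mu.-integrable `[0, 2 * pi] (EFin \o f) ->
  (forall m x, `|fourier_partial f m x| <= 2 * pi * e) ->
  \forall x \ae mu, `[0, 2 * pi]%classic x -> `|f x| <= e.
Proof.
move=> fi fe; have h : \forall x \ae mu, `]0, 2 * pi[%classic x -> `|f x| <= e.
  apply: ae_le_of_Rint_le => // u v u0 uv v2.
  exact: (Rint_itv_bound fi fe (ltW u0) uv (ltW v2)).
apply: ae_imp (ae_and h (ae_and (ae_neq 0) (ae_neq (2 * pi)))) _.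
move=> x [+ [/eqP x0 /eqP x2]] /=; rewrite !in_itv/= => + /andP[x0' x2'].
by apply; rewrite in_itv/= !lt_neqAle x0' x2' x2 eq_sym x0.
Qed.

Corollary fourier_uniqueness f :
  mu.-integrable `[0, 2 * pi] (EFin \o f) ->
  (forall l, cosmode f l = 0) -> (forall l, sinmode f l = 0) ->
  \forall x \ae mu, `[0, 2 * pi]%classic x -> f x = 0.
Proof.
move=> fi c0 s0; have h : forall m x, `|fourier_partial f m x| <= 2 * pi * 0.
  move=> m x; rewrite mulr0 /fourier_partial big1 ?mulr0 ?addr0 => [|l _]; last first.
    by rewrite c0 s0 !mul0r addr0.
  have := c0 0; rewrite /cosmode; under eq_Rintegral do rewrite mul0r cos0 mulr1.
  by move=> ->; rewrite normr0.
apply: ae_imp (fourier_partial_ae_bound fi h) _ => x + xD.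
by move=> /(_ xD); rewrite normr_le0 => /eqP.
Qed.

End fourier_bound.

(** * C1 *)

Section cell.
Context {R : realType}.
Notation mu := (@lebesgue_measure R).
Notation leb := (@lebesgue_measure R).
Notation P2 := (measurableTypeR R * measurableTypeR R)%type.
Notation I2 := (`[0, 2 * pi]%classic : set (measurableTypeR R)).
Implicit Types (f g : R * R -> R) (k : int * int).

Lemma twopi_gt0 : 0 < 2 * pi :> R. Proof. by rewrite mulr_gt0// pi_gt0. Qed.
Lemma twopi_ge0 : 0 <= 2 * pi :> R. Proof. exact: ltW twopi_gt0. Qed.

Lemma measurable_circle : measurable I2. Proof. exact: measurable_itv. Qed.
Hint Resolve measurable_circle : core.

Lemma measurable_cell : measurable (@cell R : set P2).
Proof. exact: measurableX. Qed.
Hint Resolve measurable_cell : core.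

Lemma mu_circle : mu I2 = (2 * pi)%:E.
Proof. by rewrite lebesgue_measure_itv/= lte_fin twopi_gt0 sube0. Qed.

Lemma area_cell : area (@cell R) = ((2 * pi) ^+ 2)%:E.
Proof.
transitivity (mu I2 * mu I2)%E; last by rewrite mu_circle -EFinM.
exact: (@product_measure1E _ _ _ _ R leb leb I2 I2).
Qed.

Lemma area_cell_lty : (area (@cell R) < +oo)%E.
Proof. by rewrite area_cell ltry. Qed.

Lemma cell_section f : (@area R).-integrable (@cell R) (EFin \o f) ->
  \forall x \ae mu, I2 x -> mu.-integrable I2 (EFin \o (fun y => f (x, y))).
Proof. exact: (@ae_integrable_section _ _ _ _ R leb leb I2 I2). Qed.

Lemma cell_Fubini_integrable f : (@area R).-integrable (@cell R) (EFin \o f) ->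
  mu.-integrable I2 (EFin \o (fun x => \int[mu]_(y in I2) f (x, y))).
Proof. exact: (@integrable_Rint_section _ _ _ _ R leb leb I2 I2). Qed.

Lemma cell_Fubini f : (@area R).-integrable (@cell R) (EFin \o f) ->
  \int[@area R]_(z in @cell R) f z = \int[mu]_(x in I2) \int[mu]_(y in I2) f (x, y).
Proof. exact: (@Rint_section _ _ _ _ R leb leb I2 I2). Qed.

Lemma area_ae_section (P : R * R -> Prop) : (\forall z \ae @area R, P z) ->
  \forall x \ae mu, \forall y \ae mu, P (x, y).
Proof. exact: (@ae_section _ _ _ _ R leb leb P). Qed.

Lemma measurable_phase k (D : set P2) : measurable_fun D (phase k : P2 -> R).
Proof.
apply: measurable_funTS; rewrite /phase.
by apply: measurable_funD; apply: measurable_funM.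
Qed.

Lemma measurable_cos_phase k (D : set P2) :
  measurable_fun D (fun x : P2 => cos (phase k x)).
Proof.
apply: (@measurableT_comp _ _ _ _ _ _ (cos : measurableTypeR R -> R)).
  by apply: measurable_continuous; exact: continuous_cos.
exact: measurable_phase.
Qed.

Lemma measurable_sin_phase k (D : set P2) :
  measurable_fun D (fun x : P2 => sin (phase k x)).
Proof.
apply: (@measurableT_comp _ _ _ _ _ _ (sin : measurableTypeR R -> R)).
  by apply: measurable_continuous; exact: continuous_sin.
exact: measurable_phase.
Qed.

Definition cmode f k : R := \int[@area R]_(x in @cell R) (f x * cos (phase k x)).
Definition smode f k : R := \int[@area R]_(x in @cell R) (f x * sin (phase k x)).

Lemma integrable_cphase f k : (@area R).-integrable (@cell R) (EFin \o f) ->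
  (@area R).-integrable (@cell R) (EFin \o (fun x => f x * cos (phase k x))).
Proof.
move=> fi; apply: (@integrableMb _ _ _ (@area R) _ f _ 1) => //.
  exact: measurable_cos_phase.
by move=> x _; exact: cos_max.
Qed.

Lemma integrable_sphase f k : (@area R).-integrable (@cell R) (EFin \o f) ->
  (@area R).-integrable (@cell R) (EFin \o (fun x => f x * sin (phase k x))).
Proof.
move=> fi; apply: (@integrableMb _ _ _ (@area R) _ f _ 1) => //.
  exact: measurable_sin_phase.
by move=> x _; exact: sin_max.
Qed.

Lemma cmodeD f g k : (@area R).-integrable (@cell R) (EFin \o f) ->
  (@area R).-integrable (@cell R) (EFin \o g) ->
  cmode (fun x => f x + g x) k = cmode f k + cmode g k.
Proof.
move=> fi gi; rewrite /cmode; under eq_Rintegral do rewrite mulrDl.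
by rewrite RintegralD//; exact: integrable_cphase.
Qed.

Lemma smodeD f g k : (@area R).-integrable (@cell R) (EFin \o f) ->
  (@area R).-integrable (@cell R) (EFin \o g) ->
  smode (fun x => f x + g x) k = smode f k + smode g k.
Proof.
move=> fi gi; rewrite /smode; under eq_Rintegral do rewrite mulrDl.
by rewrite RintegralD//; exact: integrable_sphase.
Qed.

Lemma cmodeZ f r k : (@area R).-integrable (@cell R) (EFin \o f) ->
  cmode (fun x => r * f x) k = r * cmode f k.
Proof.
move=> fi; rewrite /cmode; under eq_Rintegral do rewrite -mulrA.
by rewrite RintegralZl//; exact: integrable_cphase.
Qed.

Lemma smodeZ f r k : (@area R).-integrable (@cell R) (EFin \o f) ->
  smode (fun x => r * f x) k = r * smode f k.
Proof.
move=> fi; rewrite /smode; under eq_Rintegral do rewrite -mulrA.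
by rewrite RintegralZl//; exact: integrable_sphase.
Qed.

Lemma cmodeB f g k : (@area R).-integrable (@cell R) (EFin \o f) ->
  (@area R).-integrable (@cell R) (EFin \o g) ->
  cmode (fun x => f x - g x) k = cmode f k - cmode g k.
Proof.
move=> fi gi; rewrite /cmode; under eq_Rintegral do rewrite mulrBl.
by rewrite RintegralB//; exact: integrable_cphase.
Qed.

Lemma smodeB f g k : (@area R).-integrable (@cell R) (EFin \o f) ->
  (@area R).-integrable (@cell R) (EFin \o g) ->
  smode (fun x => f x - g x) k = smode f k - smode g k.
Proof.
move=> fi gi; rewrite /smode; under eq_Rintegral do rewrite mulrBl.
by rewrite RintegralB//; exact: integrable_sphase.
Qed.

(* iterated modes *)
Definition pmode f (u v : R -> R) : R :=
  \int[mu]_(x in I2) (\int[mu]_(y in I2) (f (x, y) * v y) * u x).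

Lemma pmodeE f (u v : R -> R) (fi : (@area R).-integrable (@cell R) (EFin \o f)) :
  continuous u -> continuous v -> (forall x, `|u x| <= 1) -> (forall x, `|v x| <= 1) ->
  pmode f u v = \int[@area R]_(x in @cell R) (f x * (u x.1 * v x.2)) /\
  mu.-integrable I2 (EFin \o (fun x => \int[mu]_(y in I2) (f (x, y) * v y))).
Proof.
move=> cu cv u1 v1.
have mv : measurable_fun (@cell R : set P2) (fun x : P2 => v x.2).
  apply: (@measurableT_comp _ _ _ _ _ _ (v : measurableTypeR R -> R)).
    exact: measurable_continuous.
  by apply: measurable_funTS; exact: measurable_snd.
have mu' : measurable_fun (@cell R : set P2) (fun x : P2 => u x.1).
  apply: (@measurableT_comp _ _ _ _ _ _ (u : measurableTypeR R -> R)).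
    exact: measurable_continuous.
  by apply: measurable_funTS; exact: measurable_fst.
have fvi : (@area R).-integrable (@cell R) (EFin \o (fun x => f x * v x.2)).
  by apply: (@integrableMb _ _ _ (@area R) _ f _ 1).
have fuvi : (@area R).-integrable (@cell R) (EFin \o (fun x => f x * v x.2 * u x.1)).
  by apply: (@integrableMb _ _ _ (@area R) _ (fun x => f x * v x.2) _ 1).
split; last exact: (cell_Fubini_integrable fvi).
transitivity (\int[@area R]_(x in @cell R) (f x * v x.2 * u x.1)); last first.
  by apply: eq_Rintegral => x _; ring.
rewrite cell_Fubini// /pmode; apply: Rintegral_ae_eq => //.
- apply: measurable_funM; last exact: measurable_continuous.
  exact: (integrable_measR (cell_Fubini_integrable fvi)).
- exact: (integrable_measR (cell_Fubini_integrable fuvi)).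
- apply: ae_imp (cell_section fvi) _ => x h xI.
  by rewrite /= RintegralZr//; exact: h.
Qed.

End cell.
#[global] Hint Extern 0 (measurable (@cell _)) => exact: measurable_cell : core.
#[global] Hint Resolve measurable_circle : core.

(** * C2 *)

Section cell_uniqueness.
Context {R : realType}.
Notation mu := (@lebesgue_measure R).
Notation P2 := (measurableTypeR R * measurableTypeR R)%type.
Notation I2 := (`[0, 2 * pi]%classic : set (measurableTypeR R)).
Implicit Types (f g : R * R -> R) (k : int * int).

Definition cosl (l : nat) (x : R) := cos (l%:R * x).
Definition sinl (l : nat) (x : R) := sin (l%:R * x).

Lemma continuous_cosl l : continuous (cosl l).
Proof.
by have := @continuous_cos_lin R l%:R 0; under eq_fun do rewrite addr0.
Qed.

Lemma continuous_sinl l : continuous (sinl l).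
Proof.
by have := @continuous_sin_lin R l%:R 0; under eq_fun do rewrite addr0.
Qed.

Lemma cosl_max l x : `|cosl l x| <= 1. Proof. exact: cos_max. Qed.
Lemma sinl_max l x : `|sinl l x| <= 1. Proof. exact: sin_max. Qed.

Lemma phase_natP (j l : nat) (x : R * R) :
  phase (j%:Z, l%:Z) x = j%:R * x.1 + l%:R * x.2.
Proof. by rewrite /phase /= !pmulrn. Qed.

Lemma phase_natN (j l : nat) (x : R * R) :
  phase (j%:Z, - l%:Z) x = j%:R * x.1 - l%:R * x.2.
Proof. by rewrite /phase /= rmorphN/= mulNr !pmulrn. Qed.

Variable f : R * R -> R.
Hypothesis fi : (@area R).-integrable (@cell R) (EFin \o f).

Lemma pmode_cc j l :
  pmode f (cosl j) (cosl l) = 2^-1 * (cmode f (j%:Z, l%:Z) + cmode f (j%:Z, - l%:Z)).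
Proof.
have [-> _] := pmodeE fi (@continuous_cosl j) (@continuous_cosl l) (@cosl_max j) (@cosl_max l).
rewrite /cmode -RintegralD//; [|exact: integrable_cphase|exact: integrable_cphase].
rewrite -RintegralZl//; last by apply: integrableDr => //; exact: integrable_cphase.
apply: eq_Rintegral => x _; rewrite phase_natP phase_natN !cosD cosN sinN /cosl; by field.
Qed.

Lemma pmode_cs j l :
  pmode f (cosl j) (sinl l) = 2^-1 * (smode f (j%:Z, l%:Z) - smode f (j%:Z, - l%:Z)).
Proof.
have [-> _] := pmodeE fi (@continuous_cosl j) (@continuous_sinl l) (@cosl_max j) (@sinl_max l).
rewrite /smode -RintegralB//; [|exact: integrable_sphase|exact: integrable_sphase].
rewrite -RintegralZl//; last by apply: integrableBr => //; exact: integrable_sphase.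
apply: eq_Rintegral => x _; rewrite phase_natP phase_natN !sinD cosN sinN /cosl /sinl; by field.
Qed.

Lemma pmode_sc j l :
  pmode f (sinl j) (cosl l) = 2^-1 * (smode f (j%:Z, l%:Z) + smode f (j%:Z, - l%:Z)).
Proof.
have [-> _] := pmodeE fi (@continuous_sinl j) (@continuous_cosl l) (@sinl_max j) (@cosl_max l).
rewrite /smode -RintegralD//; [|exact: integrable_sphase|exact: integrable_sphase].
rewrite -RintegralZl//; last by apply: integrableDr => //; exact: integrable_sphase.
apply: eq_Rintegral => x _; rewrite phase_natP phase_natN !sinD cosN sinN /cosl /sinl; by field.
Qed.

Lemma pmode_ss j l :
  pmode f (sinl j) (sinl l) = 2^-1 * (cmode f (j%:Z, - l%:Z) - cmode f (j%:Z, l%:Z)).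
Proof.
have [-> _] := pmodeE fi (@continuous_sinl j) (@continuous_sinl l) (@sinl_max j) (@sinl_max l).
rewrite /cmode -RintegralB//; [|exact: integrable_cphase|exact: integrable_cphase].
rewrite -RintegralZl//; last by apply: integrableBr => //; exact: integrable_cphase.
apply: eq_Rintegral => x _; rewrite phase_natP phase_natN !cosD cosN sinN /sinl; by field.
Qed.

Lemma cell_ae_of_sections (e : R) (ee : 0 <= e) :
  (\forall x \ae mu, I2 x -> \forall y \ae mu, I2 y -> `|f (x, y)| <= e) ->
  \forall z \ae @area R, @cell R z -> `|f z| <= e.
Proof.
move=> he; pose g z := Num.max (`|f z| - `|e|) 0.
have mf : measurable_fun (@cell R : set P2) f := integrable_measR fi.
have mg : measurable_fun (@cell R : set P2) g.
  apply: measurable_maxr => //; apply: measurable_funB => //.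
  exact: measurableT_comp.
have g0 z : 0 <= g z by rewrite le_max lexx orbT.
have gf z : g z <= `|f z|.
  by rewrite ge_max normr_ge0 andbT; have := normr_ge0 e; lra.
have gi : (@area R).-integrable (@cell R) (EFin \o g).
  apply: (@le_integrable _ _ _ (@area R) (@cell R) _ (EFin \o g) (EFin \o f)) => //.
    exact/measurable_EFinP.
  by move=> z _ /=; rewrite lee_fin ger0_norm.
have i0 : \int[@area R]_(z in @cell R) g z = 0.
  rewrite cell_Fubini//.
  rewrite (@Rintegral_ae_eq _ _ _ mu I2 _ (fun _ => 0)) ?Rintegral_cst ?mul0r//.
    exact: (integrable_measR (cell_Fubini_integrable gi)).
  apply: ae_imp (ae_and he (cell_section gi)) _ => x [h hi] xI.
  rewrite (@Rintegral_ae_eq _ _ _ mu I2 _ (fun _ => 0)) ?Rintegral_cst ?mul0r//.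
    exact: (integrable_measR (hi xI)).
  apply: ae_imp (h xI) _ => y hy yI; apply/eqP; rewrite eq_le g0 andbT.
  by rewrite ge_max lexx andbT subr_le0 (le_trans (hy yI))// ler_norm.
have : ae_eq (@area R) (@cell R) (EFin \o g) (cst 0%E).
  apply/(ae_eq_integral_abs (@area R) measurable_cell); first exact/measurable_EFinP.
  under eq_integral do rewrite /= ger0_norm//.
  have := integrable_fin_num measurable_cell gi.
  move=> /fineK <-; congr EFin; exact: i0.
apply: filterS => z h zc; have /eqP := h zc; rewrite eqe => /eqP gz.
have : `|f z| - `|e| <= g z by rewrite le_max lexx.
by rewrite gz (ger0_norm ee) subr_le0.
Qed.

End cell_uniqueness.

(** * C3 *)

Section cell_bound.
Context {R : realType}.
Notation mu := (@lebesgue_measure R).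
Notation P2 := (measurableTypeR R * measurableTypeR R)%type.
Notation I2 := (`[0, 2 * pi]%classic : set (measurableTypeR R)).
Implicit Types (k : int * int).

Definition row_partial (f : R * R -> R) m x : R :=
  cmode f (0, 0) + 2 * \sum_(1 <= l < m.+1)
    (cmode f (l%:Z, 0) * cos (l%:R * x) + smode f (l%:Z, 0) * sin (l%:R * x)).

Theorem row_partial_ae_bound (f : R * R -> R) (e : R) : 0 <= e ->
  (@area R).-integrable (@cell R) (EFin \o f) ->
  (forall k, k.2 != 0 -> cmode f k = 0 /\ smode f k = 0) ->
  (forall m x, `|row_partial f m x| <= (2 * pi) ^+ 2 * e) ->
  \forall z \ae @area R, @cell R z -> `|f z| <= e.
Proof.
move=> e0 fi fk fe; apply: cell_ae_of_sections => //.
pose F v x := \int[mu]_(y in I2) (f (x, y) * v y).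
have Fi v : continuous v -> (forall x, `|v x| <= 1) -> mu.-integrable I2 (EFin \o F v).
  move=> cv v1.
  by have [_] := pmodeE fi (@continuous_cosl R 0) cv (@cosl_max R 0) v1.
have Fc l : mu.-integrable I2 (EFin \o F (cosl l)).
  by apply: Fi; [exact: continuous_cosl|exact: cosl_max].
have Fs l : mu.-integrable I2 (EFin \o F (sinl l)).
  by apply: Fi; [exact: continuous_sinl|exact: sinl_max].
have nz l : (l.+1%:Z != 0) && (- l.+1%:Z != 0) by rewrite oppr_eq0.
have Fc0 l : \forall x \ae mu, I2 x -> F (cosl l.+1) x = 0.
  have /andP[n1 n2] := nz l.
  apply: fourier_uniqueness => // j; rewrite -/(pmode f (cosl j) _) -/(pmode f (sinl j) _).
    by rewrite [LHS](pmode_cc fi) (fk (_, _) n1).1 (fk (_, _) n2).1 addr0 mulr0.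
  by rewrite [LHS](pmode_sc fi) (fk (_, _) n1).2 (fk (_, _) n2).2 addr0 mulr0.
have Fs0 l : \forall x \ae mu, I2 x -> F (sinl l.+1) x = 0.
  have /andP[n1 n2] := nz l.
  apply: fourier_uniqueness => // j.
    by rewrite [LHS](pmode_cs fi) (fk (_, _) n1).2 (fk (_, _) n2).2 subr0 mulr0.
  by rewrite [LHS](pmode_ss fi) (fk (_, _) n1).1 (fk (_, _) n2).1 subr0 mulr0.
have cF0 j : cosmode (F (cosl 0)) j = cmode f (j%:Z, 0).
  by rewrite [LHS](pmode_cc fi) /= oppr0; field.
have sF0 j : sinmode (F (cosl 0)) j = smode f (j%:Z, 0).
  by rewrite [LHS](pmode_sc fi) /= oppr0; field.
have IF0 : \int[mu]_(x in I2) F (cosl 0) x = cmode f (0, 0).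
  by rewrite -cF0; apply: eq_Rintegral => x _; rewrite mul0r cos0 mulr1.
have F0b : \forall x \ae mu, I2 x -> `|F (cosl 0) x| <= 2 * pi * e.
  apply: fourier_partial_ae_bound => // m x.
  rewrite /fourier_partial IF0; under eq_bigr do rewrite cF0 sF0.
  by rewrite mulrA -expr2; exact: fe.
have := ae_and (ae_and (cell_section fi) F0b)
   (ae_and (ae_foralln Fc0) (ae_foralln Fs0)).
move=> h; apply: ae_imp h _ => x [[si F0x] [Fcx Fsx]] xI.
apply: fourier_partial_ae_bound; first exact: si.
move=> m y; rewrite /fourier_partial big_nat big1 ?mulr0 ?addr0; last first.
  move=> [//|l] _; have := Fcx l xI; have := Fsx l xI; rewrite /F /cosl /sinl.
  by rewrite /cosmode /sinmode => -> ->; rewrite !mul0r addr0.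
have := F0x xI; rewrite /F /cosl; under eq_Rintegral do rewrite mul0r cos0 mulr1.
by [].
Qed.

Corollary cell_uniqueness (f : R * R -> R) :
  (@area R).-integrable (@cell R) (EFin \o f) ->
  (forall k, cmode f k = 0 /\ smode f k = 0) ->
  \forall z \ae @area R, @cell R z -> f z = 0.
Proof.
move=> fi f0.
have h : forall m x, `|row_partial f m x| <= (2 * pi) ^+ 2 * 0.
  move=> m x; rewrite /row_partial (f0 _).1 big1 ?mulr0 ?addr0 ?normr0// => l _.
  by rewrite (f0 _).1 (f0 _).2 !mul0r addr0.
apply: ae_imp (row_partial_ae_bound (lexx 0) fi (fun k _ => f0 k) h) _.
by move=> z + zc; move=> /(_ zc); rewrite normr_le0 => /eqP.
Qed.

End cell_bound.

(** * D1 *)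

Section smooth_functions.
Context {R : realType}.

Lemma is_derive_line (V : normedModType R) (f : V -> R) (x v : V) (d : R) :
  is_derive (0 : R) 1 (fun h : R => f (h *: v + x)) d -> is_derive x v f d.
Proof.
case=> df dE; have dfx : derivable f x v := (derivable1P f x v).2 df.
apply: DeriveDef => //; rewrite -dE /derive; apply: f_equal; apply: (f_equal (fun g => g @ 0^')).
by apply/funext => h; rewrite /= addr0 scale0r add0r [h *: 1]mulr1.
Qed.

Lemma is_derive_lineE (V : normedModType R) (f : V -> R) (x v : V) (d : R) :
  is_derive x v f d -> is_derive (0 : R) 1 (fun h : R => f (h *: v + x)) d.
Proof.
case=> df dE; have dfx := (derivable1P f x v).1 df.
apply: DeriveDef => //; rewrite -dE /derive; apply: f_equal; apply: (f_equal (fun g => g @ 0^')).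
by apply/funext => h; rewrite /= addr0 scale0r add0r [h *: 1]mulr1.
Qed.

Lemma is_CnW (V : normedModType R) n (f : V -> R) : is_Cn n.+1 f -> is_Cn n f.
Proof.
elim: n f => [|n IH] f [cf df]; first by split.
split=> // v; have [dfx cdf] := df v; split=> //; exact: IH.
Qed.

Lemma smooth_coind (V : normedModType R) (S : (V -> R) -> Prop) :
  (forall f, S f -> continuous f /\
     forall v, (forall x, derivable f x v) /\ S ('D_v f)) ->
  forall f, S f -> smooth f.
Proof.
move=> HS f Sf n; elim: n f Sf => [|n IH] f Sf; have [cf df] := HS f Sf.
  by split.
split=> // v; have [dfx SD] := df v; split=> //; exact: IH.
Qed.

Lemma smooth_continuous (V : normedModType R) (f : V -> R) : smooth f -> continuous f.
Proof. by move=> /(_ 0)[]. Qed.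

Lemma smooth_derive (V : normedModType R) (f : V -> R) v : smooth f -> smooth ('D_v f).
Proof. by move=> sf n; have [_ /(_ v)[_]] := sf n.+1. Qed.

Lemma smooth_derivable (V : normedModType R) (f : V -> R) v x :
  smooth f -> derivable f x v.
Proof. by move=> /(_ 1)[_ /(_ v)[]]. Qed.

Lemma is_CnD (V : normedModType R) n (f g : V -> R) :
  is_Cn n f -> is_Cn n g -> is_Cn n (f + g).
Proof.
elim: n f g => [|n IH] f g [cf df] [cg dg].
  by split=> // x; apply: cvgD; [exact: cf|exact: cg].
split; first by move=> x; apply: cvgD; [exact: cf|exact: cg].
move=> v; have [dfx Cf] := df v; have [dgx Cg] := dg v; split.
  by move=> x; exact: derivableD.
rewrite (_ : (fun x => _) = ('D_v f : V -> R) + 'D_v g); first exact: IH.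
by apply/funext => x; rewrite deriveD.
Qed.

Lemma is_CnM (V : normedModType R) n (f g : V -> R) :
  is_Cn n f -> is_Cn n g -> is_Cn n (f * g).
Proof.
elim: n f g => [|n IH] f g Hf Hg; have [cf df] := Hf; have [cg dg] := Hg.
  by split=> // x; apply: cvgM; [exact: cf|exact: cg].
split; first by move=> x; apply: cvgM; [exact: cf|exact: cg].
move=> v; have [dfx Cf] := df v; have [dgx Cg] := dg v; split.
  by move=> x; exact: derivableM.
rewrite (_ : (fun x => _) = f * ('D_v g : V -> R) + g * ('D_v f : V -> R)).
  by apply: is_CnD; apply: IH => //; exact: is_CnW.
by apply/funext => x; rewrite deriveM.
Qed.

Lemma smoothM (V : normedModType R) (f g : V -> R) :
  smooth f -> smooth g -> smooth (f * g).
Proof. by move=> sf sg n; exact: is_CnM. Qed.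

(* a function together with all its derivatives *)
Definition derivatives (d : nat -> R -> R) :=
  forall (i : nat) (x : R), is_derive x (1 : R) (d i) (d i.+1 x).

Lemma derivatives_continuous d i : derivatives d -> continuous (d i).
Proof.
by move=> dd x; apply/differentiable_continuous/derivable1_diffP; have [] := dd i x.
Qed.

Section along_linear_form.
Variables (V : normedModType R) (l : V -> R) (d : nat -> R -> R).
Hypotheses (lD : forall (h : R) x v, l (h *: v + x) = h * l v + l x)
  (cl : continuous l) (dd : derivatives d).

Lemma is_derive_along i (c : R) x v :
  is_derive x v (fun x => c * d i (l x)) (c * l v * d i.+1 (l x)).
Proof.
apply: is_derive_line.
rewrite (_ : (fun h => _) = c \*: (d i \o (fun h : R => l v * h + l x))); last first.
  by apply/funext => h /=; rewrite lD [h * _]mulrC.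
have h1 := is_derive_lin (l v) (l x) 0.
have h2 : is_derive (l v * 0 + l x) 1 (d i) (d i.+1 (l x)).
  by rewrite mulr0 add0r; exact: dd.
have h3 := @is_derive1_comp _ (d i) (fun h : R => l v * h + l x) 0 _ _ h2 h1.
by apply: is_derive_eq; rewrite /GRing.scale/=; ring.
Qed.

Lemma smooth_along i : smooth (fun x => d i (l x)).
Proof.
apply: (@smooth_coind V (fun f => exists j c, f = fun x => c * d j (l x))); last first.
  by exists i, 1; apply/funext => x; rewrite mul1r.
move=> _ [j [c ->]]; split.
  move=> x; apply: cvgM; first exact: cvg_cst.
  apply: (@continuous_comp _ _ _ l (d j)); first exact: cl.
  exact: derivatives_continuous.
move=> v; split=> [x|]; first by have [] := is_derive_along j c x v.
exists j.+1, (c * l v); apply/funext => x.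
by have [_ ->] := is_derive_along j c x v.
Qed.

End along_linear_form.

Lemma derivatives_cos t : derivatives (fun i x => cos (x + (t + i%:R * (pi / 2)))).
Proof.
move=> i x; have -> : x + (t + i.+1%:R * (pi / 2)) = x + (t + i%:R * (pi / 2)) + pi / 2.
  by rewrite -(natr1 i); ring.
rewrite cosDpihalf.
set s := t + _; have := is_derive_cos_lin 1 s x.
rewrite mulNr !mul1r (_ : (fun x => cos (1 * x + s)) = (fun x => cos (x + s)))//.
by apply/funext => y; rewrite mul1r.
Qed.

End smooth_functions.

(** * D2 *)

Section flat_function.
Context {R : realType}.
Notation mu := (@lebesgue_measure R).

Definition flat (p : {poly R}) (x : R) : R :=
  if 0 < x then p.[x^-1] * expR (- x^-1) else 0.

Lemma flat_bound (p : {poly R}) : exists C, 0 <= C /\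
  forall x, 0 < x -> x <= 1 -> `|flat p x| <= C * x ^+ 2.
Proof.
set m := size p; pose K := \sum_(i < m) `|p`_i|.
exists (K * (m.+2)`!%:R); split; first by rewrite mulr_ge0// sumr_ge0.
move=> x x0 x1; rewrite /flat x0 normrM (ger0_norm (expR_ge0 _)).
set y := x^-1; have y1 : 1 <= y by rewrite invf_ge1.
have y0 : 0 < y by rewrite invr_gt0.
have -> : K * (m.+2)`!%:R * x ^+ 2 = (K * y ^+ m) * ((m.+2)`!%:R * (y ^+ m.+2)^-1).
  have -> : x ^+ 2 = (y ^+ 2)^-1 by rewrite /y exprVn invrK.
  rewrite -addn2 exprD; set a := y ^+ m; set c := y ^+ 2.
  have a0 : a != 0 by rewrite gt_eqF// exprn_gt0.
  have c0 : c != 0 by rewrite gt_eqF// exprn_gt0.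
  by field; rewrite a0 c0.
apply: ler_pM; [exact: normr_ge0|exact: expR_ge0| |].
  rewrite horner_coef (le_trans (ler_norm_sum _ _ _))// mulr_suml ler_sum// => i _.
  rewrite normrM ler_wpM2l// ger0_norm ?exprn_ge0 ?(ltW y0)//.
  by apply: ler_weXn2l => //; exact: ltnW.
rewrite expRN -[leLHS]mul1r ler_pdivrMr ?expR_gt0// mulrAC ler_pdivlMr ?exprn_gt0// mul1r.
rewrite mulrC -ler_pdivrMr ?ltr0n ?fact_gt0//.
by have := expR_ge1Dxn m.+1 (ltW y0); lra.
Qed.

Lemma is_derive_flat (p : {poly R}) (x : R) :
  is_derive x (1 : R) (flat p) (flat ('X^2 * (p - p^`())) x).
Proof.
have [x0|x0|->] := ltgtP x 0.
- have -> : flat ('X^2 * (p - p^`())) x = 0 by rewrite /flat ltNge ltW.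
  have nr : \near x, 0 = flat p x.
    near=> y; rewrite /flat ifF//; apply/negbTE; rewrite -leNgt ltW//.
    by near: y; exact: lt_nbhsl.
  by apply: (near_eq_is_derive nr); exact: is_derive_cst.
- have nr : \near x, p.[x^-1] * expR (- x^-1) = flat p x.
    near=> y; rewrite /flat ifT//.
    by near: y; exact: lt_nbhsr.
  have dV : is_derive x (1 : R) (fun y : R => y^-1) (- x ^- 2).
    have x0' : id x != 0 :> R by rewrite gt_eqF.
    have di : derivable (id : R -> R) x 1 by exact: derivable_id.
    apply: DeriveDef; first exact: derivableV.
    by rewrite (deriveV x0' di) derive_id /GRing.scale/= mulr1.
  have dNV : is_derive x (1 : R) (fun y : R => - y^-1) (x ^- 2).
    by rewrite -[x ^- 2]opprK; exact: is_deriveN.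
  have d1 := @is_derive1_comp _ (horner p) (fun y : R => y^-1) x _ _ (is_derive_poly p x^-1) dV.
  have d2 := @is_derive1_comp _ expR (fun y : R => - y^-1) x _ _ (is_derive_expR (- x^-1)) dNV.
  have d3 := is_deriveM d1 d2.
  apply: (near_eq_is_derive nr); apply: (is_derive_eq d3); rewrite /flat x0 !hornerE/= /GRing.scale/= exprVn; ring.
have [C [C0 hC]] := flat_bound p.
have lim : h^-1 *: ((flat p \o shift 0) (h *: 1) - flat p 0) @[h --> 0^'] --> 0.
  apply/norm_cvg0P; apply: (@squeeze_cvgr _ _ _ _ (fun _ => 0) (fun h => C * `|h|)).
  - near=> h; rewrite normr_ge0/=.
    have h1 : `|h| < 1 by near: h; exact: dnbhs0_lt.
    have h0 : h != 0 by near: h; exact: nbhs_dnbhs_neq.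
    rewrite addr0 [h *: 1]mulr1 {2}/flat ltxx subr0 normrM normfV.
    rewrite ler_pdivrMl ?normr_gt0//.
    have [hp|hn] := ltP 0 h; last first.
      by rewrite /flat ltNge hn/= normr0 !mulr_ge0.
    by rewrite (gtr0_norm hp) in h1 *; rewrite mulrCA -expr2 hC// ltW.
  - exact: cvg_cst.
  - rewrite -[X in _ --> X](mulr0 C); apply: cvgM; first exact: cvg_cst.
    apply/cvgrPdist_lt => e e0; near=> h.
    by rewrite sub0r normrN normr_id; near: h; exact: dnbhs0_lt.
have -> : flat ('X^2 * (p - p^`())) 0 = 0 by rewrite /flat ltxx.
apply: DeriveDef; first by apply/cvg_ex; exists 0.
by apply/cvg_lim.
Unshelve. all: by end_near. Qed.

End flat_function.

(** * D3 *)

Section bump.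
Context {R : realType}.
Notation mu := (@lebesgue_measure R).

Fixpoint flat_poly (i : nat) : {poly R} :=
  if i is j.+1 then 'X^2 * (flat_poly j - (flat_poly j)^`()) else 1.

Definition flat_bump : R -> R := flat 1.

Lemma bumpE x : flat_bump x = if 0 < x then expR (- x^-1) else 0.
Proof. by rewrite /flat_bump /flat hornerC mul1r. Qed.

Lemma bump_ge0 x : 0 <= flat_bump x.
Proof. by rewrite bumpE; case: ifP => // _; exact: expR_ge0. Qed.

Lemma bump_le1 x : flat_bump x <= 1.
Proof. by rewrite bumpE; case: ifP => // x0; rewrite expR_le1 oppr_le0 invr_ge0 ltW. Qed.

Lemma bump_le0 x : x <= 0 -> flat_bump x = 0.
Proof. by rewrite bumpE; case: ltP. Qed.

Lemma continuous_flat_bump : continuous flat_bump.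
Proof.
by move=> x; apply/differentiable_continuous/derivable1_diffP; have [] := is_derive_flat 1 x.
Qed.

Lemma bump_cvg (y : R) : flat_bump (n.+1%:R * y) @[n --> \oo] --> (if 0 < y then 1 else 0 : R).
Proof.
case: ifP => [y0|/negbT]; last first.
  rewrite -leNgt => y0; apply: cvg_near_cst; apply: nearW => n.
  by rewrite bump_le0// mulr_ge0_le0.
rewrite (_ : (fun n => _) = (fun n => expR (- (y^-1 * n.+1%:R^-1)))); last first.
  by apply/funext => n; rewrite bumpE mulr_gt0// invfM mulrC.
have hc : - (y^-1 * n.+1%:R^-1) @[n --> \oo] --> (0 : R).
  rewrite -oppr0; apply: cvgN; rewrite -(mulr0 y^-1); apply: cvgM; first exact: cvg_cst.
  exact: cvg_harmonic.
rewrite [X in _ --> X](_ : _ = expR 0); last by rewrite expR0.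
exact: continuous_cvg (@continuous_expR R 0) hc.
Qed.

Definition bump_prim (x : R) : R := \int[mu]_(s in `[0, x]) flat_bump s.

Lemma bump_primE a x : a <= 0 -> a <= x ->
  bump_prim x = \int[mu]_(s in `[a, x]) flat_bump s.
Proof.
move=> a0 ax; have ci u v : mu.-integrable `[u, v] (EFin \o flat_bump).
  by apply: continuous_integrable; exact: continuous_flat_bump.
have zero u v : v <= 0 -> \int[mu]_(s in `[u, v]) flat_bump s = 0.
  move=> v0; rewrite (@eq_Rintegral _ _ _ _ _ (fun _ => 0)) ?Rintegral_cst ?mul0r//.
  move=> s /set_mem/=; rewrite in_itv/= => /andP[_ sv].
  by rewrite bump_le0// (le_trans sv).
have [x0|x0] := leP 0 x; last by rewrite /bump_prim !zero ?(ltW x0).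
by rewrite [RHS](@Rint_itvD _ _ a 0)// zero// add0r.
Qed.

Lemma bump_prim_le0 x : x <= 0 -> bump_prim x = 0.
Proof.
move=> x0; rewrite (bump_primE x0 (lexx x)).
by rewrite set_itv1 Rintegral_set1.
Qed.

Lemma is_derive_bump_prim x : is_derive x (1 : R) bump_prim (flat_bump x).
Proof.
pose a := Num.min x 0 - 1.
have ax : a < x.
  by rewrite /a; have : Num.min x 0 <= x; [rewrite ge_min lexx|lra].
have a0 : a <= 0.
  by rewrite /a; have : Num.min x 0 <= 0; [rewrite ge_min lexx orbT|lra].
have ci : mu.-integrable `[a, x + 1] (EFin \o flat_bump).
  by apply: continuous_integrable; exact: continuous_flat_bump.
have xx : x < x + 1 by rewrite ltrDl.
have [] := @continuous_FTC1_closed R flat_bump a x (x + 1) xx ci ax (@continuous_flat_bump x).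
rewrite derive1E => d1 d2.
have nr : \near x, \int[mu]_(t in `[a, x]) flat_bump t = bump_prim x.
  near=> y; rewrite -bump_primE//.
  by near: y; exact: lt_le_nbhsr.
by apply: (near_eq_is_derive nr); exact: DeriveDef.
Unshelve. all: by end_near. Qed.

Definition bump_derivatives (i : nat) : R -> R :=
  if i is j.+1 then flat (flat_poly j) else bump_prim.

Lemma derivatives_bump : derivatives bump_derivatives.
Proof.
move=> [|i] x /=; first exact: is_derive_bump_prim.
exact: is_derive_flat.
Qed.

Lemma derivatives_affine (d : nat -> R -> R) (a c : R) : derivatives d ->
  derivatives (fun i x => a ^+ i * d i (a * x + c)).
Proof.
move=> dd i x.
have h1 := is_derive_lin a c x.
have h2 := dd i (a * x + c).
have h3 := @is_derive1_comp _ (d i) (fun x => a * x + c) x _ _ h2 h1.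
have h4 := is_deriveZ (a ^+ i) h3.
rewrite exprSr -mulrA [a * _]mulrC; exact: h4.
Qed.

(* smooth in time, equal to a primitive of a flat_bump that vanishes after r *)
Definition cutoff (r m : R) (i : nat) (t : R) : R :=
  (- m) ^+ i * bump_derivatives i (- m * t + m * r).

Lemma derivatives_cutoff r m : derivatives (cutoff r m).
Proof. exact: derivatives_affine derivatives_bump. Qed.

Lemma cutoff0 r m t : 0 <= m -> r <= t -> cutoff r m 0 t = 0.
Proof.
move=> m0 rt; rewrite /cutoff expr0 mul1r /= bump_prim_le0//.
have -> : - m * t + m * r = m * (r - t) by ring.
by rewrite mulr_ge0_le0// subr_le0.
Qed.

Lemma cutoff1 r m t : cutoff r m 1 t = - m * flat_bump (m * (r - t)).
Proof. by rewrite /cutoff expr1; congr (_ * flat_bump _); ring. Qed.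

End bump.

Section test_functions.
Context {R : realType}.
Notation VT := (R * (R * R))%type.

Definition wave (k : int * int) (th : R) (d : nat -> R -> R) (z : VT) : R :=
  d 0 z.1 * cos (phase k z.2 + th).

Lemma continuous_phase (k : int * int) : continuous (phase k : R * R -> R).
Proof.
move=> x; rewrite /phase; apply: cvgD; apply: cvgM; try exact: cvg_cst.
  exact: cvg_fst.
exact: cvg_snd.
Qed.

Lemma phase_lin (k : int * int) (h : R) (x v : R * R) :
  phase k (h *: v + x) = h * phase k v + phase k x.
Proof. by rewrite /phase /= /GRing.scale/=; ring. Qed.

Lemma smooth_time (d : nat -> R -> R) : derivatives d -> smooth (fun z : VT => d 0 z.1).
Proof.
move=> dd; apply: (@smooth_along R VT (fun z : VT => z.1) d _ _ dd 0) => //.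
by move=> x; exact: cvg_fst.
Qed.

Lemma smooth_wave_x k th : smooth (fun z : VT => cos (phase k z.2 + th)).
Proof.
have := @smooth_along R VT (fun z : VT => phase k z.2) _ _ _ (derivatives_cos th) 0.
rewrite mul0r addr0; apply.
  by move=> h x v; exact: phase_lin.
move=> x; apply: (@continuous_comp _ _ _ (fun z : VT => z.2) (phase k)).
  exact: cvg_snd.
exact: continuous_phase.
Qed.

Lemma smooth_wave k th d : derivatives d -> smooth (wave k th d).
Proof.
by move=> dd; apply: smoothM; [exact: smooth_time|exact: smooth_wave_x].
Qed.

Lemma is_derive_time (d : nat -> R -> R) z v : derivatives d ->
  is_derive z v (fun z : VT => d 0 z.1) (v.1 * d 1 z.1).
Proof.
move=> dd; have := @is_derive_along R VT (fun z : VT => z.1) d _ dd 0 1 z v.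
rewrite mul1r (_ : (fun x : VT => 1 * _) = (fun z : VT => d 0 z.1)).
  exact.
by apply/funext => x; rewrite mul1r.
Qed.

Lemma is_derive_wave_x k th (z v : VT) :
  is_derive z v (fun z : VT => cos (phase k z.2 + th))
   (- (phase k v.2 * sin (phase k z.2 + th))).
Proof.
have := @is_derive_along R VT (fun z : VT => phase k z.2) _ _ (derivatives_cos th) 0 1 z v.
rewrite mul1r /= mul0r addr0 mul1r addrA cosDpihalf mulrN.
rewrite (_ : (fun x : VT => 1 * _) = (fun z : VT => cos (phase k z.2 + th))).
  by apply; move=> h x w; exact: phase_lin.
by apply/funext => x; rewrite mul1r.
Qed.

Lemma derive_wave_t k th d z : derivatives d ->
  'D_(unit_t R) (wave k th d) z = d 1 z.1 * cos (phase k z.2 + th).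
Proof.
move=> dd; have h1 := @is_derive_time d z (unit_t R) dd.
have h2 := @is_derive_wave_x k th z (unit_t R).
have [_ /=] := is_deriveM h1 h2; rewrite /wave => ->.
by rewrite /unit_t/= /phase/= !mulr0 addr0 mul0r oppr0 scaler0 add0r mul1r [LHS]mulrC.
Qed.

Definition wavenum (k : int * int) (j : 'I_2) : R := if j == 0 then k.1%:~R else k.2%:~R.

Lemma phase_unit k j : phase k (unit_x R j) = wavenum k j.
Proof. by rewrite /unit_x /wavenum /phase; case: ifP => _ /=; rewrite !(mulr0, mulr1, addr0, add0r). Qed.

Lemma derive_wave_x k th d z j : derivatives d ->
  'D_(at_t0 (unit_x R j)) (wave k th d) z = - (wavenum k j * (d 0 z.1 * sin (phase k z.2 + th))).
Proof.
move=> dd; have h1 := @is_derive_time d z (at_t0 (unit_x R j)) dd.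
have h2 := @is_derive_wave_x k th z (at_t0 (unit_x R j)).
have [_ /=] := is_deriveM h1 h2; rewrite /wave => ->.
by rewrite /at_t0/= phase_unit mul0r scaler0 addr0 /GRing.scale/=; ring.
Qed.

Lemma cos_periodZ (n : int) (x : R) : cos (x + n%:~R * (2 * pi)) = cos x.
Proof.
case: n => n; first exact: cos_period.
rewrite NegzE mulrNz mulNr -[in RHS](subrK (n.+1%:R * (2 * pi)) x).
by rewrite cos_period.
Qed.

Lemma sin_periodZ (n : int) (x : R) : sin (x + n%:~R * (2 * pi)) = sin x.
Proof.
case: n => n; first exact: sin_period.
rewrite NegzE mulrNz mulNr -[in RHS](subrK (n.+1%:R * (2 * pi)) x).
by rewrite sin_period.
Qed.

Lemma cos_phase_periodic k th : periodic_x (fun x : R * R => cos (phase k x + th)).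
Proof.
move=> j x; rewrite (addrC x) phase_lin phase_unit.
have e n : 2 * pi * n%:~R + phase k x + th = phase k x + th + n%:~R * (2 * pi) by ring.
by rewrite /wavenum; case: ifP => _; rewrite e cos_periodZ.
Qed.

Lemma test_wave (T r : R) k th d : r < T -> derivatives d ->
  (forall t, r <= t -> d 0 t = 0) -> test_function T (wave k th d).
Proof.
move=> rT dd d0; split; first exact: smooth_wave.
  by move=> t j x; rewrite /wave /= cos_phase_periodic.
by exists r => // t x /d0; rewrite /wave /= => ->; rewrite mul0r.
Qed.

End test_functions.

(** * E1 *)

Section primitives.
Context {R : realType}.
Notation mu := (@lebesgue_measure R).
Notation leb := (@lebesgue_measure R).
Implicit Types (f g h k p q : R -> R) (t s T : R).

Lemma Rint_before h t T : t <= T ->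
  \int[mu]_(s in `[0, t]) h s = \int[mu]_(s in `[0, T]) (h s * (if s <= t then 1 else 0)).
Proof.
move=> tT; rewrite Rintegral_mkcond [RHS]Rintegral_mkcond; apply: eq_Rintegral => s _.
rewrite !patchE !mem_setE !in_itv/=; case: (leP 0 s) => //= _.
by case: (leP s t) => st; rewrite ?(le_trans st tT) ?mulr1//; case: ifP; rewrite ?mulr0.
Qed.

Lemma Rint_after k s T : 0 <= s ->
  \int[mu]_(t in `[s, T]) k t = \int[mu]_(t in `[0, T]) (k t * (if s <= t then 1 else 0)).
Proof.
move=> s0; rewrite Rintegral_mkcond [RHS]Rintegral_mkcond; apply: eq_Rintegral => t _.
rewrite !patchE !mem_setE !in_itv/=; case: (leP t T) => _; rewrite ?andbF ?andbT//.
by case: (leP s t) => st; rewrite ?(le_trans s0 st) ?mulr1//; case: ifP; rewrite ?mulr0.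
Qed.

Section triangle.
Variables (T : R) (h k : R -> R).
Hypotheses (hi : mu.-integrable `[0, T] (EFin \o h))
  (ki : mu.-integrable `[0, T] (EFin \o k)).

Let P2 := (measurableTypeR R * measurableTypeR R)%type.
Let D := (`[0, T]%classic : set (measurableTypeR R)).
Let mD : measurable D. Proof. exact: measurable_itv. Qed.

Let tri_int : (leb \x leb)%E.-integrable (D `*` D)
  (EFin \o (fun z : P2 => k z.1 * h z.2 * (if z.2 <= z.1 then 1 else 0))).
Proof.
apply: (@integrableMb _ _ _ (leb \x leb)%E (D `*` D) (fun z : P2 => k z.1 * h z.2) _ 1).
- exact: measurableX.
- exact: (@integrable_tensor _ _ _ _ R leb leb D D mD mD k h ki hi).
- apply: measurable_funTS; apply: measurable_fun_ifT => //.
  by apply: measurable_fun_ler.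
- by move=> z _; case: ifP; rewrite ?normr1 ?normr0.
Qed.

Let primE t : D t ->
  \int[mu]_(s in D) (k t * h s * (if s <= t then 1 else 0)) =
  k t * \int[mu]_(s in `[0, t]) h s.
Proof.
rewrite /D/= in_itv/= => /andP[_ tT]; rewrite (Rint_before h tT) -RintegralZl//.
  by apply: eq_Rintegral => s _; rewrite mulrA.
apply: (@integrableMb _ _ _ mu _ h _ 1) => //.
  apply: measurable_funTS; apply: measurable_fun_ifT => //.
  by apply: measurable_fun_ler.
by move=> z _; case: ifP; rewrite ?normr1 ?normr0.
Qed.

Lemma Rint_triangle :
  \int[mu]_(t in `[0, T]) (k t * \int[mu]_(s in `[0, t]) h s) =
  \int[mu]_(s in `[0, T]) (h s * \int[mu]_(t in `[s, T]) k t).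
Proof.
rewrite -(@eq_Rintegral _ _ _ mu D _ _ (fun t tD => primE (set_mem tD))).
rewrite (Rint_swap mD mD tri_int).
apply: eq_Rintegral => s /set_mem; rewrite /D/= in_itv/= => /andP[s0 _].
rewrite (Rint_after k T s0) -RintegralZl//.
  by apply: eq_Rintegral => t _ /=; ring.
apply: (@integrableMb _ _ _ mu _ k _ 1) => //.
  apply: measurable_funTS; apply: measurable_fun_ifT => //.
  by apply: measurable_fun_ler.
by move=> z _; case: ifP; rewrite ?normr1 ?normr0.
Qed.

Lemma integrable_mul_primitive :
  mu.-integrable `[0, T] (EFin \o (fun t => k t * \int[mu]_(s in `[0, t]) h s)).
Proof.
have := integrable_Rint_section mD mD tri_int.
by apply: eq_integrable => // t /set_mem tD /=; rewrite primE.
Qed.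

End triangle.

Lemma integrable_itvS f a b T : 0 <= a -> b <= T ->
  mu.-integrable `[0, T] (EFin \o f) -> mu.-integrable `[a, b] (EFin \o f).
Proof.
move=> a0 bT; apply: integrableS => //.
by move=> x /=; rewrite !in_itv/= => /andP[ax xb]; rewrite (le_trans a0 ax) (le_trans xb).
Qed.

Lemma primitive_mul p q t :
  mu.-integrable `[0, t] (EFin \o p) -> mu.-integrable `[0, t] (EFin \o q) ->
  \int[mu]_(s in `[0, t]) p s * \int[mu]_(s in `[0, t]) q s =
  \int[mu]_(s in `[0, t]) (p s * \int[mu]_(r in `[0, s]) q r +
                           q s * \int[mu]_(r in `[0, s]) p r).
Proof.
move=> pi qi; rewrite RintegralD//; [|exact: integrable_mul_primitive|exact: integrable_mul_primitive].
rewrite (Rint_triangle qi pi) -RintegralD//; last 2 first.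
- have i1 : mu.-integrable `[0, t] (EFin \o (fun s => \int[mu]_(s in `[0, t]) p s * q s)).
    exact: integrableZr'.
  have i2 := integrable_mul_primitive pi qi.
  have : mu.-integrable `[0, t] (EFin \o (fun s => \int[mu]_(s in `[0, t]) p s * q s -
      q s * \int[mu]_(r in `[0, s]) p r)) by exact: integrableBr.
  apply: eq_integrable => // s /set_mem/=; rewrite in_itv/= => /andP[s0 st].
  by rewrite (Rint_itvD s0 st pi); congr EFin; ring.
- exact: integrable_mul_primitive.
rewrite mulrC -RintegralZr//; apply: eq_Rintegral => s /set_mem/=; rewrite in_itv/= => /andP[s0 st].
by rewrite (Rint_itvD s0 st pi); ring.
Qed.

End primitives.

(** * E2 *)

Section ae_primitives.
Context {R : realType}.
Notation mu := (@lebesgue_measure R).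
Notation leb := (@lebesgue_measure R).
Implicit Types (p q : R -> R) (t s T : R).

(* f has derivative p on (0, T), and initial value f0 *)
Definition ae_primitive (T f0 : R) (f p : R -> R) : Prop :=
  [/\ mu.-integrable `[0, T] (EFin \o f), mu.-integrable `[0, T] (EFin \o p) &
      \forall t \ae mu, `]0, T[%classic t -> f t = f0 + \int[mu]_(s in `[0, t]) p s].

Let mI (T : R) : measurable (`[0, T]%classic : set (measurableTypeR R)).
Proof. exact: measurable_itv. Qed.

Lemma integrable_primitive T p : mu.-integrable `[0, T] (EFin \o p) ->
  mu.-integrable `[0, T] (EFin \o (fun t => \int[mu]_(s in `[0, t]) p s)).
Proof.
move=> ip; have i1 : mu.-integrable `[0, T] (EFin \o (fun _ => 1)).
  by apply: continuous_integrable => x; exact: cst_continuous.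
have := integrable_mul_primitive ip i1.
by apply: eq_integrable => // t _ /=; rewrite mul1r.
Qed.

Lemma ae_primitive_exact T p : mu.-integrable `[0, T] (EFin \o p) ->
  ae_primitive T 0 (fun t => \int[mu]_(s in `[0, t]) p s) p.
Proof.
move=> ip; split => //; first exact: integrable_primitive.
by apply: aeW => t _; rewrite add0r.
Qed.

Lemma ae_primitiveD (T f0 : R) (f p : R -> R) (g0 : R) (g q : R -> R) : ae_primitive T f0 f p -> ae_primitive T g0 g q ->
  ae_primitive T (f0 + g0) (fun t => f t + g t) (fun t => p t + q t).
Proof.
move=> [fi pi' fE] [gi qi gE]; split; [exact: integrableDr|exact: integrableDr|].
apply: ae_imp (ae_and fE gE) _ => t [ft gt] tT; rewrite ft// gt//.
have tT' : t <= T by move: tT => /=; rewrite in_itv/= => /andP[_ /ltW].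
rewrite RintegralD//; [by ring|exact: integrable_itvS pi'|exact: integrable_itvS qi].
Qed.

Lemma ae_primitiveZ (T c f0 : R) (f p : R -> R) : ae_primitive T f0 f p ->
  ae_primitive T (c * f0) (fun t => c * f t) (fun t => c * p t).
Proof.
move=> [fi pi' fE]; split; [exact: integrableZr'|exact: integrableZr'|].
apply: ae_imp fE _ => t ft tT; rewrite ft//.
have tT' : t <= T by move: tT => /=; rewrite in_itv/= => /andP[_ /ltW].
by rewrite RintegralZl//; [ring|exact: integrable_itvS pi'].
Qed.

Lemma ae_primitive_sum T I (r : seq I) (f0 : I -> R) (f p : I -> R -> R) :
  (forall i, ae_primitive T (f0 i) (f i) (p i)) ->
  ae_primitive T (\sum_(i <- r) f0 i) (fun t => \sum_(i <- r) f i t)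
    (fun t => \sum_(i <- r) p i t).
Proof.
move=> fp; elim: r => [|i r IH].
  have i0 : mu.-integrable `[0, T] (EFin \o (fun _ => 0)).
    by apply: continuous_integrable => x; exact: cst_continuous.
  split.
  - by apply: eq_integrable i0 => // s _ /=; rewrite big_nil.
  - by apply: eq_integrable i0 => // s _ /=; rewrite big_nil.
  - apply: aeW => t _; rewrite !big_nil; under eq_Rintegral do rewrite big_nil.
    by rewrite Rintegral_cst// mul0r addr0.
rewrite big_cons; have := ae_primitiveD (fp i) IH.
by congr ae_primitive; apply/funext => t; rewrite big_cons.
Qed.

Lemma primitive_bound T p t : 0 <= t -> t <= T -> mu.-integrable `[0, T] (EFin \o p) ->
  `|\int[mu]_(s in `[0, t]) p s| <= \int[mu]_(s in `[0, T]) `|p s|.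
Proof.
move=> t0 tT ip; have ip' := integrable_itvS (lexx 0) tT ip.
apply: (le_trans (le_normr_Rintegral (mI t) ip')).
have ia : mu.-integrable `[0, T] (EFin \o (fun s => `|p s|)) by exact: integrable_norm.
rewrite (Rint_itvD t0 tT ia) lerDl; exact: Rintegral_ge0.
Qed.

Lemma ae_primitiveM (T f0 : R) (f p : R -> R) (g0 : R) (g q : R -> R) : ae_primitive T f0 f p -> ae_primitive T g0 g q ->
  ae_primitive T (f0 * g0) (fun t => f t * g t) (fun t => p t * g t + f t * q t).
Proof.
move=> [fi pi' fE] [gi qi gE].
pose F t := f0 + \int[mu]_(s in `[0, t]) p s.
pose G t := g0 + \int[mu]_(s in `[0, t]) q s.
have mf := integrable_measR fi; have mg := integrable_measR gi.
have mp := integrable_measR pi'; have mq := integrable_measR qi.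
have iP := integrable_primitive pi'; have iQ := integrable_primitive qi.
have mF : measurable_fun (`[0, T]%classic : set (measurableTypeR R)) F.
  by apply: measurable_funD => //; exact: integrable_measR iP.
have mG : measurable_fun (`[0, T]%classic : set (measurableTypeR R)) G.
  by apply: measurable_funD => //; exact: integrable_measR iQ.
have cc (P : R -> Prop) : (\forall t \ae mu, `]0, T[%classic t -> P t) ->
    \forall t \ae mu, `[0, T]%classic t -> P t.
  move=> h; apply: ae_imp (ae_and h (ae_and (ae_neq 0) (ae_neq T))) _.
  move=> t [Pt [/eqP t0 /eqP tT]] /=; rewrite in_itv/= => /andP[a b].
  by apply: Pt; rewrite /= in_itv/= !lt_neqAle a b tT eq_sym t0.
have fE' := cc _ fE; have gE' := cc _ gE.
have FB t : `[0, T]%classic t -> `|F t| <= `|f0| + \int[mu]_(s in `[0, T]) `|p s|.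
  rewrite /= in_itv/= => /andP[t0 tT]; apply: (le_trans (ler_normD _ _)).
  by rewrite lerD2l primitive_bound.
have GB t : `[0, T]%classic t -> `|G t| <= `|g0| + \int[mu]_(s in `[0, T]) `|q s|.
  rewrite /= in_itv/= => /andP[t0 tT]; apply: (le_trans (ler_normD _ _)).
  by rewrite lerD2l primitive_bound.
have iFG : mu.-integrable `[0, T] (EFin \o (fun t => F t * G t)).
  have iF : mu.-integrable `[0, T] (EFin \o F).
    apply: integrableDr => //.
    by apply: continuous_integrable => x; exact: cst_continuous.
  exact: (integrableMb (mI T) iF mG GB).
have ipG : mu.-integrable `[0, T] (EFin \o (fun t => p t * G t)).
  exact: (integrableMb (mI T) pi' mG GB).
have iqF : mu.-integrable `[0, T] (EFin \o (fun t => q t * F t)).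
  exact: (integrableMb (mI T) qi mF FB).
have ipq : mu.-integrable `[0, T] (EFin \o (fun t => p t * G t + q t * F t)).
  exact: integrableDr.
have aeq : \forall t \ae mu, `[0, T]%classic t ->
    p t * G t + q t * F t = p t * g t + f t * q t.
  by apply: ae_imp (ae_and fE' gE') _ => t [ft gt] tT; rewrite (ft tT) (gt tT) /F /G; ring.
have mpg : measurable_fun (`[0, T]%classic : set (measurableTypeR R))
    (fun t => p t * g t + f t * q t).
  by apply: measurable_funD; apply: measurable_funM.
split.
- apply: integrable_ae_eq iFG _ => //; first exact: measurable_funM.
  by apply: ae_imp (ae_and fE' gE') _ => t [ft gt] tT; rewrite (ft tT) (gt tT).
- exact: integrable_ae_eq ipq _.
apply: ae_imp (ae_and fE gE) _ => t [ft gt] tT; rewrite (ft tT) (gt tT).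
move: tT; rewrite /= in_itv/= => /andP[/ltW t0 /ltW tT'].
have sub : `[0, t] `<=` `[0, T].
  by move=> s /=; rewrite !in_itv/= => /andP[-> st]; rewrite (le_trans st).
rewrite -(@Rintegral_ae_eq _ _ _ mu _ (fun t => p t * G t + q t * F t)
  (fun t => p t * g t + f t * q t)); last 4 first.
- exact: mI.
- exact: (integrable_measR (integrable_itvS (lexx 0) tT' ipq)).
- exact: measurable_funS (mI T) sub mpg.
- by apply: ae_imp aeq _ => s h st; exact/h/sub.
have ip := integrable_itvS (lexx 0) tT' pi'; have iq := integrable_itvS (lexx 0) tT' qi.
have jp := integrable_mul_primitive iq ip; have jq := integrable_mul_primitive ip iq.
under eq_Rintegral do rewrite /F /G.
rewrite mulrDl !mulrDr (primitive_mul ip iq).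
have eA : \int[mu]_(s in `[0, t]) (g0 * p s + f0 * q s) =
    g0 * \int[mu]_(s in `[0, t]) p s + f0 * \int[mu]_(s in `[0, t]) q s.
  rewrite (@RintegralD _ _ _ mu _ (fun s => g0 * p s) (fun s => f0 * q s))//.
  - by rewrite !RintegralZl.
  - exact: integrableZr'.
  - exact: integrableZr'.
transitivity (f0 * g0 + (\int[mu]_(s in `[0, t]) (g0 * p s + f0 * q s) +
  \int[mu]_(s in `[0, t]) (p s * \int[mu]_(r in `[0, s]) q r +
                           q s * \int[mu]_(r in `[0, s]) p r))).
  by rewrite eA; ring.
congr (_ + _); rewrite -RintegralD//.
- by apply: eq_Rintegral => s _; ring.
- by apply: integrableDr => //; exact: integrableZr'.
- exact: integrableDr.
Qed.

Lemma Rint_expN (rho t : R) : 0 < rho -> 0 <= t ->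
  \int[mu]_(s in `[0, t]) (- rho * expR (- rho * s)) = expR (- rho * t) - 1.
Proof.
move=> r0 t0; have dF x : is_derive x (1 : R) (fun s => expR (- rho * s)) (- rho * expR (- rho * x)).
  have h1 := is_derive_lin (- rho) 0 x.
  have h2 := is_derive_expR (- rho * x + 0).
  have h3 := @is_derive1_comp _ expR (fun s => - rho * s + 0) x _ _ h2 h1.
  rewrite mulrC -[X in expR X]addr0 (_ : (fun s => _) = expR \o (fun s => - rho * s + 0))//.
  by apply/funext => s /=; rewrite addr0.
have cf : continuous (fun s : R => - rho * expR (- rho * s)).
  move=> x; apply: cvgM; first exact: cvg_cst.
  apply: (@continuous_comp _ _ _ (fun s : R => - rho * s) expR); last exact: continuous_expR.
  exact: mulrl_continuous.
by rewrite (Rint_FTC t0 cf dF) mulr0 expR0.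
Qed.

(* If J' >= rho J - e then the primitive of J grows exponentially. *)
Lemma gronwall_growth (T J0 : R) (J H : R -> R) (rho e : R) : 0 <= T -> 0 < rho -> 0 <= e ->
  ae_primitive T J0 J H ->
  (\forall t \ae mu, `]0, T[%classic t -> rho * J t - e <= H t) ->
  (J0 - e * T) * (expR (rho * T) - 1) <= rho * \int[mu]_(s in `[0, T]) J s.
Proof.
move=> T0 r0 e0 [Ji Hi JE] JH.
pose Y t := \int[mu]_(s in `[0, t]) J s.
pose E s := expR (- rho * s).
have cE : continuous E.
  move=> x; apply: (@continuous_comp _ _ _ (fun s : R => - rho * s) expR); last exact: continuous_expR.
  exact: mulrl_continuous.
have iE : mu.-integrable `[0, T] (EFin \o (fun s => - rho * E s)).
  by apply: continuous_integrable => x; apply: cvgM; [exact: cvg_cst|exact: cE].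
have h1 := primitive_mul Ji iE.
rewrite -/(Y T) Rint_expN// -/(E T) in h1.
have iYE := integrable_mul_primitive iE Ji.
have iEE := integrable_mul_primitive Ji iE.
rewrite /= in iYE iEE.
have mE : measurable_fun (`[0, T]%classic : set (measurableTypeR R)) E.
  exact: measurable_continuous.
have iJE : mu.-integrable `[0, T] (EFin \o (fun s => J s * E s)).
  apply: (@integrableMb _ _ _ mu _ J E 1) => // x /=; rewrite in_itv/= => /andP[x0 _].
  by rewrite ger0_norm ?expR_ge0// expR_le1 mulNr oppr_le0 mulr_ge0// ltW.
have h2 : Y T * E T = \int[mu]_(s in `[0, T]) (J s * E s - rho * E s * Y s).
  have -> : Y T * E T = Y T + Y T * (E T - 1) by ring.
  rewrite h1 /Y -RintegralD//; last exact: integrableDr.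
  apply: eq_Rintegral => s /set_mem/=; rewrite in_itv/= => /andP[s0 _].
  by rewrite Rint_expN// -/(E s); ring.
have h3 : \int[mu]_(s in `[0, T]) ((J0 - e * T) * E s) <= Y T * E T.
  rewrite h2; apply: Rintegral_ae_le => //.
  - by apply: continuous_integrable => x; apply: cvgM; [exact: cvg_cst|exact: cE].
  - have : mu.-integrable `[0, T] (EFin \o (fun s => J s * E s + - rho * E s * Y s)).
      exact: integrableDr.
    by apply: eq_integrable => // s _ /=; rewrite !mulNr.
  have JH' : \forall s \ae mu, `[0, T]%classic s -> rho * J s - e <= H s.
    apply: ae_imp (ae_and JH (ae_and (ae_neq 0) (ae_neq T))) _.
    move=> t [Ht [/eqP t0 /eqP tT]] /=; rewrite in_itv/= => /andP[a c].
    by apply: Ht; rewrite /= in_itv/= !lt_neqAle a c tT eq_sym t0.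
  apply: ae_imp (ae_and JE (ae_and (ae_neq 0) (ae_neq T))) _.
  move=> t [Jt [/eqP t0 /eqP tT]] /=; rewrite in_itv/= => /andP[a c].
  have tT' : `]0, T[%classic t by rewrite /= in_itv/= !lt_neqAle a c tT eq_sym t0.
  have Jl : J0 + (rho * Y t - e * t) <= J t.
    rewrite (Jt tT') lerD2l.
    have i1 := integrable_itvS (lexx 0) c Ji; have i2 := integrable_itvS (lexx 0) c Hi.
    have i3 : mu.-integrable `[0, t] (EFin \o (fun _ => e)).
      by apply: continuous_integrable => x; exact: cst_continuous.
    have -> : rho * Y t - e * t = \int[mu]_(s in `[0, t]) (rho * J s - e).
      rewrite RintegralB//; last exact: integrableZr'.
      rewrite RintegralZl//; congr (_ - _).
      have i4 : mu.-integrable `[0, t] (EFin \o (fun _ => 1)).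
        by apply: continuous_integrable => x; exact: cst_continuous.
      transitivity (\int[mu]_(s in `[0, t]) (e * 1)); last first.
        by apply: eq_Rintegral => s _; rewrite mulr1.
      rewrite (@RintegralZl _ _ _ mu _ (fun _ => 1))//; congr (_ * _).
      rewrite (@Rint_FTC R (fun _ => 1) id 0 _ a) ?subr0//.
      by move=> x; exact: cst_continuous.
    apply: Rintegral_ae_le => //; first by apply: integrableBr => //; exact: integrableZr'.
    apply: ae_imp JH' _ => s h /=; rewrite in_itv/= => /andP[s0 st].
    by apply: h; rewrite /= in_itv/= s0 (le_trans st).
  have -> : J t * E t - rho * E t * Y t = (J t - rho * Y t) * E t by ring.
  apply: ler_wpM2r; first exact: expR_ge0.
  have : e * t <= e * T by rewrite ler_wpM2l.
  lra.
move: h3.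
have iE' : mu.-integrable `[0, T] (EFin \o E) by exact: continuous_integrable.
rewrite RintegralZl//.
have -> : \int[mu]_(s in `[0, T]) E s = (1 - E T) / rho.
  apply: (mulfI (_ : - rho != 0)); first by rewrite oppr_eq0 gt_eqF.
  by rewrite -RintegralZl// Rint_expN// -/(E T); field; rewrite gt_eqF.
have ET : 0 < E T by exact: expR_gt0.
have EE : E T * expR (rho * T) = 1 by rewrite /E -expRD mulNr addNr expR0.
move=> h3; rewrite -(ler_pM2r ET).
have -> : (J0 - e * T) * (expR (rho * T) - 1) * E T = rho * ((J0 - e * T) * ((1 - E T) / rho)).
  transitivity ((J0 - e * T) * (E T * expR (rho * T) - E T)); first by ring.
  by rewrite EE; field; rewrite gt_eqF.
by rewrite -mulrA ler_pM2l.
Qed.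

End ae_primitives.

(** * E3 *)

Section du_bois_reymond.
Context {R : realType}.
Notation mu := (@lebesgue_measure R).
Implicit Types (h : R -> R) (t s r T : R).

Lemma ae_zero_of_bumps T h : mu.-integrable `[0, T] (EFin \o h) ->
  (forall r, 0 < r -> r < T -> forall n,
    \int[mu]_(t in `[0, T]) (h t * flat_bump (n.+1%:R * (r - t))) = 0) ->
  \forall t \ae mu, `]0, T[%classic t -> h t = 0.
Proof.
move=> hi h0; pose D := `[0, T]%classic : set (measurableTypeR R).
have mD : measurable D by exact: measurable_itv.
have cl (c r : R) : continuous (fun t : R => flat_bump (c * (r - t))).
  move=> t;
  apply: (@continuous_comp _ _ _ (fun t : R => c * (r - t)) flat_bump).
    apply: cvgM; first exact: cvg_cst.
    by apply: cvgB; [exact: cvg_cst|exact: cvg_id].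
  exact: continuous_flat_bump.
have mb (n : nat) (r : R) : measurable_fun D (fun t : R => flat_bump (n.+1%:R * (r - t))).
  by apply: measurable_continuous; exact: cl.
have Z r : 0 < r -> r < T -> \int[mu]_(t in `[0, r]) h t = 0.
  move=> r0 rT; rewrite (Rint_before h (ltW rT)).
  pose u n t := (h t * flat_bump (n.+1%:R * (r - t)))%:E.
  have mh : measurable_fun D h := integrable_measR hi.
  have mi : measurable_fun D (fun s : R => if s < r then 1 else 0 : R).
    apply: measurable_funTS; apply: measurable_fun_ifT => //.
    by apply: measurable_fun_ltr.
  have [] := @dominated_convergence _ _ _ mu D mD u
    (fun t => (h t * (if t < r then 1 else 0))%:E) (fun t => `|h t|%:E).
  - by move=> n; apply/measurable_EFinP; apply: measurable_funM.
  - by apply/measurable_EFinP; apply: measurable_funM.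
  - apply: aeW => t _; apply: cvg_EFin; first exact: nearW.
    apply: cvgM; first exact: cvg_cst.
    by have := @bump_cvg R (r - t); rewrite subr_gt0.
  - exact: integrable_norm hi.
  - apply: aeW => t n _; rewrite /u /= lee_fin normrM ler_piMr//.
    by rewrite ger0_norm ?bump_ge0 ?bump_le1.
  move=> lint _ lim2.
  have lc : \int[mu]_(y in D) (h y * flat_bump (n.+1%:R * (r - y))) @[n --> \oo] -->
      \int[mu]_(t in D) (h t * (if t < r then 1 else 0)).
    apply: (@fine_cvg _ _ _ _ (fun n => \int[mu]_(y in D) (h y * flat_bump (n.+1%:R * (r - y)))%:E)%E).
    rewrite fineK; [exact: lim2|].
    exact: (integrable_fin_num mD lint).
  have : \int[mu]_(t in D) (h t * (if t < r then 1 else 0)) = 0.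
    move: lc; under eq_cvg do rewrite h0//.
    by move=> lc; rewrite -(cvg_lim (@Rhausdorff R) lc); apply: cvg_lim => //; exact: cvg_cst.
  move=> h1; rewrite -[RHS]h1; apply: Rintegral_ae_eq => //.
  - apply: measurable_funM => //; apply: measurable_funTS; apply: measurable_fun_ifT => //.
    by apply: measurable_fun_ler.
  - exact: measurable_funM.
  - apply: ae_imp (ae_neq r) _ => t /eqP tr _.
    by rewrite le_eqVlt (negbTE tr).
have : \forall t \ae mu, `]0, T[%classic t -> `|h t| <= 0.
  apply: ae_le_of_Rint_le => // u v u0 uv vT; rewrite mul0r.
  have hv : mu.-integrable `[0, v] (EFin \o h) := integrable_itvS (lexx 0) (ltW vT) hi.
  have := Rint_itvD (ltW u0) uv hv; rewrite !Z//; last 2 first.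
  - exact: le_lt_trans vT.
  - exact: lt_le_trans uv.
  by rewrite add0r => <-; rewrite normr0.
by move=> h1; apply: ae_imp h1 _ => t + tT => /(_ tT); rewrite normr_le0 => /eqP.
Qed.

Lemma Rint_cutoff1 (r m s T : R) : s <= T -> r <= T -> 0 <= m ->
  \int[mu]_(t in `[s, T]) cutoff r m 1 t = - cutoff r m 0 s.
Proof.
move=> sT rT m0; have dc := @derivatives_cutoff R r m.
rewrite (Rint_FTC sT (@derivatives_continuous R _ 1 dc) (dc 0)).
by rewrite (cutoff0 m0 rT) sub0r.
Qed.

Lemma du_bois_reymond T (f0 : R) (f g : R -> R) :
  mu.-integrable `[0, T] (EFin \o f) -> mu.-integrable `[0, T] (EFin \o g) ->
  (forall r, 0 < r -> r < T -> forall n,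
    \int[mu]_(t in `[0, T]) (f t * cutoff r n.+1%:R 1 t) + f0 * cutoff r n.+1%:R 0 0 =
    - \int[mu]_(t in `[0, T]) (g t * cutoff r n.+1%:R 0 t)) ->
  ae_primitive T f0 f g.
Proof.
move=> fi gi hfg; split => //.
pose D := `[0, T]%classic : set (measurableTypeR R).
have mD : measurable D by exact: measurable_itv.
have iG := integrable_primitive gi.
have ic0 : mu.-integrable `[0, T] (EFin \o (fun _ => f0)).
  by apply: continuous_integrable => x; exact: cst_continuous.
pose h t := f t - (f0 + \int[mu]_(s in `[0, t]) g s).
have ih1 : mu.-integrable `[0, T] (EFin \o (fun t => f0 + \int[mu]_(s in `[0, t]) g s)).
  exact: integrableDr.
have ih : mu.-integrable `[0, T] (EFin \o h) by exact: integrableBr.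
suff : \forall t \ae mu, `]0, T[%classic t -> h t = 0.
  by move=> h1; apply: ae_imp h1 _ => t + tT => /(_ tT)/eqP; rewrite subr_eq0 => /eqP.
apply: ae_zero_of_bumps => // r r0 rT n; set m : R := n.+1%:R.
have T0 : 0 <= T by rewrite ltW// (lt_trans r0).
have dc := @derivatives_cutoff R r m.
have cc i : continuous (cutoff r m i) := @derivatives_continuous R _ i dc.
have ik : mu.-integrable `[0, T] (EFin \o cutoff r m 1) by exact: continuous_integrable.
have bounded (i : nat) : exists C, forall t, D t -> `|cutoff r m i t| <= C.
  have [c _ cM] := @EVT_max R (fun t => `|cutoff r m i t|) 0 T T0
    (continuous_subspaceT (fun x => cvg_norm (cc i x))).
  by exists `|cutoff r m i c| => t tD; exact: cM.
have ibnd i w : mu.-integrable `[0, T] (EFin \o w) ->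
    mu.-integrable `[0, T] (EFin \o (fun t => w t * cutoff r m i t)).
  move=> iw; have [C hC] := bounded i.
  by apply: (@integrableMb _ _ _ mu D w _ C) => //; exact: measurable_continuous.
have m0 : m != 0 by rewrite pnatr_eq0.
apply: (mulfI (_ : - m != 0)); first by rewrite oppr_eq0.
rewrite mulr0 -RintegralZl//; last first.
  have := integrableZr' (- m^-1) mD (ibnd 1 h ih).
  by apply: eq_integrable => // t _ /=; rewrite cutoff1; congr EFin; field.
transitivity (\int[mu]_(t in `[0, T]) (f t * cutoff r m 1 t -
   (f0 * cutoff r m 1 t + cutoff r m 1 t * \int[mu]_(s in `[0, t]) g s))).
  by apply: eq_Rintegral => t _; rewrite /h cutoff1; ring.
have ikG := integrable_mul_primitive gi ik.
have ic1 := ibnd 1 _ ic0.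
rewrite RintegralB//; [|exact: ibnd|exact: integrableDr].
rewrite RintegralD// (Rint_triangle gi ik) RintegralZl// Rint_cutoff1 ?(ltW rT)//.
have -> : \int[mu]_(s in `[0, T]) (g s * \int[mu]_(t in `[s, T]) cutoff r m 1 t) =
    - \int[mu]_(s in `[0, T]) (g s * cutoff r m 0 s).
  rewrite -mulN1r -RintegralZl//; last exact: ibnd.
  apply: eq_Rintegral => s /set_mem/=; rewrite in_itv/= => /andP[_ sT].
  by rewrite Rint_cutoff1 ?(ltW rT)//; ring.
by rewrite -hfg//; ring.
Qed.

End du_bois_reymond.

(** * E4 *)

Section cylinder_modes.
Context {R : realType}.
Notation mu := (@lebesgue_measure R).
Notation leb := (@lebesgue_measure R).
Notation P2 := (measurableTypeR R * measurableTypeR R)%type.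
Notation P3 := (measurableTypeR R * P2)%type.
Implicit Types (k : int * int).

Definition time (T : R) := (`]0, T[%classic : set (measurableTypeR R)).

Lemma measurable_time T : measurable (time T). Proof. exact: measurable_itv. Qed.
Hint Resolve measurable_time : core.

Let mI (T : R) : measurable (`[0, T]%classic : set (measurableTypeR R)).
Proof. exact: measurable_itv. Qed.

Lemma cylinder_section T (f : R * (R * R) -> R) : L1_cylinder T f ->
  \forall t \ae mu, time T t -> (@area R).-integrable (@cell R) (EFin \o (fun x => f (t, x))).
Proof. exact: (@ae_integrable_section _ _ _ _ R leb (@area R) (time T) (@cell R)). Qed.

Lemma integrable_oo_cc T (f : R -> R) : mu.-integrable (time T) (EFin \o f) ->
  mu.-integrable `[0, T] (EFin \o f).
Proof.
move=> fi; have mf := integrable_measR fi.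
have mf' : measurable_fun (`[0, T]%classic : set (measurableTypeR R)) f.
  exact: (@measurable_fun_itv_cc R 0 T false true).
apply/integrableP; split; first exact/measurable_EFinP.
have /integrableP[_] := fi; rewrite /time.
rewrite integral_itv_bndo_bndc ?integral_itv_obnd_cbnd//.
- do 2 apply: measurableT_comp => //.
  apply: (measurable_funS _ _ mf') => //.
  by move=> t /=; rewrite !in_itv/= => /andP[/ltW -> ->].
- by do 2 apply: measurableT_comp => //.
Qed.

Lemma Rint_oo_cc T (f : R -> R) : mu.-integrable `[0, T] (EFin \o f) ->
  \int[mu]_(t in time T) f t = \int[mu]_(t in `[0, T]) f t.
Proof.
move=> fi; rewrite /time Rintegral_itv_bndo_bndc.
  rewrite Rintegral_itv_obnd_cbnd//.
  by apply: integrableS fi => //; apply: subset_itvr; rewrite bnd_simp.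
by apply: integrableS fi => //; apply: subset_itv; rewrite bnd_simp.
Qed.

Lemma cylinder_Fubini T (f : R * (R * R) -> R) : L1_cylinder T f ->
  mu.-integrable `[0, T] (EFin \o (fun t => \int[@area R]_(x in @cell R) f (t, x))) /\
  \int[@volume R]_(z in cylinder T) f z =
    \int[mu]_(t in `[0, T]) \int[@area R]_(x in @cell R) f (t, x).
Proof.
move=> fi.
have i1 := @integrable_Rint_section _ _ _ _ R leb (@area R) (time T) (@cell R)
  (measurable_time T) measurable_cell f fi.
have i2 := integrable_oo_cc i1; split => //.
rewrite -(Rint_oo_cc i2).
exact: (@Rint_section _ _ _ _ R leb (@area R) (time T) (@cell R)
  (measurable_time T) measurable_cell f fi).
Qed.

Lemma measurable_cylinder T : measurable (@cylinder R T : set P3).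
Proof. exact: measurableX. Qed.

Lemma volume_ae_section (P : R * (R * R) -> Prop) : (\forall z \ae @volume R, P z) ->
  \forall t \ae mu, \forall x \ae @area R, P (t, x).
Proof. exact: (@ae_section _ _ _ _ R leb (@area R) P). Qed.

Lemma L1_cylinderM T (f g : R * (R * R) -> R) (C : R) : L1_cylinder T f ->
  measurable_fun (@cylinder R T : set P3) g -> (forall z, cylinder T z -> `|g z| <= C) ->
  L1_cylinder T (fun z => f z * g z).
Proof.
move=> fi mg gC; exact: (@integrableMb _ _ _ (@volume R) _ f g C (measurable_cylinder T)).
Qed.

Definition wmode (f : R * R -> R) k (th : R) :=
  \int[@area R]_(x in @cell R) (f x * cos (phase k x + th)).

Lemma cmodeE f k : cmode f k = wmode f k 0.
Proof. by apply: eq_Rintegral => x _; rewrite addr0. Qed.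

Lemma smodeE f k : smode f k = wmode f k (- (pi / 2)).
Proof. by apply: eq_Rintegral => x _; rewrite cosBpihalf. Qed.

Lemma wmode_pi f k : (@area R).-integrable (@cell R) (EFin \o f) ->
  wmode f k (- (pi / 2) - pi / 2) = - cmode f k.
Proof.
move=> fi; rewrite -[RHS]mulN1r /cmode -RintegralZl//; last exact: integrable_cphase.
by apply: eq_Rintegral => x _; rewrite addrA cosBpihalf sinBpihalf; ring.
Qed.

Lemma measurable_wave_x k th (D : set P3) :
  measurable_fun D (fun z : P3 => cos (phase k z.2 + th)).
Proof.
apply: measurable_funTS; apply: (@measurableT_comp _ _ _ _ _ _ (cos : measurableTypeR R -> R)).
  by apply: measurable_continuous; exact: continuous_cos.
apply: measurable_funD => //.
apply: (@measurableT_comp _ _ _ _ _ _ (phase k : P2 -> R)) => //.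
exact: measurable_phase.
Qed.

Lemma measurable_time_fun (c : R -> R) (D : set P3) : continuous c ->
  measurable_fun D (fun z : P3 => c z.1).
Proof.
move=> cc; apply: measurable_funTS.
apply: (@measurableT_comp _ _ _ _ _ _ (c : measurableTypeR R -> R)) => //.
exact: measurable_continuous.
Qed.

Lemma continuous_bounded (c : R -> R) (T : R) : continuous c ->
  exists C, forall t, 0 <= t <= T -> `|c t| <= C.
Proof.
move=> cc; have [T0|T0] := leP 0 T; last first.
  by exists 0 => t /andP[a b]; have := le_trans a b; rewrite leNgt T0.
have [u _ cM] := @EVT_max R (fun t => `|c t|) 0 T T0
    (continuous_subspaceT (fun x => cvg_norm (cc x))).
by exists `|c u| => t tD; apply: cM; rewrite in_itv.
Qed.

Lemma Rint_wave T (f : R * (R * R) -> R) k th (c : R -> R) :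
  L1_cylinder T f -> continuous c ->
  mu.-integrable `[0, T] (EFin \o (fun t => wmode (fun x => f (t, x)) k th)) /\
  \int[@volume R]_(z in cylinder T) (f z * (c z.1 * cos (phase k z.2 + th))) =
  \int[mu]_(t in `[0, T]) (wmode (fun x => f (t, x)) k th * c t).
Proof.
move=> fi cc.
have i1 : L1_cylinder T (fun z => f z * cos (phase k z.2 + th)).
  by apply: (@L1_cylinderM _ _ _ 1 fi); [exact: measurable_wave_x|move=> z _; exact: cos_max].
have [i2 _] := cylinder_Fubini i1; split; first exact: i2.
have [C hC] := continuous_bounded T cc.
have i3 : L1_cylinder T (fun z => f z * cos (phase k z.2 + th) * c z.1).
  apply: (@L1_cylinderM _ _ _ C i1); first exact: measurable_time_fun.
  by move=> [t x] [] /=; rewrite in_itv/= => /andP[/ltW t0 /ltW tT] _; apply: hC; rewrite t0.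
transitivity (\int[@volume R]_(z in cylinder T) (f z * cos (phase k z.2 + th) * c z.1)).
  by apply: eq_Rintegral => z _; ring.
have [i4 ->] := cylinder_Fubini i3; apply: Rintegral_ae_eq => //.
- exact: (integrable_measR i4).
- apply: measurable_funM; first exact: (integrable_measR i2).
  exact: measurable_continuous.
apply: ae_imp (ae_and (cylinder_section i1) (ae_and (ae_neq 0) (ae_neq T))) _.
move=> t [si [/eqP t0 /eqP tT]] /=; rewrite in_itv/= => /andP[a b].
rewrite RintegralZr//; apply: si.
by rewrite /time /= in_itv/= !lt_neqAle a b tT eq_sym t0.
Qed.

Lemma integrable_wmode T (f : R * (R * R) -> R) k th : L1_cylinder T f ->
  mu.-integrable `[0, T] (EFin \o (fun t => wmode (fun x => f (t, x)) k th)).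
Proof.
move=> fi; have [] := @Rint_wave T f k th (fun _ => 1) fi; last by [].
by move=> x; exact: cst_continuous.
Qed.

Lemma weak_dx_mode T j f g k th : weak_dx T j f g ->
  \forall t \ae mu, time T t ->
    wmode (fun x => g (t, x)) k th =
    wavenum k j * wmode (fun x => f (t, x)) k (th - pi / 2).
Proof.
move=> [fi gi fg].
have ig := integrable_wmode k th gi; have jf := integrable_wmode k (th - pi / 2) fi.
have ih : mu.-integrable `[0, T] (EFin \o (fun t => wmode (fun x => g (t, x)) k th -
    wavenum k j * wmode (fun x => f (t, x)) k (th - pi / 2))).
  by apply: integrableBr => //; exact: integrableZr'.
suff : \forall t \ae mu, `]0, T[%classic t -> wmode (fun x => g (t, x)) k th -
    wavenum k j * wmode (fun x => f (t, x)) k (th - pi / 2) = 0.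
  by move=> h; apply: ae_imp h _ => t h tT; apply/eqP; rewrite -subr_eq0 h.
apply: ae_zero_of_bumps => // r r0 rT n; set m : R := n.+1%:R.
have dc := @derivatives_cutoff R r m.
have cc i : continuous (cutoff r m i) := @derivatives_continuous R _ i dc.
pose d i := cutoff r m i.+1.
have dd : derivatives d by move=> i x; exact: dc.
have d0 t : r <= t -> d 0 t = 0.
  by move=> rt; rewrite /d cutoff1 bump_le0 ?mulr0// mulr_ge0_le0// subr_le0.
have := fg _ (test_wave k th rT dd d0).
have -> : \int[@volume R]_(z in cylinder T) (f z * 'D_(at_t0 (unit_x R j)) (wave k th d) z)
   = \int[@volume R]_(z in cylinder T)
      (f z * ((- wavenum k j * d 0 z.1) * cos (phase k z.2 + (th - pi / 2)))).
  by apply: eq_Rintegral => z _; rewrite derive_wave_x// addrA cosBpihalf; ring.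
have [_ ->] := @Rint_wave T f k (th - pi / 2) (fun t => - wavenum k j * d 0 t) fi
  (fun x => cvgM (cvg_cst _) (cc 1 x)).
have [_ ->] := @Rint_wave T g k th (d 0) gi (cc 1).
have [C hC] := continuous_bounded T (cc 1).
have ibnd w : mu.-integrable `[0, T] (EFin \o w) ->
    mu.-integrable `[0, T] (EFin \o (fun t => w t * d 0 t)).
  move=> iw; apply: (@integrableMb _ _ _ mu _ w _ C) => //.
  exact: measurable_continuous (cc 1).
have m0 : m != 0 by rewrite pnatr_eq0.
have m0' : - m != 0 by rewrite oppr_eq0.
move=> e; apply: (mulfI m0').
rewrite mulr0 -RintegralZl//; last first.
  have := integrableZr' (- m^-1) (mI T) (ibnd _ ih).
  by apply: eq_integrable => // t _ /=; rewrite /d cutoff1; congr EFin; field.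
transitivity (\int[mu]_(t in `[0, T]) (wmode (fun x => g (t, x)) k th * d 0 t
   + wmode (fun x => f (t, x)) k (th - pi / 2) * (- wavenum k j * d 0 t))).
  by apply: eq_Rintegral => t _; rewrite /d cutoff1; ring.
rewrite RintegralD//; [by rewrite e addrN|exact: ibnd|].
have := integrableZr' (- wavenum k j) (mI T) (ibnd _ jf).
by apply: eq_integrable => // t _ /=; congr EFin; ring.
Qed.

Lemma weak_dx_cmode T j f g k : weak_dx T j f g ->
  \forall t \ae mu, time T t ->
    cmode (fun x => g (t, x)) k = wavenum k j * smode (fun x => f (t, x)) k /\
    smode (fun x => g (t, x)) k = - (wavenum k j * cmode (fun x => f (t, x)) k).
Proof.
move=> fg; have [fi _ _] := fg.
apply: ae_imp (ae_and (weak_dx_mode k 0 fg)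
  (ae_and (weak_dx_mode k (- (pi / 2)) fg) (cylinder_section fi))) _.
move=> t [h1 [h2 fti]] tT; split; first by rewrite cmodeE (h1 tT) sub0r -smodeE.
by rewrite smodeE (h2 tT) wmode_pi ?mulrN//; exact: fti.
Qed.

Lemma weak_dt_mode T f0 f g k th : (@area R).-integrable (@cell R) (EFin \o f0) ->
  weak_dt T f0 f g ->
  ae_primitive T (wmode f0 k th) (fun t => wmode (fun x => f (t, x)) k th)
    (fun t => wmode (fun x => g (t, x)) k th).
Proof.
move=> f0i [fi gi fg]; apply: du_bois_reymond; [exact: integrable_wmode|exact: integrable_wmode|].
move=> r r0 rT n; set m : R := n.+1%:R.
have dc := @derivatives_cutoff R r m.
have cc i : continuous (cutoff r m i) := @derivatives_continuous R _ i dc.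
have m0 : 0 <= m by [].
have := fg _ (test_wave k th rT dc (fun t => @cutoff0 R r m t m0)).
have -> : \int[@volume R]_(z in cylinder T) (f z * 'D_(unit_t R) (wave k th (cutoff r m)) z)
   = \int[@volume R]_(z in cylinder T) (f z * (cutoff r m 1 z.1 * cos (phase k z.2 + th))).
  by apply: eq_Rintegral => z _; rewrite derive_wave_t.
have [_ ->] := @Rint_wave T f k th (cutoff r m 1) fi (cc 1).
have [_ ->] := @Rint_wave T g k th (cutoff r m 0) gi (cc 0).
have -> : \int[@area R]_(x in @cell R) (f0 x * wave k th (cutoff r m) (at_t0 x)) =
    wmode f0 k th * cutoff r m 0 0; last by [].
rewrite -RintegralZr//; first by apply: eq_Rintegral => x _; rewrite /wave /=; ring.
apply: (@integrableMb _ _ _ (@area R) _ f0 _ 1) => //.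
  apply: (@measurableT_comp _ _ _ _ _ _ (cos : measurableTypeR R -> R)).
    by apply: measurable_continuous; exact: continuous_cos.
  by apply: measurable_funD => //; exact: measurable_phase.
by move=> x _; exact: cos_max.
Qed.

End cylinder_modes.
#[global] Hint Resolve measurable_time : core.

(** * F1 *)

Section caratheodory.
Context {R : realType} d (X : measurableType d).

Lemma floor_approx_cvg (t : R) : (Num.floor (n.+1%:R * t))%:~R / n.+1%:R @[n --> \oo] --> t.
Proof.
apply: (@squeeze_cvgr _ _ _ _ (fun n => t - n.+1%:R^-1) (fun _ => t)); last 2 first.
- rewrite -[X in _ --> X]subr0; apply: cvgB; first exact: cvg_cst.
  exact: cvg_harmonic.
- exact: cvg_cst.
apply: nearW => n; have n0 : 0 < n.+1%:R :> R by [].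
have /andP[a b] := floor_itv (n.+1%:R * t).
apply/andP; split; last by rewrite ler_pdivrMr// [t * _]mulrC.
rewrite ler_pdivlMr// mulrBl mulVf ?gt_eqF// lerBlDr -[1]/(1%:~R) -intrD.
by rewrite [t * _]mulrC ltW.
Qed.

Lemma caratheodory_measurable (f : measurableTypeR R * X -> R) :
  (forall x, continuous (fun t : R => f (t, x))) ->
  (forall t, measurable_fun setT (fun x => f (t, x))) -> measurable_fun setT f.
Proof.
move=> cf mf.
pose q n (t : R) : R := (Num.floor (n.+1%:R * t))%:~R / n.+1%:R.
apply: (@measurable_fun_cvg _ _ _ _ (fun n z => f (q n z.1, z.2))); last first.
  move=> [t x] _ /=; have ct := cf x t.
  exact: (cvg_comp _ _ (@floor_approx_cvg t) ct).
move=> n _ A mA; rewrite setTI.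
rewrite (_ : _ @^-1` A = \bigcup_(i : int)
   ([set t : measurableTypeR R | Num.floor (n.+1%:R * t) = i] `*`
    ((fun x => f (i%:~R / n.+1%:R, x)) @^-1` A))); last first.
  apply/seteqP; split => [[t x] /= fA|[t x] [i _ [/= <-]]//].
  by exists (Num.floor (n.+1%:R * t)).
apply: countable_bigcupT_measurable => // i; apply: measurableX; last first.
  by rewrite -[X in measurable X]setTI; exact: mf.
rewrite (_ : [set _ | _] = `[i%:~R / n.+1%:R, (i + 1)%:~R / n.+1%:R[%classic).
  exact: measurable_itv.
apply/seteqP; split => t /=; rewrite in_itv/= ler_pdivrMr// ltr_pdivlMr// mulrC.
  by move=> <-; exact: floor_itv.
by rewrite -floor_eq => /eqP.
Qed.

End caratheodory.

Section continuous_measurable.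
Context {R : realType}.
Notation P2 := (measurableTypeR R * measurableTypeR R)%type.
Notation P3 := (measurableTypeR R * P2)%type.

Lemma continuous_pairing (U V W : topologicalType) (f : U -> V) (g : U -> W) :
  continuous f -> continuous g -> continuous (fun x => (f x, g x)).
Proof.
by move=> cf cg x; exact: (@cvg_pair _ _ _ _ _ _ _ _ _ f g (cf x) (cg x)).
Qed.

Lemma continuous_measurable3 (f : R * (R * R) -> R) : continuous f ->
  measurable_fun setT (f : P3 -> R).
Proof.
move=> cf.
have cc (T : topologicalType) (c : T) : continuous (fun _ : R => c) by exact: cst_continuous.
have cid : continuous (fun t : R => t) by move=> t; exact: cvg_id.
have comp (g : R -> R * (R * R)) : continuous g -> continuous (fun t => f (g t)).
  by move=> cg t; apply: (@continuous_comp _ _ _ g f); [exact: cg|exact: cf].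
apply: caratheodory_measurable => [x|t].
  by apply: comp; exact: continuous_pairing.
apply: caratheodory_measurable => [y|x].
  by apply: comp; do 2 apply: continuous_pairing => //.
apply: measurable_continuous.
by apply: comp; do 2 apply: continuous_pairing => //.
Qed.

End continuous_measurable.

Section wrap.
Context {R : realType}.
Notation mu := (@lebesgue_measure R).
Notation leb := (@lebesgue_measure R).
Notation P2 := (measurableTypeR R * measurableTypeR R)%type.
Notation P3 := (measurableTypeR R * P2)%type.
Notation I2 := (`[0, 2 * pi]%classic : set (measurableTypeR R)).

Lemma leb_translate (c : R) (A : set (measurableTypeR R)) : measurable A ->
  pushforward mu ((fun x => x + c) : measurableTypeR R -> measurableTypeR R) A = mu A.
Proof.
move=> mA.
have mt : measurable_fun setT ((fun x => x + c) : measurableTypeR R -> measurableTypeR R).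
  by apply: measurable_funD.
apply/esym.
pose nu := pushforward mu ((fun x => x + c) : measurableTypeR R -> measurableTypeR R).
have [mt'] : exists mfn : {mfun measurableTypeR R >-> measurableTypeR R}, mfn = (fun x => x + c) :> (_ -> _).
  by exists (HB.pack_for {mfun measurableTypeR R >-> measurableTypeR R} (fun x : R => x + c)
     (isMeasurableFun.Build _ _ _ _ _ mt)).
move=> e; rewrite -e.
apply: (@lebesgue_measure_unique R (pushforward mu mt')) => //= _ [[a b]] _ <-.
rewrite /pushforward e.
have -> : (fun x => x + c) @^-1` `]a, b] = `]a - c, b - c]%classic.
  by apply/seteqP; split => x /=; rewrite !in_itv/= ltrBlDr lerBrDr.
by rewrite !lebesgue_measure_itv/= !lte_fin ltrD2r -!EFinD; case: ifP => // _; congr EFin; ring.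
Qed.

Lemma ge0_integral_translate (c a b : R) (f : R -> \bar R) :
  measurable_fun setT (f : measurableTypeR R -> \bar R) -> (forall x, (0 <= f x)%E) ->
  (\int[mu]_(x in `[a, b[) f (x + c)%R = \int[mu]_(x in `[(a + c)%R, (b + c)%R[) f x)%E.
Proof.
move=> mf f0.
have mt : measurable_fun setT ((fun x => x + c) : measurableTypeR R -> measurableTypeR R).
  by apply: measurable_funD.
have := @ge0_integral_pushforward _ _ (measurableTypeR R) (measurableTypeR R) R _ mt mu
   `[(a + c), (b + c)[ f (measurable_itv _) (measurable_funS measurableT (fun _ _ => I) mf)
   (fun x _ => f0 x).
have -> : (fun x => x + c) @^-1` `[a + c, b + c[ = `[a, b[%classic.
  by apply/seteqP; split => x /=; rewrite !in_itv/= lerD2r ltrD2r.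
move=> <-; apply: eq_measure_integral => A mA _; exact: leb_translate.
Qed.

Definition circle_mod (x : R) : R := x - (Num.floor (x / (2 * pi)))%:~R * (2 * pi).

Lemma wrap_itv x : 0 <= circle_mod x < 2 * pi.
Proof.
have p0 := @twopi_gt0 R; have /andP[a b] := floor_itv (x / (2 * pi)).
rewrite /circle_mod subr_ge0 -ler_pdivlMr// a/= ltrBlDr.
by move: b; rewrite intrD ltr_pdivrMr// mulrDl mul1r addrC.
Qed.

Lemma wrap_eq x (n : int) : 0 <= x - n%:~R * (2 * pi) < 2 * pi -> circle_mod x = x - n%:~R * (2 * pi).
Proof.
have p0 := @twopi_gt0 R; move=> /andP[a b]; rewrite /circle_mod; congr (_ - _%:~R * _).
apply: floor_def; rewrite ler_pdivlMr// -subr_ge0 a/= ltr_pdivrMr//.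
by rewrite intrD mulrDl mul1r addrC -ltrBlDr.
Qed.

Lemma wrap_id x : 0 <= x < 2 * pi -> circle_mod x = x.
Proof. by move=> h; rewrite (@wrap_eq _ 0) ?mul0r ?subr0. Qed.

Lemma wrap_decomp x : exists n : int, x = circle_mod x + n%:~R * (2 * pi).
Proof. by exists (Num.floor (x / (2 * pi))); rewrite /circle_mod subrK. Qed.

Lemma wrapD2pi x : circle_mod (x + 2 * pi) = circle_mod x.
Proof.
have [n xE] := wrap_decomp x; have h := wrap_itv x.
have -> : x + 2 * pi = circle_mod x + (n + 1)%:~R * (2 * pi) by rewrite {1}xE intrD; ring.
by rewrite (@wrap_eq _ (n + 1)) addrK.
Qed.

Lemma measurable_wrap : measurable_fun setT (circle_mod : measurableTypeR R -> measurableTypeR R).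
Proof.
rewrite /circle_mod; apply: measurable_funB => //; apply: measurable_funM => //.
apply: (@nondecreasing_measurable R setT) => // x y xy.
by rewrite ler_int le_floor// ler_wpM2r// invr_ge0 ltW// twopi_gt0.
Qed.

Lemma ge0_integral_wrap (h : R) (f : R -> \bar R) : 0 <= h <= 2 * pi ->
  measurable_fun setT (f : measurableTypeR R -> \bar R) -> (forall x, (0 <= f x)%E) ->
  (\int[mu]_(x in I2) f (circle_mod (x + h)) = \int[mu]_(x in I2) f x)%E.
Proof.
move=> /andP[h0 h2] mf f0; have p0 := @twopi_gt0 R.
have mfw : measurable_fun setT (fun x : measurableTypeR R => f (circle_mod (x + h))).
  apply: (measurableT_comp mf); apply: (measurableT_comp measurable_wrap).
  by apply: measurable_funD.
have mS (g : R -> \bar R) D : measurable_fun setT (g : measurableTypeR R -> \bar R) ->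
   measurable_fun (D : set (measurableTypeR R)) g by move=> mg; apply: measurable_funTS.
rewrite -!(@integral_itv_bndo_bndc R (BLeft 0) (2 * pi)) ; [|exact: mS..].
have split3 c (g : R -> \bar R) : 0 <= c <= 2 * pi ->
    measurable_fun setT (g : measurableTypeR R -> \bar R) -> (forall x, (0 <= g x)%E) ->
   (\int[mu]_(x in `[0%R, (2 * pi)%R[) g x =
    \int[mu]_(x in `[0%R, c[) g x + \int[mu]_(x in `[c, (2 * pi)%R[) g x)%E.
  move=> /andP[c0 c2] mg g0.
  rewrite -ge0_integral_setU//; last 2 first.
  - exact: mS.
  - apply/disj_setPS => x [/=]; rewrite !in_itv/= => /andP[_ a] /andP[b _].
    by rewrite ltNge b in a.
  congr (integral _ _ _); apply/seteqP; split => x /=; rewrite !in_itv/=.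
    by move=> /andP[-> ->]; rewrite andbT; case: (ltP x c) => _; [left|right].
  by case=> /andP[a b]; rewrite ?a ?b ?andbT//=; [exact: lt_le_trans c2|exact: le_trans a].
rewrite (split3 (2 * pi - h)) ?(split3 h)//; last 2 first.
- by rewrite h0.
- by rewrite subr_ge0 h2/= lerBlDr lerDl.
rewrite addeC; congr (_ + _)%E.
- transitivity (\int[mu]_(x in `[(2 * pi - h)%R, (2 * pi)%R[) f (x + (h - 2 * pi))%R)%E.
    apply: eq_integral => x /set_mem/=; rewrite in_itv/= => /andP[a b]; congr f.
    by rewrite (@wrap_eq _ 1) mul1r; [ring|apply/andP; split; lra].
  rewrite ge0_integral_translate//; congr (integral _ _ _).
  by apply/seteqP; split => x /=; rewrite !in_itv/=; congr (_ && _);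
    [congr (_ <= _)|congr (_ < _)|congr (_ <= _)|congr (_ < _)]; ring.
- transitivity (\int[mu]_(x in `[0%R, (2 * pi - h)%R[) f (x + h)%R)%E.
    apply: eq_integral => x /set_mem/=; rewrite in_itv/= => /andP[a b]; congr f.
    by rewrite wrap_id//; apply/andP; split; lra.
  by rewrite ge0_integral_translate// add0r subrK.
Qed.

End wrap.

(** * F2 *)

Section tonelli_rectangle.
Local Open Scope ereal_scope.
Context d1 d2 (T1 : measurableType d1) (T2 : measurableType d2) (R : realType).
Variable m1 : {sigma_finite_measure set T1 -> \bar R}.
Variable m2 : {sigma_finite_measure set T2 -> \bar R}.
Variables (D1 : set T1) (D2 : set T2).
Hypotheses (mD1 : measurable D1) (mD2 : measurable D2).
Variable g : T1 * T2 -> \bar R.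
Hypotheses (mg : measurable_fun setT g) (g0 : forall z, 0 <= g z).

Lemma measurable_section_integral :
  measurable_fun setT (fun x => \int[m2]_(y in D2) g (x, y)).
Proof.
have mS : measurable (setT `*` D2 : set (T1 * T2)) by exact: measurableX.
have mgD : measurable_fun setT (g \_ (setT `*` D2)).
  by apply/(measurable_restrictT _ _).1 => //; exact: measurable_funTS.
have gD0 z : 0 <= (g \_ (setT `*` D2)) z by rewrite patchE; case: ifP.
have := @measurable_fun_fubini_tonelli_F _ _ T1 T2 R m2 _ mgD gD0; rewrite /fubini_F.
congr measurable_fun; apply/funext => x.
rewrite [RHS]integral_mkcond; apply: eq_integral => y _; rewrite !patchE.
congr (if _ then _ else _); apply/idP/idP => /set_mem h; apply: mem_set => //.
by case: h.
Qed.

Lemma tonelli_rectangle :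
  \int[m1 \x m2]_(z in D1 `*` D2) g z = \int[m1]_(x in D1) \int[m2]_(y in D2) g (x, y).
Proof.
have mS : measurable (D1 `*` D2) by exact: measurableX.
have mgD : measurable_fun setT (g \_ (D1 `*` D2)).
  by apply/(measurable_restrictT _ _).1 => //; exact: measurable_funTS.
have gD0 z : 0 <= (g \_ (D1 `*` D2)) z by rewrite patchE; case: ifP.
rewrite integral_mkcond (fubini_tonelli1 _ mgD gD0) [RHS]integral_mkcond.
apply: eq_integral => x _; rewrite /fubini_F [RHS]patchE.
case: ifPn => xD.
  rewrite [RHS]integral_mkcond; apply: eq_integral => y _; rewrite !patchE.
  congr (if _ then _ else _); apply/idP/idP => [/set_mem[]|/set_mem] h; apply: mem_set => //.
  by split => //; exact: set_mem.
rewrite integral0_eq// => y _; rewrite patchE ifF//.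
by apply/negbTE; apply: contra xD => /set_mem[]/= ? _; apply: mem_set.
Qed.

End tonelli_rectangle.

Section measure_preserving.
Context d (T : measurableType d) (R : realType) (mu : {measure set T -> \bar R}).
Variables (D : set T) (S : T -> T).
Hypotheses (mD : measurable D) (mS : measurable_fun setT S).
Hypothesis SD : forall x, D x -> D (S x).
Hypothesis S_int : forall f : T -> \bar R, measurable_fun setT f ->
  (forall x, (0 <= f x)%E) -> (\int[mu]_(x in D) f (S x) = \int[mu]_(x in D) f x)%E.

Lemma preserving_measurable (f : T -> R) : measurable_fun D f ->
  measurable_fun D (fun x => f (S x)).
Proof.
move=> mf; have mf' : measurable_fun setT (f \_ D).
  by apply/(measurable_restrictT _ _).1.
have : measurable_fun D (fun x => (f \_ D) (S x)).
  by apply: measurable_funTS; exact: measurableT_comp.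
by apply: eq_measurable_fun => x /set_mem xD; rewrite patchE mem_set//; exact: SD.
Qed.

Lemma preserving_ge0 (f : T -> \bar R) : measurable_fun D f ->
  (forall x, (0 <= f x)%E) -> (\int[mu]_(x in D) f (S x) = \int[mu]_(x in D) f x)%E.
Proof.
move=> mf f0.
have mf' : measurable_fun setT (f \_ D) by apply/(measurable_restrictT _ _).1.
have f0' x : (0 <= (f \_ D) x)%E by rewrite patchE; case: ifP.
transitivity (\int[mu]_(x in D) (f \_ D) (S x))%E.
  by apply: eq_integral => x /set_mem xD; rewrite patchE mem_set//; exact: SD.
rewrite S_int//; apply: eq_integral => x xD; by rewrite patchE xD.
Qed.

Lemma preserving_Rint (f : T -> R) : measurable_fun D f ->
  \int[mu]_(x in D) f (S x) = \int[mu]_(x in D) f x.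
Proof.
move=> mf; rewrite /Rintegral; congr fine.
have mef : measurable_fun D (EFin \o f) by exact/measurable_EFinP.
rewrite integralE [RHS]integralE; congr (_ - _)%E.
  transitivity (\int[mu]_(x in D) ((EFin \o f)^\+ (S x)))%E.
    by apply: eq_integral => x _; rewrite !funeposE.
  by rewrite (preserving_ge0 (measurable_funepos mef)).
transitivity (\int[mu]_(x in D) ((EFin \o f)^\- (S x)))%E.
  by apply: eq_integral => x _; rewrite !funenegE.
by rewrite (preserving_ge0 (measurable_funeneg mef)).
Qed.

Lemma preserving_integrable (f : T -> R) : mu.-integrable D (EFin \o f) ->
  mu.-integrable D (EFin \o (fun x => f (S x))).
Proof.
move=> fi; have mf := integrable_measR fi; have /integrableP[mef foo] := fi.
apply/integrableP; split; first exact/measurable_EFinP/preserving_measurable.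
have := @preserving_ge0 (fun x => `|(f x)%:E|%E).
by move=> -> //; apply: measurableT_comp.
Qed.

Lemma preserving_ae (P : T -> Prop) : (\forall x \ae mu, D x -> P x) ->
  \forall x \ae mu, D x -> P (S x).
Proof.
move=> [N [mN N0 PN]].
pose g x : \bar R := (\1_N x)%:E.
have mg : measurable_fun setT g by exact/measurable_EFinP/measurable_indic.
have g0 x : (0 <= g x)%E by rewrite lee_fin.
have i0 : (\int[mu]_(x in D) g (S x) = 0)%E.
  rewrite S_int// integral_indic//; apply: (@subset_measure0 _ _ _ mu _ N) => //.
  exact: measurableI.
have mgS : measurable_fun D (fun x => g (S x)).
  by apply: measurable_funTS; exact: measurableT_comp.
have h : ae_eq mu D (fun x => g (S x)) (cst 0%E).
  apply/(ae_eq_integral_abs mu mD mgS); rewrite -[RHS]i0.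
  by apply: eq_integral => x _; rewrite gee0_abs.
apply: ae_imp h _ => x h xD; have /eqP := h xD; rewrite eqe indicE.
have [_|Sx _] := boolP (S x \in N); first by rewrite oner_eq0.
apply: contrapT => nP; move/negP: Sx; apply; apply: mem_set; apply: PN => /= hP.
by apply: nP; exact/hP/SD.
Qed.

End measure_preserving.

Section wrap_torus.
Context {R : realType}.
Notation mu := (@lebesgue_measure R).
Notation leb := (@lebesgue_measure R).
Notation P2 := (measurableTypeR R * measurableTypeR R)%type.
Notation P3 := (measurableTypeR R * P2)%type.
Notation I2 := (`[0, 2 * pi]%classic : set (measurableTypeR R)).

Definition wrap2 (h x : R * R) : R * R := (circle_mod (x.1 + h.1), circle_mod (x.2 + h.2)).
Definition wrap3 (h : R * R) (z : R * (R * R)) := (z.1, wrap2 h z.2).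

Definition small (h : R * R) := (0 <= h.1 <= 2 * pi) /\ (0 <= h.2 <= 2 * pi).

Lemma measurable_wrap2 h : measurable_fun setT (wrap2 h : P2 -> P2).
Proof.
by apply: measurable_fun_pair; apply: (measurableT_comp measurable_wrap);
  apply: measurable_funD.
Qed.

Lemma measurable_wrap3 h : measurable_fun setT (wrap3 h : P3 -> P3).
Proof.
apply: measurable_fun_pair => //.
by apply: (measurableT_comp (measurable_wrap2 h)).
Qed.

Lemma wrap2_cell h x : @cell R (wrap2 h x).
Proof.
have /andP[a b] := wrap_itv (x.1 + h.1); have /andP[c d] := wrap_itv (x.2 + h.2).
by split; rewrite /= in_itv/= ?a ?c ltW.
Qed.

Lemma wrap3_cylinder T h z : @cylinder R T z -> cylinder T (wrap3 h z).
Proof. by case=> tT _; split => //; exact: wrap2_cell. Qed.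

Lemma ge0_integral_wrap2 h (f : P2 -> \bar R) : small h -> measurable_fun setT f ->
  (forall x, (0 <= f x)%E) ->
  (\int[@area R]_(x in @cell R) f (wrap2 h x) = \int[@area R]_(x in @cell R) f x)%E.
Proof.
move=> [h1 h2] mf f0.
have mfw : measurable_fun setT (fun x => f (wrap2 h x)).
  exact: measurableT_comp mf (measurable_wrap2 h).
transitivity (\int[mu]_(x in I2) \int[mu]_(y in I2) f (wrap2 h (x, y)))%E.
  exact: (@tonelli_rectangle _ _ _ _ R leb leb I2 I2 measurable_circle measurable_circle
    (fun x => f (wrap2 h x)) mfw (fun z => f0 _)).
transitivity (\int[mu]_(x in I2) \int[mu]_(y in I2) f (x, y))%E; last first.
  apply/esym.
  exact: (@tonelli_rectangle _ _ _ _ R leb leb I2 I2 measurable_circle measurable_circle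
    f mf f0).
have mG := @measurable_section_integral _ _ (measurableTypeR R) (measurableTypeR R) R leb I2
   measurable_circle f mf f0.
rewrite -[RHS](ge0_integral_wrap h1 mG); last by move=> x; exact: integral_ge0.
apply: eq_integral => x _; rewrite /wrap2 /=.
apply: (ge0_integral_wrap (f := fun y => f (circle_mod (x + h.1), y))) => //.
by apply: (measurableT_comp mf).
Qed.

Lemma ge0_integral_wrap3 T h (f : P3 -> \bar R) : small h -> measurable_fun setT f ->
  (forall x, (0 <= f x)%E) ->
  (\int[@volume R]_(x in cylinder T) f (wrap3 h x) = \int[@volume R]_(x in cylinder T) f x)%E.
Proof.
move=> sh mf f0.
have mfw : measurable_fun setT (fun x => f (wrap3 h x)).
  exact: measurableT_comp mf (measurable_wrap3 h).
transitivity (\int[mu]_(t in time T) \int[@area R]_(x in @cell R) f (wrap3 h (t, x)))%E.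
  exact: (@tonelli_rectangle _ _ _ _ R leb (@area R) (time T) (@cell R)
    (measurable_time T) measurable_cell (fun x => f (wrap3 h x)) mfw (fun z => f0 _)).
transitivity (\int[mu]_(t in time T) \int[@area R]_(x in @cell R) f (t, x))%E; last first.
  apply/esym.
  exact: (@tonelli_rectangle _ _ _ _ R leb (@area R) (time T) (@cell R)
    (measurable_time T) measurable_cell f mf f0).
apply: eq_integral => t _.
apply: (ge0_integral_wrap2 (f := fun x => f (t, x))) => //.
by apply: (measurableT_comp mf).
Qed.

End wrap_torus.

(** * F3 *)

Section translation.
Context {R : realType}.

Lemma derive_translate (V : normedModType R) (f : V -> R) (c v z : V) :
  'D_v (fun z => f (z + c)) z = 'D_v f (z + c).
Proof.
rewrite /derive; apply: f_equal; apply: (f_equal (fun g => g @ 0^')).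
by apply/funext => h /=; rewrite addrA.
Qed.

Lemma derivable_translate (V : normedModType R) (f : V -> R) (c v z : V) :
  derivable f (z + c) v -> derivable (fun z => f (z + c)) z v.
Proof.
rewrite /derivable => df; set g := (X in cvg (X @ _)).
rewrite (_ : g = fun h => h^-1 *: (f (h *: v + (z + c)) - f (z + c))); first exact: df.
by apply/funext => h; rewrite /g /= addrA.
Qed.

Lemma is_Cn_translate (V : normedModType R) n (f : V -> R) (c : V) :
  is_Cn n f -> is_Cn n (fun z => f (z + c)).
Proof.
elim: n f => [|n IH] f [cf df].
  split => // z; apply: (@continuous_comp _ _ _ (fun z : V => z + c) f); last exact: cf.
  by apply: cvgD; [exact: cvg_id|exact: cvg_cst].
split.
  move=> z; apply: (@continuous_comp _ _ _ (fun z : V => z + c) f); last exact: cf.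
  by apply: cvgD; [exact: cvg_id|exact: cvg_cst].
move=> v; have [dfx Cf] := df v; split.
  by move=> z; exact: (@derivable_translate V f c v z (dfx (z + c))).
suff -> : (fun z => 'D_v (fun z => f (z + c)) z) = (fun z => ('D_v f) (z + c)) by exact: (IH ('D_v f) Cf).
by apply/funext => z; rewrite derive_translate.
Qed.

Lemma shift_unit0 (a : R) : a *: unit_x R 0 = (a, 0).
Proof. by congr pair => /=; rewrite /GRing.scale/= ?mulr1 ?mulr0. Qed.

Lemma shift_unit1 (a : R) : a *: unit_x R 1 = (0, a).
Proof. by congr pair => /=; rewrite /GRing.scale/= ?mulr1 ?mulr0. Qed.

Lemma periodic_int (Y : Type) (f : R * R -> Y) (n m : int) (x : R * R) : periodic_x f ->
  f (x.1 + n%:~R * (2 * pi), x.2 + m%:~R * (2 * pi)) = f x.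
Proof.
move=> pf.
have p1 (y : R * R) : f (y.1 + 2 * pi, y.2) = f y.
  rewrite -[RHS](pf 0); congr f; rewrite shift_unit0.
  by case: y => a b; congr pair; rewrite /= addr0.
have p2 (y : R * R) : f (y.1, y.2 + 2 * pi) = f y.
  rewrite -[RHS](pf 1); congr f; rewrite shift_unit1.
  by case: y => a b; congr pair; rewrite /= addr0.
have q1 (k : nat) (y : R * R) : f (y.1 + k%:R * (2 * pi), y.2) = f y.
  elim: k => [|k IH]; first by rewrite mul0r addr0; case: y.
  by rewrite -natr1 mulrDl mul1r addrA (p1 (_, _)).
have q2 (k : nat) (y : R * R) : f (y.1, y.2 + k%:R * (2 * pi)) = f y.
  elim: k => [|k IH]; first by rewrite mul0r addr0; case: y.
  by rewrite -natr1 mulrDl mul1r addrA (p2 (_, _)).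
have r1 (k : int) (y : R * R) : f (y.1 + k%:~R * (2 * pi), y.2) = f y.
  case: k => k; first exact: q1.
  rewrite NegzE mulrNz mulNr -(q1 k.+1 (_, _)) /= subrK; by case: y.
have r2 (k : int) (y : R * R) : f (y.1, y.2 + k%:~R * (2 * pi)) = f y.
  case: k => k; first exact: q2.
  rewrite NegzE mulrNz mulNr -(q2 k.+1 (_, _)) /= subrK; by case: y.
by rewrite (r2 m (x.1 + n%:~R * (2 * pi), x.2)) r1.
Qed.

Lemma wrap2_periodic (Y : Type) (f : R * R -> Y) (h x : R * R) : periodic_x f ->
  f (wrap2 h x) = f (x + h).
Proof.
move=> pf; have [n e1] := wrap_decomp (x.1 + h.1); have [m e2] := wrap_decomp (x.2 + h.2).
rewrite -(periodic_int n m _ pf) /wrap2 /= -e1 -e2.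
by case: x {e1 e2} => a b; case: h.
Qed.

Lemma wrap2_shift_period h j (x : R * R) : wrap2 h (x + (2 * pi) *: unit_x R j) = wrap2 h x.
Proof.
rewrite /wrap2 /unit_x; case: ifP => _ /=; rewrite /GRing.scale/= mulr1 mulr0 addr0;
  by congr pair; rewrite addrAC wrapD2pi.
Qed.

End translation.

Section shifted.
Context {R : realType}.
Notation mu := (@lebesgue_measure R).
Notation P2 := (measurableTypeR R * measurableTypeR R)%type.
Notation P3 := (measurableTypeR R * P2)%type.
Variable h : R * R.
Hypothesis sh : small h.

Let cell_Rint (f : R * R -> R) : measurable_fun (@cell R : set P2) f ->
  \int[@area R]_(x in @cell R) f (wrap2 h x) = \int[@area R]_(x in @cell R) f x.
Proof.
exact: (@preserving_Rint _ _ R (@area R) (@cell R) (wrap2 h) measurable_cell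
  (fun x _ => wrap2_cell h x) (fun f mf f0 => ge0_integral_wrap2 sh mf f0)).
Qed.

Lemma cell_shift_integrable (f : R * R -> R) : (@area R).-integrable (@cell R) (EFin \o f) ->
  (@area R).-integrable (@cell R) (EFin \o (fun x => f (wrap2 h x))).
Proof.
exact: (@preserving_integrable _ _ R (@area R) (@cell R) (wrap2 h) measurable_cell
  (measurable_wrap2 h) (fun x _ => wrap2_cell h x) (fun f mf f0 => ge0_integral_wrap2 sh mf f0)).
Qed.

Let cyl_Rint T (f : R * (R * R) -> R) : measurable_fun (@cylinder R T : set P3) f ->
  \int[@volume R]_(x in cylinder T) f (wrap3 h x) = \int[@volume R]_(x in cylinder T) f x.
Proof.
exact: (@preserving_Rint _ _ R (@volume R) (@cylinder R T) (wrap3 h) (measurable_cylinder T)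
  (fun x => wrap3_cylinder h (z := x)) (fun f mf f0 => ge0_integral_wrap3 T sh mf f0)).
Qed.

Lemma L1_cylinder_shift T f : L1_cylinder T f -> L1_cylinder T (fun z => f (wrap3 h z)).
Proof.
exact: (@preserving_integrable _ _ R (@volume R) (@cylinder R T) (wrap3 h) (measurable_cylinder T)
  (measurable_wrap3 h) (fun x => wrap3_cylinder h (z := x))
  (fun f mf f0 => ge0_integral_wrap3 T sh mf f0)).
Qed.

Lemma ae_cylinder_shift T (P : R * (R * R) -> Prop) :
  (\forall z \ae @volume R, cylinder T z -> P z) ->
  \forall z \ae @volume R, cylinder T z -> P (wrap3 h z).
Proof.
exact: (@preserving_ae _ _ R (@volume R) (@cylinder R T) (wrap3 h) (measurable_cylinder T)
  (measurable_wrap3 h) (fun x => wrap3_cylinder h (z := x))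
  (fun f mf f0 => ge0_integral_wrap3 T sh mf f0)).
Qed.

Definition unshift (phi : R * (R * R) -> R) (z : R * (R * R)) : R := phi (z + (0, - h)).

Lemma unshift_wrap3 (phi : R * (R * R) -> R) z : (forall t, periodic_x (fun x => phi (t, x))) ->
  unshift phi (wrap3 h z) = phi z.
Proof.
move=> pphi; rewrite /unshift /wrap3.
rewrite [_ + _](_ : _ = (z.1, wrap2 h z.2 - h)); last first.
  by congr pair; rewrite /= addr0.
have pp : periodic_x (fun x => phi (z.1, x - h)).
  by move=> j x; rewrite addrAC; exact: (pphi z.1 j (x - h)).
by rewrite (@wrap2_periodic R R (fun x => phi (z.1, x - h)) h z.2 pp) addrK; case: z {pp}.
Qed.

Lemma test_unshift T phi : test_function T phi -> test_function T (unshift phi).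
Proof.
move=> [sphi pphi [T' TT' phi0]]; split.
- by move=> n; apply: is_Cn_translate.
- move=> t j x; rewrite /unshift.
  have e y : (t, y) + (0, - h) = (t, y - h) :> R * (R * R).
    by congr pair; rewrite /= addr0.
  by rewrite !e addrAC; exact: (pphi t j (x - h)).
- exists T' => // t x tT'; rewrite /unshift.
  by rewrite [_ + _](_ : _ = (t, x - h)) ?phi0//; congr pair; rewrite /= addr0.
Qed.

Lemma derive_unshift phi v : 'D_v (unshift phi) = unshift ('D_v phi).
Proof. by apply/funext => z; rewrite /unshift derive_translate. Qed.

Lemma derive_periodic (phi : R * (R * R) -> R) v :
  (forall t, periodic_x (fun x => phi (t, x))) ->
  forall t, periodic_x (fun x => 'D_v phi (t, x)).
Proof.
move=> pphi t j x; pose c : R * (R * R) := (0, (2 * pi) *: unit_x R j).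
have e (z : R * (R * R)) : z + c = (z.1, z.2 + (2 * pi) *: unit_x R j).
  by congr pair; rewrite /= addr0.
have -> : (t, x + (2 * pi) *: unit_x R j) = (t, x) + c by rewrite e.
rewrite -derive_translate; congr ('D_v _ _); apply/funext => z.
by rewrite e pphi; case: z.
Qed.

Let smooth_meas (phi : R * (R * R) -> R) T : smooth phi ->
  measurable_fun (@cylinder R T : set P3) phi.
Proof.
move=> sphi; apply: measurable_funTS; apply: continuous_measurable3.
exact: smooth_continuous.
Qed.

Lemma Rint_cylinder_shift T f psi :
  L1_cylinder T f -> smooth psi -> (forall t, periodic_x (fun x => psi (t, x))) ->
  \int[@volume R]_(z in cylinder T) (f (wrap3 h z) * psi z) =
  \int[@volume R]_(z in cylinder T) (f z * unshift psi z).
Proof.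
move=> fi spsi ppsi.
transitivity (\int[@volume R]_(z in cylinder T) (f (wrap3 h z) * unshift psi (wrap3 h z))).
  by apply: eq_Rintegral => z _; rewrite unshift_wrap3.
apply: (cyl_Rint (f := fun z => f z * unshift psi z)).
apply: measurable_funM; first exact: (integrable_measR fi).
by apply: smooth_meas => n; exact: is_Cn_translate.
Qed.

Lemma weak_dx_shift T j f g : weak_dx T j f g ->
  weak_dx T j (fun z => f (wrap3 h z)) (fun z => g (wrap3 h z)).
Proof.
move=> [fi gi fg]; split; [exact: L1_cylinder_shift|exact: L1_cylinder_shift|].
move=> phi tphi; have [sphi pphi _] := tphi.
rewrite (Rint_cylinder_shift fi (smooth_derive _ sphi) (derive_periodic _ pphi)).
rewrite (Rint_cylinder_shift gi sphi pphi) -derive_unshift.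
exact: fg (test_unshift tphi).
Qed.

Lemma weak_dt_shift T (f0 : R * R -> R) (f g : R * (R * R) -> R) : measurable_fun (@cell R : set P2) f0 ->
  {in @cell R, forall x, f0 (wrap2 h x) = f0 x} -> weak_dt T f0 f g ->
  weak_dt T f0 (fun z => f (wrap3 h z)) (fun z => g (wrap3 h z)).
Proof.
move=> mf0 f0h [fi gi fg]; split; [exact: L1_cylinder_shift|exact: L1_cylinder_shift|].
move=> phi tphi; have [sphi pphi _] := tphi.
rewrite (Rint_cylinder_shift fi (smooth_derive _ sphi) (derive_periodic _ pphi)).
rewrite (Rint_cylinder_shift gi sphi pphi) -derive_unshift.
rewrite -(fg _ (test_unshift tphi)); congr (_ + _).
transitivity (\int[@area R]_(x in @cell R)
  (f0 (wrap2 h x) * unshift phi (at_t0 (wrap2 h x)))).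
  apply: eq_Rintegral => x xc; rewrite f0h//; congr (_ * _).
  by rewrite -(unshift_wrap3 (at_t0 x) pphi).
apply: (cell_Rint (f := fun x => f0 x * unshift phi (at_t0 x))).
apply: measurable_funM => //; apply: measurable_funTS.
have mu_ : measurable_fun setT (unshift phi : P3 -> R).
  apply: continuous_measurable3; apply: smooth_continuous => n.
  exact: is_Cn_translate.
have m2 : measurable_fun setT (fun x : P2 => ((0 : measurableTypeR R), x) : P3).
  by apply: measurable_fun_pair => //; exact: measurable_cst.
exact: (measurableT_comp mu_ m2).
Qed.

Lemma phase_wrap2 k (x : R * R) th : cos (phase k (wrap2 h x) + th) = cos (phase k x + phase k h + th).
Proof.
rewrite (@wrap2_periodic R R (fun x => cos (phase k x + th)) h x).
  by rewrite (_ : x + h = 1 *: h + x) ?phase_lin ?mul1r 1?(addrC (phase k h))// scale1r addrC.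
exact: cos_phase_periodic.
Qed.

Lemma wmode_shift (f : R * R -> R) k th : (@area R).-integrable (@cell R) (EFin \o f) ->
  wmode (fun x => f (wrap2 h x)) k th = wmode f k (th - phase k h).
Proof.
move=> fi; rewrite /wmode.
transitivity (\int[@area R]_(x in @cell R)
  (f (wrap2 h x) * cos (phase k (wrap2 h x) + (th - phase k h)))).
  by apply: eq_Rintegral => x _; rewrite phase_wrap2; congr (_ * cos _); ring.
apply: (cell_Rint (f := fun x => f x * cos (phase k x + (th - phase k h)))).
apply: measurable_funM; first exact: (integrable_measR fi).
apply: (@measurableT_comp _ _ _ _ _ _ (cos : measurableTypeR R -> R)).
  by apply: measurable_continuous; exact: continuous_cos.
by apply: measurable_funD => //; exact: measurable_phase.
Qed.

Lemma wmode_rot (f : R * R -> R) k th a : (@area R).-integrable (@cell R) (EFin \o f) ->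
  wmode f k (th - a) = cos a * wmode f k th + sin a * wmode f k (th - pi / 2).
Proof.
move=> fi.
have i1 b : (@area R).-integrable (@cell R) (EFin \o (fun x => f x * cos (phase k x + b))).
  apply: (@integrableMb _ _ _ (@area R) _ f _ 1) => //.
    apply: (@measurableT_comp _ _ _ _ _ _ (cos : measurableTypeR R -> R)).
      by apply: measurable_continuous; exact: continuous_cos.
    by apply: measurable_funD => //; exact: measurable_phase.
  by move=> x _; exact: cos_max.
rewrite /wmode -!RintegralZl// -RintegralD//; [|exact: integrableZr'|exact: integrableZr'].
by apply: eq_Rintegral => x _; rewrite !addrA cosBpihalf cosB; ring.
Qed.

Lemma cmode_shift (f : R * R -> R) k : (@area R).-integrable (@cell R) (EFin \o f) ->
  cmode (fun x => f (wrap2 h x)) k = cos (phase k h) * cmode f k + sin (phase k h) * smode f k.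
Proof. by move=> fi; rewrite cmodeE wmode_shift// wmode_rot// -cmodeE sub0r -smodeE. Qed.

Lemma smode_shift (f : R * R -> R) k : (@area R).-integrable (@cell R) (EFin \o f) ->
  smode (fun x => f (wrap2 h x)) k = cos (phase k h) * smode f k - sin (phase k h) * cmode f k.
Proof.
by move=> fi; rewrite smodeE wmode_shift// wmode_rot// -smodeE wmode_pi// mulrN.
Qed.

End shifted.

(** * F4 *)

Section invariance.
Context {R : realType}.
Notation mu := (@lebesgue_measure R).
Notation P2 := (measurableTypeR R * measurableTypeR R)%type.
Notation P3 := (measurableTypeR R * P2)%type.

Definition L2cell (f : R * R -> R) : Prop :=
  measurable_fun setT (f : P2 -> measurableTypeR R) /\
  (\int[@area R]_(x in @cell R) (f x ^+ 2)%:E < +oo)%E.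

Lemma Hs_L2 s f : Hs s f -> L2cell f.
Proof. by case. Qed.

Lemma L2_integrable (f : R * R -> R) : L2cell f ->
  (@area R).-integrable (@cell R) (EFin \o f).
Proof.
move=> [mf f2]; have mf' : measurable_fun (@cell R : set P2) f by exact: measurable_funTS.
have i2 : (@area R).-integrable (@cell R) (EFin \o (fun x => 1 + f x ^+ 2)).
  apply: integrableDr => //.
    apply: (@integrable_bounded _ _ _ (@area R) (@cell R) _ 1) => //.
    - exact: area_cell_lty.
    - by move=> x _; rewrite normr1.
  apply/integrableP; split; first by apply/measurable_EFinP; exact: measurable_funX.
  rewrite (_ : (fun x => _) = (fun x => (f x ^+ 2)%:E))//.
  by apply/funext => x; rewrite /= ger0_norm ?sqr_ge0.
apply: (le_integrable _ _ _ i2) => //; first exact/measurable_EFinP.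
move=> x _ /=; rewrite lee_fin (ger0_norm (x := 1 + _)) ?addr_ge0 ?sqr_ge0//.
by rewrite -real_normK ?num_real//; have := sqr_ge0 (`|f x| - 1); nra.
Qed.

Lemma Hs_integrable s f : Hs s f -> (@area R).-integrable (@cell R) (EFin \o f).
Proof. by move=> /Hs_L2/L2_integrable. Qed.

Lemma ae_cylinder_slices T (P : R * (R * R) -> Prop) :
  (\forall z \ae @volume R, cylinder T z -> P z) ->
  \forall t \ae mu, time T t -> \forall x \ae @area R, @cell R x -> P (t, x).
Proof.
move=> /volume_ae_section h; apply: ae_imp h _ => t h tT.
by apply: ae_imp h _ => x h xc; apply: h; split.
Qed.

Lemma cmode_ae f g k : (@area R).-integrable (@cell R) (EFin \o f) ->
  (@area R).-integrable (@cell R) (EFin \o g) ->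
  (\forall x \ae @area R, @cell R x -> f x = g x) -> cmode f k = cmode g k.
Proof.
move=> fi gi fg; apply: Rintegral_ae_eq => //.
- exact: integrable_measR (integrable_cphase k fi).
- exact: integrable_measR (integrable_cphase k gi).
- by apply: ae_imp fg _ => x h /h ->.
Qed.

Lemma smode_ae f g k : (@area R).-integrable (@cell R) (EFin \o f) ->
  (@area R).-integrable (@cell R) (EFin \o g) ->
  (\forall x \ae @area R, @cell R x -> f x = g x) -> smode f k = smode g k.
Proof.
move=> fi gi fg; apply: Rintegral_ae_eq => //.
- exact: integrable_measR (integrable_sphase k fi).
- exact: integrable_measR (integrable_sphase k gi).
- by apply: ae_imp fg _ => x h /h ->.
Qed.

Variable h : R * R.
Hypothesis sh : small h.

Lemma invariant_mode_eq0 f k : (@area R).-integrable (@cell R) (EFin \o f) ->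
  (\forall x \ae @area R, @cell R x -> f (wrap2 h x) = f x) ->
  cos (phase k h) < 1 -> cmode f k = 0 /\ smode f k = 0.
Proof.
move=> fi fh c1; have fhi := cell_shift_integrable sh fi.
have e1 := cmode_shift sh k fi; rewrite (cmode_ae k fhi fi fh) in e1.
have e2 := smode_shift sh k fi; rewrite (smode_ae k fhi fi fh) in e2.
move: c1 e1 e2; set c := cos _; set s := sin _; set A := cmode f k; set B := smode f k.
move=> c1 e1 e2.
have : (1 - c) * (A ^+ 2 + B ^+ 2) = 0.
  have e : A ^+ 2 + B ^+ 2 = A * (c * A + s * B) + B * (c * B - s * A) by rewrite -e1 -e2 !expr2.
  by rewrite mulrBl mul1r {1}e; ring.
move/eqP; rewrite mulf_eq0 subr_eq0 gt_eqF//= paddr_eq0 ?sqr_ge0//.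
by rewrite !sqrf_eq0 => /andP[/eqP -> /eqP ->].
Qed.

Lemma Hs_norm_shift s f : L2cell f ->
  Hs_norm_sq s (fun x => f (wrap2 h x)) = Hs_norm_sq s f.
Proof.
move=> /L2_integrable fi; rewrite /Hs_norm_sq; apply: eq_esum => k _; congr (_ * _)%:E.
rewrite /fourier_cos /fourier_sin -!/(cmode _ k) -!/(smode _ k).
rewrite cmode_shift// smode_shift//.
have := cos2Dsin2 (phase k h); set c := cos _; set s' := sin _; set A := cmode f k; set B := smode f k.
set q := (_ ^+ 2)^-1 => cs.
transitivity (q ^+ 2 * ((c ^+ 2 + s' ^+ 2) * (A ^+ 2 + B ^+ 2))); last by rewrite cs; ring.
by ring.
Qed.

Lemma Hs_shift s f : Hs s f -> Hs s (fun x => f (wrap2 h x)).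
Proof.
move=> hf; have f2 := Hs_L2 hf; have [mf pf f2oo fs] := hf; split.
- have mf' : measurable_fun setT (f : P2 -> measurableTypeR R) by [].
  exact: (measurableT_comp mf' (measurable_wrap2 h)).
- by move=> j x; rewrite wrap2_shift_period.
- have := @ge0_integral_wrap2 R h (fun x => (f x ^+ 2)%:E) sh => /= .
  move=> ->//; first by apply/measurable_EFinP; exact: measurable_funX.
  by move=> x; rewrite lee_fin sqr_ge0.
- by rewrite Hs_norm_shift.
Qed.

Definition shift_state (U : state R (R * (R * R))) : state R (R * (R * R)) :=
  (fun z => U.1 (wrap3 h z), fun z => U.2 (wrap3 h z)).

Lemma LinfHs_shift s T U : LinfHs s T U -> LinfHs s T (shift_state U).
Proof.
move=> [m1 m2 aeHs fin]; split.
- move=> i; apply: (@preserving_measurable _ P3 R (`]0, T[ `*` setT) (wrap3 h)) (m1 i).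
  + by apply: measurableX => //; exact: measurable_itv.
  + exact: measurable_wrap3.
  + by move=> z [].
- move=> i j; apply: (@preserving_measurable _ P3 R (`]0, T[ `*` setT) (wrap3 h)) (m2 i j).
  + by apply: measurableX => //; exact: measurable_itv.
  + exact: measurable_wrap3.
  + by move=> z [].
- apply: ae_imp aeHs _ => t hs tT; have [h1 h2] := hs tT; split.
  + by move=> i; apply: (Hs_shift (h1 i)).
  + by move=> i j; apply: (Hs_shift (h2 i j)).
- rewrite /LinfHs_norm; set F := (X in ess_sup _ X); suff -> : ess_sup mu F =
    ess_sup mu ((fun t => state_Hs_norm s (slice U t)) \_ `]0, T[) by [].
  apply: eq_ess_sup; apply: ae_imp aeHs _ => t hs; rewrite /F !patchE.
  case: ifPn => // /set_mem tT; have [h1 h2] := hs tT; congr sqrte; congr (_ + _)%E.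
    by apply: eq_bigr => i _; exact: Hs_norm_shift (Hs_L2 (h1 i)).
  by apply: eq_bigr => i _; apply: eq_bigr => j _; exact: Hs_norm_shift (Hs_L2 (h2 i j)).
Qed.

Lemma sol_shift eps b s T U0 U : state_Hs s U0 ->
  (forall x, @cell R x -> U0.1 (wrap2 h x) = U0.1 x /\ U0.2 (wrap2 h x) = U0.2 x) ->
  euler_oldroyd_sol eps b s T U0 U -> euler_oldroyd_sol eps b s T U0 (shift_state U).
Proof.
move=> [h1 h2] inv [LU [p [ut [Dp [Du [taut [Dtau [[w1 w2 w3 w4 w5] eqn]]]]]]]].
split; first exact: LinfHs_shift.
exists (fun z => p (wrap3 h z)), (fun z => ut (wrap3 h z)), (fun z => Dp (wrap3 h z)),
  (fun z => Du (wrap3 h z)), (fun z => taut (wrap3 h z)), (fun j z => Dtau j (wrap3 h z)).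
split; last first.
  exact: (@ae_cylinder_shift R h sh T (fun z =>
    [/\ ut z + \sum_(j < 2) U.1 z j 0 *: col j (Du z) + Dp z
             = \sum_(j < 2) col j (Dtau j z),
             taut z + \sum_(j < 2) U.1 z j 0 *: Dtau j z
             + Qterm b (U.2 z) (Du z)
             = (eps ^+ 2)^-1 *: (strain (Du z) - U.2 z) &
             \tr (Du z) = 0]) eqn).
split.
- move=> i; apply: (weak_dt_shift sh _ _ (w1 i)).
    by have [mf _ _ _] := h1 i; apply: measurable_funTS.
  by move=> x /set_mem/inv[->].
- move=> i j; apply: (weak_dt_shift sh _ _ (w2 i j)).
    by have [mf _ _ _] := h2 i j; apply: measurable_funTS.
  by move=> x /set_mem/inv[_ ->].
- by move=> i j; apply: (weak_dx_shift sh (w3 i j)).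
- by move=> i j k; apply: (weak_dx_shift sh (w4 i j k)).
- by move=> j; apply: (weak_dx_shift sh (w5 j)).
Qed.

(** Uniqueness turns a symmetry of the data into a symmetry of the solution,
    and a symmetry of the solution kills Fourier modes. *)
Lemma unique_sol_modes eps b s T U0 U k : state_Hs s U0 ->
  (forall x, @cell R x -> U0.1 (wrap2 h x) = U0.1 x /\ U0.2 (wrap2 h x) = U0.2 x) ->
  euler_oldroyd_sol eps b s T U0 U ->
  (forall V, euler_oldroyd_sol eps b s T U0 V ->
         \forall z \ae @volume R, cylinder T z -> V.1 z = U.1 z /\ V.2 z = U.2 z) ->
  cos (phase k h) < 1 ->
  \forall t \ae mu, time T t ->
    (forall i, cmode (fun x => U.1 (t, x) i 0) k = 0 /\ smode (fun x => U.1 (t, x) i 0) k = 0) /\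
    (forall i j, cmode (fun x => U.2 (t, x) i j) k = 0 /\ smode (fun x => U.2 (t, x) i j) k = 0).
Proof.
move=> sU0 inv sol uniq c1; have [[_ _ aeHs _] _] := sol.
have := ae_cylinder_slices (uniq _ (sol_shift sU0 inv sol)) => aeinv.
apply: ae_imp (ae_and aeHs aeinv) _ => t [hs hinv] tT.
have [h1 h2] := hs tT; have {}hinv := hinv tT; split.
  move=> i; apply: invariant_mode_eq0 c1; first exact: Hs_integrable (h1 i).
  by apply: ae_imp hinv _ => x hx /hx[e _]; move: e => /= ->.
move=> i j; apply: invariant_mode_eq0 c1; first exact: Hs_integrable (h2 i j).
by apply: ae_imp hinv _ => x hx /hx[_ e]; move: e => /= ->.
Qed.

End invariance.

(** * G1 *)

Section shear_structure.
Context {R : realType}.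
Notation mu := (@lebesgue_measure R).
Notation P2 := (measurableTypeR R * measurableTypeR R)%type.
Notation P3 := (measurableTypeR R * P2)%type.

Definition no_modes (f : R * R -> R) (k : int * int) := cmode f k = 0 /\ smode f k = 0.

Lemma ae_forall_modes T (P : int * int -> R -> Prop) :
  (forall k, \forall t \ae mu, time T t -> P k t) ->
  \forall t \ae mu, time T t -> forall k, P k t.
Proof.
move=> h; have h' : \forall t \ae mu, forall n : nat, time T t ->
    (if unpickle n is Some k then P k t else True).
  apply: ae_foralln => n; case: unpickle => [k|]; first exact: h.
  by apply: aeW.
by apply: ae_imp h' _ => t H tT k; have := H (pickle k) tT; rewrite pickleK.
Qed.

Lemma weak_dx_modes T j f g : weak_dx T j f g ->
  \forall t \ae mu, time T t -> forall k,
    cmode (fun x => g (t, x)) k = wavenum k j * smode (fun x => f (t, x)) k /\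
    smode (fun x => g (t, x)) k = - (wavenum k j * cmode (fun x => f (t, x)) k).
Proof. by move=> w; apply: ae_forall_modes => k; exact: weak_dx_cmode. Qed.

Lemma weak_dt_cmode T f0 f g k : (@area R).-integrable (@cell R) (EFin \o f0) ->
  weak_dt T f0 f g ->
  ae_primitive T (cmode f0 k) (fun t => cmode (fun x => f (t, x)) k)
    (fun t => cmode (fun x => g (t, x)) k).
Proof.
move=> f0i w; have := weak_dt_mode k 0 f0i w; rewrite -cmodeE.
by congr ae_primitive; apply/funext => t; rewrite cmodeE.
Qed.

Lemma weak_dt_smode T f0 f g k : (@area R).-integrable (@cell R) (EFin \o f0) ->
  weak_dt T f0 f g ->
  ae_primitive T (smode f0 k) (fun t => smode (fun x => f (t, x)) k)
    (fun t => smode (fun x => g (t, x)) k).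
Proof.
move=> f0i w; have := weak_dt_mode k (- (pi / 2)) f0i w; rewrite -smodeE.
by congr ae_primitive; apply/funext => t; rewrite smodeE.
Qed.

Lemma integrable_cmode T f k : L1_cylinder T f ->
  mu.-integrable `[0, T] (EFin \o (fun t => cmode (fun x => f (t, x)) k)).
Proof.
by move=> fi; have := integrable_wmode k 0 fi; apply: eq_integrable => // t _ /=; rewrite cmodeE.
Qed.

Lemma integrable_smode T f k : L1_cylinder T f ->
  mu.-integrable `[0, T] (EFin \o (fun t => smode (fun x => f (t, x)) k)).
Proof.
move=> fi; have := integrable_wmode k (- (pi / 2)) fi.
by apply: eq_integrable => // t _ /=; rewrite smodeE.
Qed.

Lemma ae_itv_cc T (P : R -> Prop) : (\forall t \ae mu, time T t -> P t) ->
  \forall t \ae mu, `[0, T]%classic t -> P t.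
Proof.
move=> h; apply: ae_imp (ae_and h (ae_and (ae_neq 0) (ae_neq T))) _ => t [H [t0 tT]].
rewrite /= in_itv/= => /andP[a b]; apply: H; rewrite /time /= in_itv/= !lt_neqAle a b.
by rewrite eq_sym; move/eqP: t0 => ->; move/eqP: tT => ->.
Qed.

Lemma ae_primitive_eq T f0 (f p q : R -> R) : ae_primitive T f0 f p ->
  mu.-integrable `[0, T] (EFin \o q) -> (\forall t \ae mu, time T t -> p t = q t) ->
  ae_primitive T f0 f q.
Proof.
move=> [fi pi' fE] qi pq; split => //; apply: ae_imp fE _ => t ft tT; rewrite ft//.
congr (_ + _); have tT' : t <= T by move: tT => /=; rewrite in_itv/= => /andP[_ /ltW].
apply: Rintegral_ae_eq => //.
- exact: (integrable_measR (integrable_itvS (lexx 0) tT' pi')).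
- exact: (integrable_measR (integrable_itvS (lexx 0) tT' qi)).
apply: ae_imp (ae_itv_cc pq) _ => s H; rewrite /= in_itv/= => /andP[s0 st].
by apply: H; rewrite /= in_itv/= s0 (le_trans st).
Qed.

Lemma no_modes_eq0 f : (@area R).-integrable (@cell R) (EFin \o f) ->
  (forall k, no_modes f k) -> \forall x \ae @area R, @cell R x -> f x = 0.
Proof. by move=> fi h; apply: cell_uniqueness. Qed.

Lemma sum_ord2 (V : nmodType) (F : 'I_2 -> V) : \sum_(j < 2) F j = F 0 + F 1.
Proof.
rewrite big_ord_recl big_ord_recl big_ord0 addr0; congr (F _ + F _); exact/val_inj.
Qed.

(* a 2 x 2 velocity gradient all of whose entries vanish but the (1, 0) one *)
Lemma Qterm_shear b (tau G : 'M[R]_2) : G 0 0 = 0 -> G 0 1 = 0 -> G 1 1 = 0 ->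
  Qterm b tau G 1 0 = 2^-1 * G 1 0 * ((1 + b) * tau 1 1 - (1 - b) * tau 0 0).
Proof.
move=> G0 G1 G2; rewrite /Qterm /vorticity /strain.
by rewrite !(mxE, sum_ord2) G0 G1 G2; ring.
Qed.

End shear_structure.

(** * G2 *)

Section shear_solutions.
Context {R : realType}.
Notation mu := (@lebesgue_measure R).
Notation P2 := (measurableTypeR R * measurableTypeR R)%type.
Notation P3 := (measurableTypeR R * P2)%type.

Lemma ae_ord2 (P : 'I_2 -> R -> Prop) : (forall i, \forall t \ae mu, P i t) ->
  \forall t \ae mu, forall i, P i t.
Proof.
move=> h; apply: ae_imp (ae_and (h 0) (h 1)) _ => t [h0 h1] i.
by have [->|->] : i = 0 \/ i = 1 by case: i => -[|[|//]] ilt; [left|right]; exact/val_inj.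
Qed.

Lemma Rint_cell0 : \int[@area R]_(x in @cell R) (0 : R) = 0.
Proof. by rewrite Rintegral_cst ?mul0r. Qed.

Lemma modes_ae0 f k : (@area R).-integrable (@cell R) (EFin \o f) ->
  (\forall x \ae @area R, @cell R x -> f x = 0) -> no_modes f k.
Proof.
move=> fi f0; have i0 : (@area R).-integrable (@cell R) (EFin \o (fun _ => 0)).
  by have := integrableZr' 0 measurable_cell fi; apply: eq_integrable => // x _ /=; rewrite mul0r.
split.
  rewrite (cmode_ae k fi i0 f0) /cmode; under eq_Rintegral do rewrite mul0r.
  exact: Rint_cell0.
rewrite (smode_ae k fi i0 f0) /smode; under eq_Rintegral do rewrite mul0r.
exact: Rint_cell0.
Qed.

Lemma phase0 (x : R * R) : phase (0, 0) x = 0.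
Proof. by rewrite /phase/= !mul0r addr0. Qed.

Lemma smode00 f : smode f (0, 0) = 0 :> R.
Proof.
rewrite /smode; under eq_Rintegral do rewrite phase0 sin0 mulr0.
exact: Rint_cell0.
Qed.

Lemma wavenum0 j : wavenum (0, 0) j = 0 :> R.
Proof. by rewrite /wavenum; case: ifP. Qed.

Lemma weak_dx_eq0 T j f g : weak_dx T j f g ->
  (\forall t \ae mu, time T t -> forall k, wavenum k j != 0 :> R ->
     no_modes (fun x => f (t, x)) k) ->
  \forall t \ae mu, time T t -> \forall x \ae @area R, @cell R x -> g (t, x) = 0.
Proof.
move=> fg nm; have [_ gi _] := fg.
apply: ae_imp (ae_and nm (ae_and (weak_dx_modes fg) (cylinder_section gi))) _.
move=> t [h1 [h2 h3]] tT; apply: no_modes_eq0; first exact: h3.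
move=> k; have [e1 e2] := h2 tT k; split.
  have [k0|/(h1 tT k)[_ s0]] := eqVneq (wavenum k j : R) 0; first by rewrite e1 k0 mul0r.
  by rewrite e1 s0 mulr0.
have [k0|/(h1 tT k)[c0 _]] := eqVneq (wavenum k j : R) 0; first by rewrite e2 k0 mul0r oppr0.
by rewrite e2 c0 mulr0 oppr0.
Qed.

Variables (eps b s T : R) (U0 : state R (R * R)) (U : state R (R * (R * R))).
Hypothesis U0_Hs : state_Hs s U0.
Hypothesis sol : euler_oldroyd_sol eps b s T U0 U.

Let mu0 : R := (eps ^+ 2)^-1.

(** For a solution without Fourier modes of nonzero wavenumber, the velocity
    gradient vanishes, and the stress just relaxes. *)
Lemma constant_stress i j :
  (forall k, k != (0, 0) -> \forall t \ae mu, time T t ->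
    (forall i, no_modes (fun x => U.1 (t, x) i 0) k) /\
    (forall i j, no_modes (fun x => U.2 (t, x) i j) k)) ->
  ae_primitive T (cmode (fun x => U0.2 x i j) (0, 0))
    (fun t => cmode (fun x => U.2 (t, x) i j) (0, 0))
    (fun t => - mu0 * cmode (fun x => U.2 (t, x) i j) (0, 0)).
Proof.
move=> nm; have [_ [p [ut [Dp [Du [taut [Dtau [[w1 w2 w3 w4 w5] eqn]]]]]]]] := sol.
have [_ h2] := U0_Hs.
have nm' : \forall t \ae mu, time T t -> forall k, k != (0, 0) ->
    (forall i, no_modes (fun x => U.1 (t, x) i 0) k) /\
    (forall i j, no_modes (fun x => U.2 (t, x) i j) k).
  apply: ae_forall_modes => k; have [->|k0] := eqVneq k (0, 0); first by apply: aeW => t _ /eqP.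
  by apply: ae_imp (nm k k0) _ => t H tT _; exact: H.
have wk (k : int * int) l : wavenum k l != 0 :> R -> k != (0, 0).
  by apply: contra_neq => ->; rewrite wavenum0.
have Du0 : \forall t \ae mu, forall i j, time T t -> \forall x \ae @area R, @cell R x ->
    Du (t, x) i j = 0.
  apply: ae_ord2 => i'; apply: ae_ord2 => j'.
  apply: (weak_dx_eq0 (w3 i' j')); apply: ae_imp nm' _ => t H tT k /wk k0.
  by have [H1 _] := H tT k k0.
have Dt0 : \forall t \ae mu, forall l, time T t -> \forall x \ae @area R, @cell R x ->
    Dtau l (t, x) i j = 0.
  apply: ae_ord2 => l.
  apply: (weak_dx_eq0 (w4 i j l)); apply: ae_imp nm' _ => t H tT k /wk k0.
  by have [_ H2] := H tT k k0.
have [Ui ti _] := w2 i j.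
apply: (ae_primitive_eq (weak_dt_cmode (0, 0) (Hs_integrable (h2 i j)) (w2 i j))).
  by apply: (integrableZr' (- mu0) _ (integrable_cmode (0, 0) Ui)); exact: measurable_itv.
apply: ae_imp (ae_and (ae_and Du0 Dt0) (ae_and (ae_cylinder_slices eqn)
  (ae_and (cylinder_section Ui) (cylinder_section ti)))) _.
move=> t [[D0 D1] [E [Uit tit]]] tT; rewrite -cmodeZ; last exact: Uit.
apply: cmode_ae; [exact: tit|by apply: integrableZr'; [exact: measurable_cell|exact: Uit]|].
apply: ae_imp (ae_and (ae_and (D1 0 tT) (D1 1 tT)) (ae_and (E tT)
  (ae_and (ae_and (D0 0 0 tT) (D0 0 1 tT)) (ae_and (D0 1 0 tT) (D0 1 1 tT))))) _.
move=> x [[d0 d1] [H [[a1 a2] [a3 a4]]]] xc; have [_ e _] := H xc.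
have G0 : Du (t, x) = 0.
  apply/matrixP => i' j'; rewrite mxE.
  have o2 (l : 'I_2) : l = 0 \/ l = 1.
    by case: l => -[|[|//]] ilt; [left|right]; exact/val_inj.
  by case: (o2 i') => ->; case: (o2 j') => ->; [exact: a1|exact: a2|exact: a3|exact: a4].
move: e; rewrite G0 /Qterm /strain /vorticity !(trmx0, oppr0, addr0, scaler0, mulmx0, mul0mx).
move=> /(congr1 (fun M : 'M[R]_2 => M i j)); rewrite sum_ord2 !mxE.
by rewrite (d0 xc) (d1 xc) !mulr0 !addr0 => ->; rewrite /mu0; ring.
Qed.

(** Vorticity-stretching form of the shear dynamics: with E the combination of
    diagonal stresses below, the velocity component v = u_1 and the stress
    c = tau_10 satisfy v_t = c_x and c_t = - (E - mu0) / 2 * v_x - mu0 * c. *)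
Lemma shear_dynamics :
  (forall k : int * int, k.2 != 0 -> \forall t \ae mu, time T t ->
    (forall i, no_modes (fun x => U.1 (t, x) i 0) k) /\
    (forall i j, no_modes (fun x => U.2 (t, x) i j) k)) ->
  cmode (fun x => U0.1 x 0 0) (0, 0) = 0 ->
  exists g w : R * (R * R) -> R,
  [/\ L1_cylinder T g, L1_cylinder T w,
    \forall t \ae mu, time T t ->
      (forall k, cmode (fun x => g (t, x)) k = k.1%:~R * smode (fun x => U.1 (t, x) 1 0) k /\
                 smode (fun x => g (t, x)) k = - (k.1%:~R * cmode (fun x => U.1 (t, x) 1 0) k)) /\
      (\forall x \ae @area R, @cell R x -> w (t, x) =
         - 2^-1 * ((1 + b) * U.2 (t, x) 1 1 - (1 - b) * U.2 (t, x) 0 0 - mu0) * g (t, x)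
         - mu0 * U.2 (t, x) 1 0),
    forall n : int,
      ae_primitive T (cmode (fun x => U0.1 x 1 0) (n, 0))
        (fun t => cmode (fun x => U.1 (t, x) 1 0) (n, 0))
        (fun t => n%:~R * smode (fun x => U.2 (t, x) 1 0) (n, 0)) /\
      ae_primitive T (smode (fun x => U0.1 x 1 0) (n, 0))
        (fun t => smode (fun x => U.1 (t, x) 1 0) (n, 0))
        (fun t => - n%:~R * cmode (fun x => U.2 (t, x) 1 0) (n, 0)) &
    forall k,
      ae_primitive T (cmode (fun x => U0.2 x 1 0) k)
        (fun t => cmode (fun x => U.2 (t, x) 1 0) k) (fun t => cmode (fun x => w (t, x)) k) /\
      ae_primitive T (smode (fun x => U0.2 x 1 0) k)
        (fun t => smode (fun x => U.2 (t, x) 1 0) k) (fun t => smode (fun x => w (t, x)) k)].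
Proof.
move=> nm mean0; have [_ [p [ut [Dp [Du [taut [Dtau [[w1 w2 w3 w4 w5] eqn]]]]]]]] := sol.
have [h1 h2] := U0_Hs.
have nm' : \forall t \ae mu, time T t -> forall k, k.2 != 0 ->
    (forall i, no_modes (fun x => U.1 (t, x) i 0) k) /\
    (forall i j, no_modes (fun x => U.2 (t, x) i j) k).
  apply: ae_forall_modes => k; have [k0|k0] := eqVneq k.2 0.
    by apply: aeW => t _.
  by apply: ae_imp (nm k k0) _ => t H tT _; exact: H.
have wk (k : int * int) : wavenum k 1 != 0 :> R -> k.2 != 0.
  by rewrite /wavenum/=; apply: contra_neq => ->.
have Duy i : \forall t \ae mu, time T t -> \forall x \ae @area R, @cell R x -> Du (t, x) i 1 = 0.
  apply: (weak_dx_eq0 (w3 i 1)); apply: ae_imp nm' _ => t H tT k /wk k0.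
  by have [H1 _] := H tT k k0.
have Dty : \forall t \ae mu, forall i j, time T t -> \forall x \ae @area R, @cell R x ->
    Dtau 1 (t, x) i j = 0.
  apply: ae_ord2 => i; apply: ae_ord2 => j.
  apply: (weak_dx_eq0 (w4 i j 1)); apply: ae_imp nm' _ => t H tT k /wk k0.
  by have [_ H2] := H tT k k0.
have eqs := ae_cylinder_slices eqn.
have Du00 : \forall t \ae mu, time T t -> \forall x \ae @area R, @cell R x -> Du (t, x) 0 0 = 0.
  apply: ae_imp (ae_and (Duy 1) eqs) _ => t [D E] tT.
  apply: ae_imp (ae_and (D tT) (E tT)) _ => x [d e] xc.
  have [_ _] := e xc; by rewrite /mxtrace sum_ord2 (d xc) addr0.
have [u0i ut0i _] := w1 0; have [_ Dp0i _] := w5 0; have [_ Dt000i _] := w4 0 0 0.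
have [_ Du00i _] := w3 0 0.
have mean_ut : \forall t \ae mu, time T t -> cmode (fun x => ut (t, x) 0 0) (0, 0) = 0.
  apply: ae_imp (ae_and (ae_and (ae_and Du00 (Duy 0)) (ae_and Dty eqs))
    (ae_and (ae_and (weak_dx_modes (w5 0)) (weak_dx_modes (w4 0 0 0)))
    (ae_and (cylinder_section ut0i) (ae_and (cylinder_section Dp0i) (cylinder_section Dt000i))))) _.
  move=> t [[[D0 D1] [D2 E]] [[m1 m2] [i1 [i2 i3]]]] tT.
  rewrite (@cmode_ae _ _ (fun x => Dtau 0 (t, x) 0 0 - Dp (t, x) 0 0)); first last.
  - apply: ae_imp (ae_and (ae_and (D0 tT) (D1 tT)) (ae_and (D2 0 1 tT) (E tT))) _.
    move=> x [[d0 d1] [d2 e]] xc; have [e1 _ _] := e xc.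
    move: e1 => /(congr1 (fun M : 'cV[R]_2 => M 0 0)); rewrite !sum_ord2 !mxE (d0 xc) (d1 xc) (d2 xc).
    by move=> e1; lra.
  - by apply: integrableBr; [exact: measurable_cell|exact: i3|exact: i2].
  - exact: i1.
  rewrite cmodeB; [|exact: i3|exact: i2].
  by rewrite (m1 tT _).1 (m2 tT _).1 wavenum0 !mul0r subr0.
have mean_u : \forall t \ae mu, time T t -> cmode (fun x => U.1 (t, x) 0 0) (0, 0) = 0.
  have i0 : mu.-integrable `[0, T] (EFin \o (fun _ => 0)).
    by apply: continuous_integrable => x; exact: cst_continuous.
  have [_ _ h] := ae_primitive_eq (weak_dt_cmode (0, 0) (Hs_integrable (h1 0)) (w1 0)) i0 mean_ut.
  apply: ae_imp h _ => t H tT; by rewrite H// mean0 add0r Rintegral_cst ?mul0r.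
have u0 : \forall t \ae mu, time T t -> \forall x \ae @area R, @cell R x -> U.1 (t, x) 0 0 = 0.
  apply: ae_imp (ae_and (ae_and mean_u nm') (ae_and (ae_and Du00 (weak_dx_modes (w3 0 0)))
     (ae_and (cylinder_section u0i) (cylinder_section Du00i)))) _.
  move=> t [[m0 nmt] [[D0 m1] [i1 i2]]] tT; apply: no_modes_eq0; first exact: i1.
  move=> [k1 k2]; have [k20|k20] := eqVneq k2 0; last first.
    by have [H _] := nmt tT (k1, k2) k20; exact: H.
  rewrite k20; have [->|k10] := eqVneq k1 0; first by split; [exact: m0|exact: smode00].
  have [e1 e2] := m1 tT (k1, 0); have [z1 z2] := modes_ae0 (k1, 0) (i2 tT) (D0 tT).
  have k1R : k1%:~R != 0 :> R by rewrite intr_eq0.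
  split; [move: e2; rewrite z2|move: e1; rewrite z1]; rewrite /wavenum/= => /esym/eqP.
    by rewrite oppr_eq0 mulf_eq0 (negbTE k1R) => /eqP.
  by rewrite mulf_eq0 (negbTE k1R) => /eqP.
have [u1i ut1i _] := w1 1; have [_ Dp1i _] := w5 1; have [t10i Dt10i _] := w4 1 0 0.
have [_ gi _] := w3 1 0; have [ti10 wi _] := w2 1 0.
have ut_modes : \forall t \ae mu, time T t -> forall n : int,
    cmode (fun x => ut (t, x) 1 0) (n, 0) = n%:~R * smode (fun x => U.2 (t, x) 1 0) (n, 0) /\
    smode (fun x => ut (t, x) 1 0) (n, 0) = - n%:~R * cmode (fun x => U.2 (t, x) 1 0) (n, 0).
  apply: ae_imp (ae_and (ae_and (ae_and u0 (Duy 1)) (ae_and Dty eqs))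
    (ae_and (ae_and (weak_dx_modes (w5 1)) (weak_dx_modes (w4 1 0 0)))
    (ae_and (cylinder_section ut1i) (ae_and (cylinder_section Dp1i) (cylinder_section Dt10i))))) _.
  move=> t [[[D0 D1] [D2 E]] [[m1 m2] [i1 [i2 i3]]]] tT n.
  have e : \forall x \ae @area R, @cell R x -> ut (t, x) 1 0 = Dtau 0 (t, x) 1 0 - Dp (t, x) 1 0.
    apply: ae_imp (ae_and (ae_and (D0 tT) (D1 tT)) (ae_and (D2 1 1 tT) (E tT))) _.
    move=> x [[d0 d1] [d2 e]] xc; have [e1 _ _] := e xc.
    move: e1 => /(congr1 (fun M : 'cV[R]_2 => M 1 0)); rewrite !sum_ord2 !mxE (d0 xc) (d1 xc) (d2 xc).
    by move=> e1; lra.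
  have i4 : (@area R).-integrable (@cell R)
      (EFin \o (fun x => Dtau 0 (t, x) 1 0 - Dp (t, x) 1 0)).
    by apply: integrableBr; [exact: measurable_cell|exact: i3|exact: i2].
  have [a1 a2] := m1 tT (n, 0); have [a3 a4] := m2 tT (n, 0).
  rewrite (cmode_ae _ (i1 tT) i4 e) (smode_ae _ (i1 tT) i4 e).
  rewrite cmodeB; [|exact: i3|exact: i2]; rewrite smodeB; [|exact: i3|exact: i2].
  rewrite a1 a2 a3 a4 /wavenum/=; split; ring.
exists (fun z => Du z 1 0), (fun z => taut z 1 0); split => //.
- apply: ae_imp (ae_and (ae_and (ae_and u0 (Duy 1)) (ae_and Dty eqs))
    (ae_and (ae_and (Duy 0) Du00) (weak_dx_modes (w3 1 0)))) _.
  move=> t [[[D0 D1] [D2 E]] [[D3 D4] m]] tT; split; first by move=> k; exact: m tT k.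
  apply: ae_imp (ae_and (ae_and (ae_and (D0 tT) (D1 tT)) (ae_and (D2 1 0 tT) (E tT)))
    (ae_and (D3 tT) (D4 tT))) _.
  move=> x [[[d0 d1] [d2 e]] [d3 d4]] xc; have [_ e1 _] := e xc.
  move: e1 => /(congr1 (fun M : 'M[R]_2 => M 1 0)).
  rewrite sum_ord2 3!mxE [X in _ + X = _]Qterm_shear; [|exact: d4 xc|exact: d3 xc|exact: d1 xc].
  by rewrite !mxE (d0 xc) (d2 xc) (d3 xc) -/mu0 => e1; lra.
- move=> n; split.
    apply: (ae_primitive_eq (weak_dt_cmode _ (Hs_integrable (h1 1)) (w1 1))).
      by apply: (integrableZr' _ _ (integrable_smode (n, 0) ti10)); exact: measurable_itv.
    by apply: ae_imp ut_modes _ => t H tT; have [] := H tT n.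
  apply: (ae_primitive_eq (weak_dt_smode _ (Hs_integrable (h1 1)) (w1 1))).
    by apply: (integrableZr' _ _ (integrable_cmode (n, 0) ti10)); exact: measurable_itv.
  by apply: ae_imp ut_modes _ => t H tT; have [] := H tT n.
- move=> k; split.
    exact: (weak_dt_cmode _ (Hs_integrable (h2 1 0)) (w2 1 0)).
  exact: (weak_dt_smode _ (Hs_integrable (h2 1 0)) (w2 1 0)).
Qed.

End shear_solutions.

(** * H1 *)

Section sobolev_coefficients.
Context {R : realType}.
Notation mu := (@lebesgue_measure R).
Notation P2 := (measurableTypeR R * measurableTypeR R)%type.

Lemma Hs_norm_sq_ge0 (s : R) f : (0 <= Hs_norm_sq s f)%E.
Proof.
apply: esum_ge0 => k _; rewrite lee_fin mulr_ge0 ?powR_ge0//.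
by rewrite addr_ge0 ?sqr_ge0.
Qed.

Lemma state_Hs_norm_le (s e : R) V : 0 <= e -> (state_Hs_norm s V <= e%:E)%E ->
  (forall i, (Hs_norm_sq s (fun x => V.1 x i 0)%R <= (e ^+ 2)%:E)%E) /\
  (forall i j, (Hs_norm_sq s (fun x => V.2 x i j)%R <= (e ^+ 2)%:E)%E).
Proof.
move=> e0; have -> : e%:E = sqrte (e ^+ 2)%:E by rewrite /= sqrtr_sqr ger0_norm.
rewrite /state_Hs_norm lee_sqrt ?lee_fin ?sqr_ge0// !sum_ord2.
set a0 := Hs_norm_sq _ _; set a1 := Hs_norm_sq _ _; set b00 := Hs_norm_sq _ _.
set b01 := Hs_norm_sq _ _; set b10 := Hs_norm_sq _ _; set b11 := Hs_norm_sq _ _ => h.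
have p := @Hs_norm_sq_ge0 s.
have o2 (l : 'I_2) : l = 0 \/ l = 1.
  by case: l => -[|[|//]] ilt; [left|right]; exact/val_inj.
split=> [i|i j]; apply: le_trans h.
  case: (o2 i) => ->; rewrite -/a0 -/a1; first by rewrite -addeA leeDl// ?adde_ge0 ?p.
  by rewrite (addeC a0) -addeA leeDl// ?adde_ge0 ?p.
case: (o2 i) => ->; case: (o2 j) => ->; rewrite -/b00 -/b01 -/b10 -/b11.
- by rewrite addeC -!addeA leeDl// ?adde_ge0 ?p.
- by rewrite addeC (addeC b00) -!addeA leeDl// ?adde_ge0 ?p.
- by rewrite addeC (addeC (b00 + b01)%E) -!addeA leeDl// ?adde_ge0 ?p.
- by rewrite addeC (addeC (b00 + b01)%E) (addeC b10) -!addeA leeDl// ?adde_ge0 ?p.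
Qed.

Lemma Hs_coef (s e : R) f k : 3 <= s -> (Hs_norm_sq s f <= (e ^+ 2)%:E)%E ->
  (1 + k.1%:~R ^+ 2 + k.2%:~R ^+ 2) ^+ 3 * (cmode f k ^+ 2 + smode f k ^+ 2) <=
  ((2 * pi) ^+ 2 * e) ^+ 2.
Proof.
move=> s3 he; set a := 1 + _ + _; set q : R := (2 * pi) ^+ 2.
have q0 : 0 < q by rewrite exprn_gt0// twopi_gt0.
have a1 : 1 <= a by rewrite /a -addrA lerDl addr_ge0 ?sqr_ge0.
have h : a `^ s * (fourier_cos f k ^+ 2 + fourier_sin f k ^+ 2) <= e ^+ 2.
  rewrite -lee_fin; apply: le_trans he; apply: esum_ge; exists [set k].
    by split=> //; exact: finite_set1.
  by rewrite fsbig_set1.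
have h' : a ^+ 3 * (fourier_cos f k ^+ 2 + fourier_sin f k ^+ 2) <= e ^+ 2.
  apply: le_trans h; apply: ler_wpM2r; first by rewrite addr_ge0 ?sqr_ge0.
  by rewrite -powR_mulrn ?(le_trans ler01)//; apply: ler_powR.
have -> : cmode f k = q * fourier_cos f k.
  by rewrite /fourier_cos -/q mulrA divff ?mul1r// gt_eqF.
have -> : smode f k = q * fourier_sin f k.
  by rewrite /fourier_sin -/q mulrA divff ?mul1r// gt_eqF.
rewrite [leLHS](_ : _ = q ^+ 2 * (a ^+ 3 * (fourier_cos f k ^+ 2 + fourier_sin f k ^+ 2))); last by ring.
rewrite [leRHS](_ : _ = q ^+ 2 * e ^+ 2); last by ring.
by apply: (ler_wpM2l (sqr_ge0 q)).
Qed.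

Lemma coef_decay (s e : R) f (l : nat) : 3 <= s -> 0 <= e -> (Hs_norm_sq s f <= (e ^+ 2)%:E)%E ->
  l%:R ^+ 3 * `|cmode f (l%:Z, 0)| <= (2 * pi) ^+ 2 * e /\
  l%:R ^+ 3 * `|smode f (l%:Z, 0)| <= (2 * pi) ^+ 2 * e.
Proof.
move=> s3 e0 /(Hs_coef (l%:Z, 0) s3); set B := _ * e; set A := cmode _ _; set S := smode _ _.
have B0 : 0 <= B by rewrite mulr_ge0 ?sqr_ge0.
rewrite /= -pmulrn expr0n addr0 => h.
have L : l%:R ^+ 6 <= (1 + l%:R ^+ 2) ^+ 3 :> R.
  by rewrite (exprM _ 2 3) lerXn2r ?nnegrE ?addr_ge0 ?sqr_ge0// lerDr.
have A2 := sqr_ge0 A; have S2 := sqr_ge0 S; have l6 : 0 <= l%:R ^+ 6 :> R by rewrite exprn_ge0.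
have g (X : R) : X ^+ 2 <= A ^+ 2 + S ^+ 2 -> l%:R ^+ 3 * `|X| <= B.
  move=> hX; rewrite -(@ler_pXn2r _ 2)// ?nnegrE ?mulr_ge0 ?exprn_ge0//.
  rewrite exprMn -exprM real_normK ?num_real//; apply: le_trans h.
  apply: (le_trans (ler_wpM2l l6 hX)); apply: ler_wpM2r L; exact: addr_ge0.
by split; apply: g; [rewrite lerDl|rewrite lerDr].
Qed.

Lemma coef0_bound (s e : R) f : 3 <= s -> 0 <= e -> (Hs_norm_sq s f <= (e ^+ 2)%:E)%E ->
  `|cmode f (0, 0)| <= (2 * pi) ^+ 2 * e.
Proof.
move=> s3 e0 /(Hs_coef (0, 0) s3); set B := _ * e; set A := cmode _ _; set S := smode _ _.
have B0 : 0 <= B by rewrite mulr_ge0 ?sqr_ge0.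
rewrite /= expr0n !addr0 expr1n mul1r => h.
rewrite -(@ler_pXn2r _ 2)// ?nnegrE// real_normK ?num_real//; apply: le_trans h.
by rewrite lerDl sqr_ge0.
Qed.

Definition tail_weight (N l : nat) : R := if (N < l)%N then (l%:R ^+ 2)^-1 else 0.

Lemma inv_sq_telescope (m : nat) : (0 < m)%N ->
  (m.+1%:R ^+ 2)^-1 <= m%:R^-1 - m.+1%:R^-1 :> R.
Proof.
move=> m0; have a0 : 0 < m%:R :> R by rewrite ltr0n.
have -> : m.+1%:R = 1 + m%:R :> R by rewrite addrC natr1.
set a : R := m%:R in a0 *; have a1 : 0 < 1 + a by lra.
have -> : a^-1 - (1 + a)^-1 = (a * (1 + a))^-1 by field; rewrite gt_eqF//= gt_eqF.
by rewrite lef_pV2 ?posrE ?exprn_gt0 ?mulr_gt0// expr2; apply: ler_wpM2r; lra.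
Qed.

Lemma tail_weight_sum (N m : nat) : (0 < N)%N ->
  \sum_(1 <= l < m.+1) tail_weight N l <= N%:R^-1.
Proof.
move=> N0; suff h : \sum_(1 <= l < m.+1) tail_weight N l <= N%:R^-1 - (maxn N m)%:R^-1.
  by apply: (le_trans h); rewrite lerBlDr lerDl invr_ge0.
elim: m => [|m IH]; first by rewrite big_geq// maxn0 subrr.
rewrite big_nat_recr//=; apply: (le_trans (lerD IH (lexx _))); rewrite /tail_weight.
have [Nm|Nm] := ltnP N m.+1; last first.
  by rewrite addr0 (maxn_idPl (ltnW Nm)).
have -> : maxn N m = m by apply/maxn_idPr.
have := inv_sq_telescope (leq_trans N0 Nm).
by move: (_ ^+ 2)^-1 (m%:R^-1) (m.+1%:R^-1) (N%:R^-1) => x y z w; lra.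
Qed.

Lemma inv_sq_sum m : \sum_(1 <= l < m.+1) (l%:R ^+ 2)^-1 <= 2 :> R.
Proof.
case: m => [|m]; first by rewrite big_geq.
suff h : \sum_(1 <= l < m.+2) (l%:R ^+ 2)^-1 <= 2 - m.+1%:R^-1 :> R.
  by apply: (le_trans h); rewrite lerBlDr lerDl invr_ge0.
elim: m => [|m IH]; first by rewrite big_nat1 expr1n invr1; lra.
rewrite big_nat_recr//=; apply: (le_trans (lerD IH (lexx _))).
have := @inv_sq_telescope m.+1 isT.
by move: (_ ^+ 2)^-1 (m.+1%:R^-1) (m.+2%:R^-1) => x y z; lra.
Qed.

Lemma row_partial_le (f : R * R -> R) (c0 K w : R) (W : nat -> R) m x : 0 <= K ->
  `|cmode f (0, 0)| <= c0 ->
  (forall l, (0 < l)%N -> `|cmode f (l%:Z, 0)| <= K * W l /\ `|smode f (l%:Z, 0)| <= K * W l) ->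
  \sum_(1 <= l < m.+1) W l <= w ->
  `|row_partial f m x| <= c0 + 4 * K * w.
Proof.
move=> K0 h0 h hw; rewrite /row_partial; apply: (le_trans (ler_normD _ _)); apply: lerD => //.
rewrite normrM ger0_norm//; have -> : 4 * K * w = 2 * (2 * (K * w)) by ring.
apply: ler_wpM2l => //; apply: (le_trans (ler_norm_sum _ _ _)).
apply: (@le_trans _ _ (\sum_(1 <= l < m.+1) 2 * (K * W l))).
  rewrite big_nat_cond [leRHS]big_nat_cond; apply: ler_sum => l /andP[/andP[l1 _] _].
  have [a b] := h l l1; apply: (le_trans (ler_normD _ _)); rewrite mulrDl !mul1r !normrM.
  apply: lerD; [apply: le_trans a|apply: le_trans b]; rewrite -[leRHS]mulr1;
    apply: ler_wpM2l => //; [exact: cos_max|exact: sin_max].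
by rewrite -big_distrr -big_distrr/=; apply: ler_wpM2l => //; apply: ler_wpM2l.
Qed.

Lemma row_ae_bound (f : R * R -> R) (K : R) : 0 <= K ->
  (@area R).-integrable (@cell R) (EFin \o f) ->
  (forall k, k.2 != 0 -> no_modes f k) ->
  `|cmode f (0, 0)| <= (2 * pi) ^+ 2 * K ->
  (forall l, (0 < l)%N -> `|cmode f (l%:Z, 0)| <= (2 * pi) ^+ 2 * K * (l%:R ^+ 2)^-1 /\
     `|smode f (l%:Z, 0)| <= (2 * pi) ^+ 2 * K * (l%:R ^+ 2)^-1) ->
  \forall x \ae @area R, @cell R x -> `|f x| <= 9 * K.
Proof.
move=> K0 fi nm h0 h; apply: row_partial_ae_bound => //; first exact: mulr_ge0.
have q0 : 0 <= (2 * pi) ^+ 2 * K by rewrite mulr_ge0 ?sqr_ge0.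
move=> m x; apply: (le_trans (row_partial_le x q0 h0 h (inv_sq_sum m))); lra.
Qed.

Lemma tail_ae_bound (f : R * R -> R) (K : R) N : 0 <= K -> (0 < N)%N ->
  (@area R).-integrable (@cell R) (EFin \o f) ->
  (forall k, k.2 != 0 -> no_modes f k) ->
  cmode f (0, 0) = 0 ->
  (forall l, (0 < l)%N -> `|cmode f (l%:Z, 0)| <= (2 * pi) ^+ 2 * K * tail_weight N l /\
     `|smode f (l%:Z, 0)| <= (2 * pi) ^+ 2 * K * tail_weight N l) ->
  \forall x \ae @area R, @cell R x -> `|f x| <= 4 * K / N%:R.
Proof.
move=> K0 N0 fi nm h0 h; apply: row_partial_ae_bound => //; first by rewrite mulr_ge0 ?mulr_ge0.
have q0 : 0 <= (2 * pi) ^+ 2 * K by rewrite mulr_ge0 ?sqr_ge0.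
have h0' : `|cmode f (0, 0)| <= 0 by rewrite h0 normr0.
move=> m x; apply: (le_trans (row_partial_le x q0 h0' h (tail_weight_sum m N0))); lra.
Qed.

End sobolev_coefficients.

(** * H2 *)

Section cosine_data.
Context {R : realType}.
Notation mu := (@lebesgue_measure R).
Notation P2 := (measurableTypeR R * measurableTypeR R)%type.
Notation P3 := (measurableTypeR R * P2)%type.

Lemma half_turn_small (m : int) : m != 0 -> 0 <= (pi : R) / `|m%:~R| <= 2 * pi.
Proof.
move=> m0; have m1 : 1 <= `|m%:~R| :> R by rewrite -intr_norm -[1]/(1%:~R) ler_int -gtz0_ge1 normr_gt0.
have p0 := @pi_gt0 R; rewrite divr_ge0 ?pi_ge0// ler_pdivrMr ?(lt_le_trans ltr01)//.
by nra.
Qed.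

Lemma half_turn_cos (m : int) : m != 0 -> cos (m%:~R * (pi / `|m%:~R|)) = -1 :> R.
Proof.
move=> m0; have m0' : m%:~R != 0 :> R by rewrite intr_eq0.
have p0 : 0 <= (pi : R) / `|m%:~R| by rewrite divr_ge0 ?pi_ge0.
by rewrite -cos_norm normrM (ger0_norm p0) mulrC divfK ?normr_eq0// cospi.
Qed.

Definition half_turn1 (m : int) : R * R := (pi / `|m%:~R|, 0).
Definition half_turn2 (m : int) : R * R := (0, pi / `|m%:~R|).

Lemma small_half_turn1 m : m != 0 -> small (half_turn1 m).
Proof. by move=> m0; split=> /=; rewrite ?half_turn_small// lexx mulr_ge0// pi_ge0. Qed.

Lemma small_half_turn2 m : m != 0 -> small (half_turn2 m).
Proof. by move=> m0; split=> /=; rewrite ?half_turn_small// lexx mulr_ge0// pi_ge0. Qed.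

Lemma phase_half_turn1 (k : int * int) : k.1 != 0 -> cos (phase k (half_turn1 k.1)) < 1.
Proof. by move=> k0; rewrite /phase/= mulr0 addr0 half_turn_cos//; lra. Qed.

Lemma phase_half_turn2 (k : int * int) : k.2 != 0 -> cos (phase k (half_turn2 k.2)) < 1.
Proof. by move=> k0; rewrite /phase/= mulr0 add0r half_turn_cos//; lra. Qed.

Lemma const_integrable (c : R) : (@area R).-integrable (@cell R) (EFin \o (fun _ => c)).
Proof.
apply: (@integrable_bounded _ _ _ (@area R) (@cell R) _ `|c|) => //; exact: area_cell_lty.
Qed.
Hint Resolve const_integrable : core.

Lemma const_modes (c : R) k : k != (0, 0) -> no_modes (fun _ => c) k.
Proof.
move=> k0; have inv h : \forall x \ae @area R, @cell R x ->
   (fun _ => c) (wrap2 h x) = (fun _ => c) x by exact: aeW.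
have [k10|k10] := eqVneq k.1 0; last first.
  exact: (invariant_mode_eq0 (small_half_turn1 k10) (const_integrable c) (inv _) (phase_half_turn1 k10)).
have k20 : k.2 != 0.
  by apply: contra_neq k0 => k20; move: k10 k20; case: k => a b /= -> ->.
exact: (invariant_mode_eq0 (small_half_turn2 k20) (const_integrable c) (inv _) (phase_half_turn2 k20)).
Qed.

Lemma wmode_cs f k th : (@area R).-integrable (@cell R) (EFin \o f) ->
  wmode f k th = cos th * cmode f k - sin th * smode f k.
Proof.
move=> fi; have := wmode_rot k 0 (- th) fi.
rewrite opprK add0r cosN sinN sub0r -cmodeE -smodeE => ->; by rewrite mulNr.
Qed.

Definition wave_mass (k : int * int) (th : R) := if k == (0, 0) then (2 * pi) ^+ 2 * cos th else 0.

Lemma cmode_const0 (c : R) : cmode (fun _ => c) (0, 0) = (2 * pi) ^+ 2 * c.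
Proof.
rewrite /cmode; under eq_Rintegral do rewrite phase0 cos0 mulr1.
by rewrite Rintegral_cst//= area_cell mulrC.
Qed.

Lemma Rint_cos_phase k th :
  \int[@area R]_(x in @cell R) cos (phase k x + th) = wave_mass k th.
Proof.
transitivity (wmode (fun _ => 1) k th).
  by apply: eq_Rintegral => x _; rewrite mul1r.
rewrite wmode_cs// /wave_mass; have [->|k0] := eqVneq k (0, 0).
  by rewrite cmode_const0 smode00 mulr0 subr0 mulr1 mulrC.
by have [-> ->] := const_modes 1 k0; rewrite !mulr0 subr0.
Qed.

Lemma wave_mass_le k th : `|wave_mass k th| <= (2 * pi) ^+ 2.
Proof.
rewrite /wave_mass; case: ifP => _; last by rewrite normr0 sqr_ge0.
by rewrite normrM ger0_norm ?sqr_ge0// ler_piMr ?sqr_ge0// cos_max.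
Qed.

Lemma phaseD (k l : int * int) (x : R * R) : phase (k + l) x = phase k x + phase l x.
Proof. by rewrite /phase /= !intrD; ring. Qed.

Lemma phaseN (k : int * int) (x : R * R) : phase (- k) x = - phase k x.
Proof. by rewrite /phase /= !mulrNz; ring. Qed.

Lemma measurable_wave k th (D : set P2) :
  measurable_fun D (fun x : P2 => cos (phase k x + th)).
Proof.
apply: measurable_funTS.
apply: (@measurableT_comp _ _ _ _ _ _ (cos : measurableTypeR R -> R)).
  by apply: measurable_continuous; exact: continuous_cos.
by apply: measurable_funD => //; exact: measurable_phase.
Qed.

Lemma integrable_wave k th : (@area R).-integrable (@cell R) (EFin \o (fun x => cos (phase k x + th))).
Proof.
apply: (@integrable_bounded _ _ _ (@area R) (@cell R) _ 1) => //; first exact: area_cell_lty.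
  exact: measurable_wave.
by move=> x _; exact: cos_max.
Qed.
Hint Resolve integrable_wave : core.

Lemma wmode_wave k0 (th0 : R) k th : wmode (fun x => cos (phase k0 x + th0)) k th =
  2^-1 * (wave_mass (k0 + k) (th0 + th) + wave_mass (k0 - k) (th0 - th)).
Proof.
rewrite -!Rint_cos_phase -RintegralD// -RintegralZl//; last by apply: integrableDr.
apply: eq_Rintegral => x _; rewrite !phaseD phaseN.
have -> : phase k0 x + phase k x + (th0 + th) = (phase k0 x + th0) + (phase k x + th) by ring.
have -> : phase k0 x - phase k x + (th0 - th) = (phase k0 x + th0) - (phase k x + th) by ring.
rewrite (cosD (phase k0 x + th0) (phase k x + th)) (cosB (phase k0 x + th0) (phase k x + th)).
by field.
Qed.

Lemma wmode_wave_le k0 (th0 : R) k th : `|wmode (fun x => cos (phase k0 x + th0)) k th| <= (2 * pi) ^+ 2.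
Proof.
rewrite wmode_wave normrM gtr0_norm ?invr_gt0//.
have h := ler_normD (wave_mass (k0 + k) (th0 + th)) (wave_mass (k0 - k) (th0 - th)).
have := wave_mass_le (k0 + k) (th0 + th); have := wave_mass_le (k0 - k) (th0 - th).
move: h; move: (`|_ + _|) (`|wave_mass _ _|) (`|wave_mass _ _|) ((2 * pi) ^+ 2) => p q r q0; lra.
Qed.

Lemma wmode_wave0 k0 (th0 : R) k th : k != k0 -> k != - k0 ->
  wmode (fun x => cos (phase k0 x + th0)) k th = 0.
Proof.
move=> h1 h2; rewrite wmode_wave /wave_mass ifF ?ifF ?addr0 ?mulr0//; apply/negbTE.
  by apply: contra h1; rewrite -[(0, 0)]/(0 : int * int) subr_eq0 eq_sym.
by apply: contra h2; rewrite -[(0, 0)]/(0 : int * int) addr_eq0 => /eqP ->; rewrite opprK.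
Qed.

Lemma cosine_Hs (s d : R) k0 :
  Hs s (fun x => d * cos (phase k0 x)) /\
  (Hs_norm_sq s (fun x => d * cos (phase k0 x))%R <=
    (4 * ((1 + k0.1%:~R ^+ 2 + k0.2%:~R ^+ 2) `^ s * d ^+ 2))%:E)%E.
Proof.
set f := fun x => _; set a := 1 + _ + _; set C := a `^ s * (2 * d ^+ 2).
have C0 : 0 <= C by rewrite mulr_ge0 ?powR_ge0// mulr_ge0 ?sqr_ge0.
have wi := integrable_wave k0 0.
have fw k th : wmode f k th = d * wmode (fun x => cos (phase k0 x + 0)) k th.
  rewrite /wmode -RintegralZl//; last first.
    apply: (@integrableMb _ _ _ (@area R) _ _ _ 1 _ wi) => //; first exact: measurable_wave.
    by move=> x _; exact: cos_max.
  by apply: eq_Rintegral => x _; rewrite addr0 /f mulrA.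
have q0 : 0 < (2 * pi) ^+ 2 :> R by rewrite exprn_gt0// twopi_gt0.
have hle k th : (((2 * pi) ^+ 2)^-1 * wmode f k th) ^+ 2 <= d ^+ 2.
  rewrite fw mulrCA exprMn -[leRHS]mulr1; apply: (ler_wpM2l (sqr_ge0 d)).
  rewrite -[leRHS](expr1n _ 2) -real_normK ?num_real// lerXn2r ?nnegrE//.
  by rewrite normrM gtr0_norm ?invr_gt0// mulrC ler_pdivrMr// mul1r wmode_wave_le.
have fcE k : fourier_cos f k = ((2 * pi) ^+ 2)^-1 * wmode f k 0 by rewrite -cmodeE.
have fsE k : fourier_sin f k = ((2 * pi) ^+ 2)^-1 * wmode f k (- (pi / 2)) by rewrite -smodeE.
have bound : (Hs_norm_sq s f <= (4 * (a `^ s * d ^+ 2))%:E)%E.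
  rewrite [leRHS](_ : _ = (C%:E + C%:E)%E); last by rewrite -EFinD /C; congr EFin; ring.
  pose ind l := fun k : int * int => if k \in [set l] then C%:E else 0%E.
  have ind0 l k : (0 <= ind l k)%E by rewrite /ind; case: ifP.
  have indE l : (\esum_(k in setT) ind l k = C%:E)%E.
    by rewrite -esum_mkcond esum_set1.
  rewrite -[X in (_ <= X + _)%E](indE k0) -[X in (_ <= _ + X)%E](indE (- k0)) -esumD//.
  apply: le_esum => k _; rewrite fcE fsE.
  have main : a = 1 + k.1%:~R ^+ 2 + k.2%:~R ^+ 2 -> (((1 + k.1%:~R ^+ 2 + k.2%:~R ^+ 2) `^ s *
   ((((2 * pi) ^+ 2)^-1 * wmode f k 0) ^+ 2 + (((2 * pi) ^+ 2)^-1 * wmode f k (- (pi / 2))) ^+ 2))%:E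
     <= C%:E)%E.
    move=> <-; rewrite lee_fin /C; apply: ler_wpM2l; first exact: powR_ge0.
    have -> : 2 * d ^+ 2 = d ^+ 2 + d ^+ 2 by ring.
    by apply: lerD.
  have [kk|kk] := eqVneq k k0.
    apply: (le_trans (main _)); first by rewrite /a kk.
    by rewrite {1}/ind mem_set ?leeDl//= kk.
  have [kk'|kk'] := eqVneq k (- k0).
    apply: (le_trans (main _)).
      by rewrite /a kk' /=; case: (k0) => u v /=; rewrite !mulrNz !sqrrN.
    by rewrite {2}/ind mem_set ?leeDr//= kk'.
  by rewrite !fw !wmode_wave0// !mulr0 expr0n/= addr0 mulr0 adde_ge0.
have mf : measurable_fun setT (f : P2 -> measurableTypeR R).
  apply: measurable_funM => //.
  have := @measurable_wave k0 0 setT; congr measurable_fun; apply/funext => x; by rewrite addr0.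
split=> //; split => //.
- by move=> j x; have := cos_phase_periodic k0 0 j x; rewrite !addr0 /f => ->.
- have i2 : (@area R).-integrable (@cell R) (EFin \o (fun x => f x ^+ 2)).
    apply: (@integrable_bounded _ _ _ (@area R) (@cell R) _ (d ^+ 2)) => //.
    + exact: area_cell_lty.
    + by apply: measurable_funTS; exact: measurable_funX.
    + move=> x _; rewrite ger0_norm ?sqr_ge0// /f exprMn -[leRHS]mulr1.
      by apply: (ler_wpM2l (sqr_ge0 d)); rewrite -(cos2Dsin2 (phase k0 x)) lerDl sqr_ge0.
  have /integrableP[_] := i2; rewrite (_ : (fun x => _) = (fun x => (f x ^+ 2)%:E))//.
  by apply/funext => x; rewrite /= ger0_norm ?sqr_ge0.
- by apply: (le_lt_trans bound); rewrite ltry.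
Qed.

Lemma const_Hs (s c : R) : Hs s (fun _ => c).
Proof.
have [h _] := cosine_Hs s c (0, 0); move: h.
by congr Hs; apply/funext => x; rewrite phase0 cos0 mulr1.
Qed.

Lemma Hs_norm_zero (s : R) : Hs_norm_sq s (fun _ => 0 : R) = 0%E.
Proof.
have [_ h] := cosine_Hs s 0 (0, 0); apply/eqP; rewrite eq_le Hs_norm_sq_ge0 andbT.
move: h; rewrite expr0n/= !mulr0; congr (_ <= _)%E; congr Hs_norm_sq.
by apply/funext => x; rewrite mul0r.
Qed.

Definition shear_data (d : R) (n : nat) (A : 'M[R]_2) : state R (R * R) :=
  (fun x => \col_i (if i == 0 then 0 else d * cos (phase (n%:Z, 0) x)), fun _ => A).

Lemma shear_data_div_free d n A : div_free (shear_data d n A).1.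
Proof.
move=> psi spsi ppsi.
have cD : continuous ('D_(unit_x R 1) psi) by apply: smooth_continuous; exact: smooth_derive.
pose c x1 : R := d * cos (n%:R * x1).
have eqi x : \sum_(j < 2) (shear_data d n A).1 x j 0 * 'D_(unit_x R j) psi x =
    c x.1 * 'D_(unit_x R 1) psi x.
  by rewrite sum_ord2 !mxE/= mul0r add0r /phase /= mul0r addr0 -pmulrn.
transitivity (\int[@area R]_(x in @cell R) (c x.1 * 'D_(unit_x R 1) psi x)).
  by apply: eq_Rintegral => x _; exact: eqi.
have [M hM] : exists M, forall x, @cell R x -> `|'D_(unit_x R 1) psi x| <= M.
  have cpt : compact (@cell R) by apply: compact_setX; exact: segment_compact.
  have h : compact ('D_(unit_x R 1) psi @` @cell R).
    by apply: continuous_compact => //; exact: continuous_subspaceT.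
  have [M M0 hM] := pinfty_ex_gt0 (compact_bounded h).
  by exists M => x xc; apply: hM; exists x.
have mD : measurable_fun setT ('D_(unit_x R 1) psi : P2 -> R).
  pose f (z : R * (R * R)) := 'D_(unit_x R 1) psi z.2.
  have cf : continuous f.
    move=> z; apply: (@continuous_comp _ _ _ snd ('D_(unit_x R 1) psi)); [exact: cvg_snd|exact: cD].
  have m2 : measurable_fun setT (fun x : P2 => ((0 : measurableTypeR R), x) : P3).
    by apply: measurable_fun_pair => //; exact: measurable_cst.
  exact: (measurableT_comp (continuous_measurable3 cf) m2).
have cc : continuous c.
  have -> : c = fun x => d * cos (n%:R * x + 0) by apply/funext => x; rewrite /c addr0.
  by move=> x; apply: cvgM; [exact: cvg_cst|exact: (@continuous_cos_lin R n%:R 0 x)].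
have fi : (@area R).-integrable (@cell R) (EFin \o (fun x => c x.1 * 'D_(unit_x R 1) psi x)).
  apply: (@integrable_bounded _ _ _ (@area R) (@cell R) _ (`|d| * M)) => //.
  - exact: area_cell_lty.
  - apply: measurable_funTS; apply: measurable_funM => //.
    exact: (measurableT_comp (measurable_continuous cc)).
  - move=> x xc; rewrite normrM; apply: ler_pM => //; last exact: hM.
    by rewrite normrM -[leRHS]mulr1; apply: ler_wpM2l => //; exact: cos_max.
rewrite (cell_Fubini fi).
transitivity (\int[mu]_(x in `[0, 2 * pi]) (0 : R)); last by rewrite Rintegral_cst ?mul0r.
apply: eq_Rintegral => x1' _ /=; move: (x1' : R) => {x1'}x1.
pose F y := psi (x1, y).
have dF (y : R) : is_derive y (1 : R) F ('D_(unit_x R 1) psi (x1, y)).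
  have dp : derivable psi (x1, y) (unit_x R 1) by apply: smooth_derivable.
  have h := is_derive_lineE (DeriveDef dp erefl).
  apply: is_derive_line; move: h; congr (is_derive _ _ _ _); apply/funext => r.
  by rewrite /F shift_unit1; congr psi; congr pair; rewrite /= ?add0r// /GRing.scale/= mulr1.
have cF : continuous (fun y => 'D_(unit_x R 1) psi (x1, y)).
  move=> y; apply: (@continuous_comp _ _ _ (fun y : R => (x1, y)) ('D_(unit_x R 1) psi)); last exact: cD.
  by apply: continuous_pairing => // z; [exact: cvg_cst|exact: cvg_id].
rewrite RintegralZl//; last by apply: continuous_integrable.
rewrite (Rint_FTC _ cF dF) ?twopi_ge0// /F.
have e : psi (x1, 2 * pi) = psi (x1, 0).
  rewrite -(ppsi 1 (x1, 0)) shift_unit1; congr psi.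
  by congr pair; rewrite /= ?addr0 ?add0r.
by rewrite e subrr mulr0.
Qed.

End cosine_data.

(** * H3 *)

Section stretching.
Context {R : realType}.
Notation mu := (@lebesgue_measure R).
Notation P2 := (measurableTypeR R * measurableTypeR R)%type.

Definition row_trig (p q : nat -> R) (N : nat) (x : R * R) : R :=
  \sum_(1 <= l < N.+1) (p l * cos (phase (l%:Z, 0) x) + q l * sin (phase (l%:Z, 0) x)).

Lemma measurable_row_trig p q N (D : set P2) : measurable_fun D (row_trig p q N).
Proof.
apply: measurable_funTS; apply: measurable_sum => l; apply: measurable_funD;
  apply: measurable_funM => //; [exact: measurable_cos_phase|exact: measurable_sin_phase].
Qed.

Lemma row_trig_bound p q N x : `|row_trig p q N x| <= \sum_(1 <= l < N.+1) (`|p l| + `|q l|).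
Proof.
apply: (le_trans (ler_norm_sum _ _ _)); apply: ler_sum => l _.
apply: (le_trans (ler_normD _ _)); rewrite !normrM.
by apply: lerD; rewrite -[leRHS]mulr1; apply: ler_wpM2l => //; [exact: cos_max|exact: sin_max].
Qed.

Lemma integrable_row_trigM f p q N : (@area R).-integrable (@cell R) (EFin \o f) ->
  (@area R).-integrable (@cell R) (EFin \o (fun x => f x * row_trig p q N x)).
Proof.
move=> fi; apply: (@integrableMb _ _ _ (@area R) _ f _ _ _ fi) => //.
  exact: measurable_row_trig.
by move=> x _; exact: row_trig_bound.
Qed.

Lemma row_trig_pairing f p q N : (@area R).-integrable (@cell R) (EFin \o f) ->
  \sum_(1 <= l < N.+1) (p l * cmode f (l%:Z, 0) + q l * smode f (l%:Z, 0)) =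
  \int[@area R]_(x in @cell R) (f x * row_trig p q N x).
Proof.
move=> fi.
have ci l : (@area R).-integrable (@cell R) (EFin \o (fun x => p l * (f x * cos (phase (l%:Z, 0) x)))).
  by apply: (integrableZr' _ _ (integrable_cphase (l%:Z, 0) fi)); exact: measurable_cell.
have si l : (@area R).-integrable (@cell R) (EFin \o (fun x => q l * (f x * sin (phase (l%:Z, 0) x)))).
  by apply: (integrableZr' _ _ (integrable_sphase (l%:Z, 0) fi)); exact: measurable_cell.
transitivity (\int[@area R]_(x in @cell R) \sum_(1 <= l < N.+1)
   (p l * (f x * cos (phase (l%:Z, 0) x)) + q l * (f x * sin (phase (l%:Z, 0) x)))); last first.
  apply: eq_Rintegral => x _; rewrite /row_trig big_distrr; apply: eq_bigr => l _ /=; ring.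
rewrite Rintegral_sum//; last by move=> l _; apply: (integrableDr _ (ci l) (si l)); exact: measurable_cell.
apply: eq_bigr => l _; rewrite RintegralD//.
by rewrite !RintegralZl//; [exact: integrable_sphase|exact: integrable_cphase].
Qed.

(** The pairing of ag with the truncation of g controls the one of g up to the
    truncation error, because (a - 1) g g >= 0. *)
Lemma stretching_lower (g ag a : R * R -> R) N (Amax G e1 : R) :
  let p l := cmode g (l%:Z, 0) in let q l := smode g (l%:Z, 0) in
  (@area R).-integrable (@cell R) (EFin \o g) ->
  (@area R).-integrable (@cell R) (EFin \o ag) ->
  (\forall x \ae @area R, @cell R x ->
    [/\ ag x = a x * g x, 1 <= a x <= Amax, `|g x| <= G &
        `|g x - (2 * pi ^+ 2)^-1 * row_trig p q N x| <= e1]) ->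
  \sum_(1 <= l < N.+1) (p l ^+ 2 + q l ^+ 2)
    - (2 * pi) ^+ 2 * (2 * pi ^+ 2 * (Amax * G * e1)) <=
  \sum_(1 <= l < N.+1) (p l * cmode ag (l%:Z, 0) + q l * smode ag (l%:Z, 0)).
Proof.
move=> p q gi agi h.
have -> : \sum_(1 <= l < N.+1) (p l ^+ 2 + q l ^+ 2) =
    \sum_(1 <= l < N.+1) (p l * cmode g (l%:Z, 0) + q l * smode g (l%:Z, 0)).
  by apply: eq_bigr => l _; rewrite !expr2.
rewrite !row_trig_pairing// lerBlDr -lerBlDl -RintegralB//; last 2 first.
- exact: integrable_row_trigM.
- exact: integrable_row_trigM.
set K := 2 * pi ^+ 2 * _.
have -> : (2 * pi) ^+ 2 * K = \int[@area R]_(x in @cell R) K.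
  by rewrite Rintegral_cst//= area_cell mulrC.
apply: Rintegral_ae_le => //.
- apply: integrableBr => //; exact: integrable_row_trigM.
- exact: const_integrable.
apply: ae_imp h _ => x h xc; have [-> /andP[a1 a2] gG] := h xc.
have p0 : 0 < 2 * pi ^+ 2 :> R by rewrite mulr_gt0// exprn_gt0// pi_gt0.
set P := row_trig _ _ _ _; set r := g x - _ => re.
have PE : P = 2 * pi ^+ 2 * (g x - r).
  by rewrite /r opprB addrC subrK mulrA divff ?mul1r// gt_eqF.
rewrite PE (_ : _ - _ = 2 * pi ^+ 2 * ((a x - 1) * (g x * r) - (a x - 1) * g x ^+ 2)); last by ring.
rewrite /K; apply: ler_wpM2l; first exact: ltW.
have s2 : 0 <= (a x - 1) * g x ^+ 2 by rewrite mulr_ge0 ?sqr_ge0// subr_ge0.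
have G0 : 0 <= G by apply: le_trans gG.
have e0 : 0 <= e1 by apply: le_trans re.
have h1 : (a x - 1) * (g x * r) <= Amax * G * e1.
  apply: (le_trans (ler_norm _)); rewrite !normrM mulrA; apply: ler_pM => //.
  by apply: ler_pM => //; rewrite ger0_norm; lra.
lra.
Qed.

End stretching.

(** * H4 *)

Section energy.
Context {R : realType}.
Notation mu := (@lebesgue_measure R).
Variables (T m B e eta : R) (n N : nat).
Variables (vc0 vs0 : nat -> R) (Vc Vs Cc Cs Wc Ws : nat -> R -> R).
Hypotheses (T0 : 0 <= T) (m0 : 0 <= m) (mn : m <= n%:R) (n0 : (0 < n)%N).
Hypotheses (B0 : 0 <= B) (e0 : 0 <= e).
Hypothesis pVc : forall l, ae_primitive T (vc0 l) (Vc l) (fun t => l%:R * Cs l t).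
Hypothesis pVs : forall l, ae_primitive T (vs0 l) (Vs l) (fun t => - l%:R * Cc l t).
Hypothesis pCc : forall l, ae_primitive T 0 (Cc l) (Wc l).
Hypothesis pCs : forall l, ae_primitive T 0 (Cs l) (Ws l).
Hypothesis initial : eta ^+ 2 <= \sum_(1 <= l < N.+1) (vc0 l ^+ 2 + vs0 l ^+ 2).
Hypothesis low : \forall t \ae mu, time T t -> forall l, (0 < l < n)%N -> Vc l t = 0 /\ Vs l t = 0.
Hypothesis decay : \forall t \ae mu, time T t -> forall l, (0 < l)%N ->
  [/\ l%:R ^+ 3 * `|Vc l t| <= B, l%:R ^+ 3 * `|Vs l t| <= B,
      l%:R ^+ 3 * `|Cc l t| <= B & l%:R ^+ 3 * `|Cs l t| <= B].
Hypothesis stretch : \forall t \ae mu, time T t -> exists Ac As : nat -> R,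
  (forall l, Wc l t = - Ac l - m * Cc l t /\ Ws l t = - As l - m * Cs l t) /\
  \sum_(1 <= l < N.+1) ((l%:R * Vs l t) ^+ 2 + (- (l%:R * Vc l t)) ^+ 2) - e <=
  \sum_(1 <= l < N.+1) (l%:R * Vs l t * Ac l + - (l%:R * Vc l t) * As l).

Let I t := \sum_(1 <= l < N.+1) (Vc l t * Vc l t + Vs l t * Vs l t).
Let G t := \sum_(1 <= l < N.+1) (2 * l%:R * (Vc l t * Cs l t - Vs l t * Cc l t)).
Let DG t := \sum_(1 <= l < N.+1) (2 * l%:R *
  ((l%:R * Cs l t * Cs l t + Vc l t * Ws l t) - (- l%:R * Cc l t * Cc l t + Vs l t * Wc l t))).

Let pI : ae_primitive T (\sum_(1 <= l < N.+1) (vc0 l * vc0 l + vs0 l * vs0 l)) I G.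
Proof.
have := ae_primitive_sum (index_iota 1 N.+1)
  (fun l => ae_primitiveD (ae_primitiveM (pVc l) (pVc l)) (ae_primitiveM (pVs l) (pVs l))).
by congr ae_primitive; apply/funext => t; apply: eq_bigr => l _; ring.
Qed.

Let pG : ae_primitive T 0 G DG.
Proof.
have := ae_primitive_sum (index_iota 1 N.+1)
  (fun l => ae_primitiveZ (2 * l%:R) (ae_primitiveD (ae_primitiveM (pVc l) (pCs l))
    (ae_primitiveZ (-1) (ae_primitiveM (pVs l) (pCc l))))).
rewrite (eq_bigr (fun _ => 0)); last by move=> l _; ring.
rewrite big1_eq; congr ae_primitive; apply/funext => t; apply: eq_bigr => l _; ring.
Qed.

Let k := n%:R + m.

Let n1 : 1 <= n%:R :> R. Proof. by rewrite ler1n. Qed.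

Let growth : \forall t \ae mu, time T t -> n%:R * (G t + k * I t) - 2 * e <= DG t + k * G t.
Proof.
apply: ae_imp (ae_and low stretch) _ => t [lowt st] tT; have {}lowt := lowt tT.
have [Ac [As [WE S]]] := st tT.
set X := \sum_(1 <= l < N.+1) 2 * l%:R ^+ 2 * (Cs l t ^+ 2 + Cc l t ^+ 2).
set Y := \sum_(1 <= l < N.+1) ((l%:R * Vs l t) ^+ 2 + (- (l%:R * Vc l t)) ^+ 2).
set Z := \sum_(1 <= l < N.+1) (l%:R * Vs l t * Ac l + - (l%:R * Vc l t) * As l).
have DGE : DG t = X + 2 * Z - m * G t.
  rewrite /X /Z /DG /G !big_distrr -big_split -sumrB /=; apply: eq_bigr => l _.
  by have [-> ->] := WE l; ring.
have P1 : 0 <= X.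
  by apply: sumr_ge0 => l _; rewrite mulr_ge0 ?addr_ge0 ?sqr_ge0// mulr_ge0 ?sqr_ge0.
have P2 : n%:R ^+ 2 * I t <= Y.
  rewrite /Y /I big_distrr /= big_nat_cond [leRHS]big_nat_cond; apply: ler_sum => l /andP[/andP[l1 _] _].
  have [ln|nl] := ltnP l n.
    have [|-> ->] := lowt l; first by rewrite l1.
    by rewrite !mulr0 oppr0 !expr0n !addr0 mulr0.
  rewrite [leRHS](_ : _ = l%:R ^+ 2 * (Vc l t * Vc l t + Vs l t * Vs l t)); last by ring.
  apply: ler_wpM2r; first by rewrite -!expr2 addr_ge0 ?sqr_ge0.
  by rewrite lerXn2r ?nnegrE// ler_nat.
have I0 : 0 <= I t by apply: sumr_ge0 => l _; rewrite -!expr2 addr_ge0 ?sqr_ge0.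
have P3 : n%:R * k * I t <= 2 * (n%:R ^+ 2 * I t).
  rewrite mulrA; apply: ler_wpM2r => //; rewrite /k; have := n1; have := mn; nra.
rewrite -/Y -/Z in S; rewrite DGE; move: P1 P2 P3 S; rewrite /k.
clear DGE; move: X Y Z (G t) (I t) => x y z g i P1 P2 P3 S.
have -> : n%:R * (g + (n%:R + m) * i) - 2 * e = n%:R * g + n%:R * (n%:R + m) * i - 2 * e by ring.
have -> : x + 2 * z - m * g + (n%:R + m) * g = x + 2 * z + n%:R * g by ring.
lra.
Qed.

Let upper : \forall t \ae mu, time T t -> G t + k * I t <= (8 + 4 * k) * B ^+ 2.
Proof.
apply: ae_imp decay _ => t dec tT; have {}dec := dec tT.
have k0 : 0 <= k by rewrite /k addr_ge0.
apply: (@le_trans _ _ (\sum_(1 <= l < N.+1) (4 + 2 * k) * B ^+ 2 * (l%:R ^+ 2)^-1)); last first.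
  rewrite -big_distrr /=; have q0 : 0 <= (4 + 2 * k) * B ^+ 2.
    by rewrite mulr_ge0 ?sqr_ge0// addr_ge0// mulr_ge0.
  apply: (le_trans (ler_wpM2l q0 (inv_sq_sum N))).
  by rewrite [leLHS](_ : _ = (8 + 4 * k) * B ^+ 2)//; ring.
rewrite /G /I big_distrr -big_split/= big_nat_cond [leRHS]big_nat_cond.
apply: ler_sum => l /andP[/andP[l1 _] _]; have [d1 d2 d3 d4] := dec l l1.
have l0 : 1 <= l%:R :> R by rewrite ler1n.
set r : R := l%:R in l0 d1 d2 d3 d4 *; have r0 : 0 < r by exact: lt_le_trans ltr01 l0.
have bound X Y : r ^+ 3 * `|X| <= B -> r ^+ 3 * `|Y| <= B -> r * (X * Y) <= B ^+ 2 * (r ^+ 2)^-1.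
  move=> hX hY; rewrite ler_pdivlMr ?exprn_gt0//.
  have h : (r ^+ 3 * `|X|) * (r ^+ 3 * `|Y|) <= B ^+ 2.
    by rewrite expr2; apply: ler_pM => //; rewrite mulr_ge0 ?exprn_ge0// ltW.
  apply: le_trans h.
  apply: (@le_trans _ _ (r ^+ 3 * (`|X| * `|Y|))).
    rewrite [leLHS](_ : _ = r ^+ 3 * (X * Y)); last by ring.
    apply: ler_wpM2l; first exact: exprn_ge0 (ltW r0).
    by rewrite -normrM ler_norm.
  rewrite [leRHS](_ : _ = r ^+ 3 * (r ^+ 3 * (`|X| * `|Y|))); last by ring.
  by rewrite ler_peMl ?mulr_ge0 ?exprn_ge0 ?exprn_ege1// ltW.
have sq X : r ^+ 3 * `|X| <= B -> X * X <= B ^+ 2 * (r ^+ 2)^-1.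
  move=> hX; apply: le_trans (bound _ _ hX hX).
  by rewrite ler_peMl// -expr2 sqr_ge0.
have b1 := bound _ _ d1 d4; have b2 := bound (- Vs l t) (Cc l t).
rewrite normrN in b2; have {}b2 := b2 d2 d3.
have b3 := ler_wpM2l k0 (sq _ d1); have b4 := ler_wpM2l k0 (sq _ d2).
rewrite [leRHS](_ : _ = 2 * (B ^+ 2 * (r ^+ 2)^-1) + 2 * (B ^+ 2 * (r ^+ 2)^-1)
  + (k * (B ^+ 2 * (r ^+ 2)^-1) + k * (B ^+ 2 * (r ^+ 2)^-1))); last by ring.
rewrite [leLHS](_ : _ = 2 * (r * (Vc l t * Cs l t)) + 2 * (r * (- Vs l t * Cc l t))
   + (k * (Vc l t * Vc l t) + k * (Vs l t * Vs l t))); last by ring.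
by apply: lerD; [apply: lerD; apply: ler_wpM2l|apply: lerD].
Qed.

(** With I the energy of the modes 1..N of v, the system is I'' + m I' >= 2 n^2 I
    up to e, an elliptic inequality: I' + (n + m) I grows at rate n. *)
Lemma energy_growth :
  (k * eta ^+ 2 - 2 * e * T) * (expR (n%:R * T) - 1) <=
  n%:R * (T * ((8 + 4 * k) * B ^+ 2)).
Proof.
have pJ := ae_primitiveD pG (ae_primitiveZ k pI).
have [Ji _ _] := pJ; have k0 : 0 <= k by rewrite /k addr_ge0.
have rn : 0 < n%:R :> R by rewrite ltr0n.
have e2 : 0 <= 2 * e by rewrite mulr_ge0.
have h := gronwall_growth T0 rn e2 pJ growth.
apply: (@le_trans _ _ (n%:R * \int[mu]_(t in `[0, T]) (G t + k * I t))).
  apply: le_trans h; apply: ler_wpM2r.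
    by rewrite subr_ge0 -expR0 ler_expR mulr_ge0.
  rewrite add0r lerB// ler_wpM2l// (le_trans initial)//.
apply: ler_wpM2l; first exact: ltW.
have ic : mu.-integrable `[0, T] (EFin \o (fun _ => (8 + 4 * k) * B ^+ 2)).
  by apply: continuous_integrable => x; exact: cst_continuous.
apply: (@le_trans _ _ (\int[mu]_(t in `[0, T]) ((8 + 4 * k) * B ^+ 2))).
  apply: Rintegral_ae_le => //; exact: ae_itv_cc.
rewrite Rintegral_cst//= lebesgue_measure_itv/= lte_fin mulrC.
by case: ltgtP T0 => //= <- _; rewrite ?subr0 ?mul0r ?mulr0.
Qed.

End energy.

(** * I1 *)

Section bounds.
Context {R : realType}.
Notation mu := (@lebesgue_measure R).
Notation P2 := (measurableTypeR R * measurableTypeR R)%type.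

Lemma ae_primitiveS (T T1 f0 : R) f p : T1 <= T -> ae_primitive T f0 f p -> ae_primitive T1 f0 f p.
Proof.
move=> T1T [fi pi' h]; split; [exact: integrable_itvS fi|exact: integrable_itvS pi'|].
apply: ae_imp h _ => t ht; rewrite /= in_itv/= => /andP[a c]; apply: ht.
by rewrite /= in_itv/= a (lt_le_trans c).
Qed.

Lemma ae_primitive_near (T f0 c C : R) f : 0 <= c -> 0 <= C ->
  ae_primitive T f0 f (fun t => - c * f t) ->
  (\forall t \ae mu, time T t -> `|f t| <= C) ->
  \forall t \ae mu, time T t -> `|f t - f0| <= c * C * t.
Proof.
move=> c0 C0 [fi pi' h] hC; apply: ae_imp h _ => t ht tT; rewrite ht//.
have /andP[t0 tT'] : 0 < t < T by move: tT; rewrite /time /= in_itv.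
have mI : measurable (`[0, t]%classic : set (measurableTypeR R)) by exact: measurable_itv.
have it := integrable_itvS (lexx 0) (ltW tT') pi'.
rewrite addrC addKr; apply: (le_trans (le_normr_Rintegral mI it)).
have ic : mu.-integrable `[0, t] (EFin \o (fun _ => c * C)).
  by apply: continuous_integrable => x; exact: cst_continuous.
apply: (@le_trans _ _ (\int[mu]_(s in `[0, t]) (c * C))).
  apply: Rintegral_ae_le => //; first exact: integrable_norm.
  apply: ae_imp (ae_itv_cc hC) _ => s hs; rewrite /= in_itv/= => /andP[s0 st].
  rewrite normrM normrN (ger0_norm c0); apply: ler_wpM2l => //; apply: hs.
  by rewrite /= in_itv/= s0 (le_trans st) ?ltW.
by rewrite Rintegral_cst//= lebesgue_measure_itv/= lte_fin t0 /= subr0.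
Qed.

Lemma LinfHs_norm_ae s T (U : state R (R * (R * R))) (K : R) : (LinfHs_norm s T U <= K%:E)%E ->
  \forall t \ae mu, time T t -> (state_Hs_norm s (slice U t) <= K%:E)%E.
Proof.
move=> /ess_supP h; apply: ae_imp h _ => t; rewrite patchE => h tT.
by move: h; rewrite mem_set.
Qed.

Lemma exp_beats_poly (kappa T A : R) (K n0 : nat) : 0 < kappa -> 0 < T -> 0 <= A ->
  exists n : nat, [/\ (n0 <= n)%N, (0 < n)%N &
    A * (n%:R * (1 + n%:R ^+ 2) ^+ K ^+ 2) < kappa ^+ 2 * (expR (n%:R * T) - 1)].
Proof.
move=> k0 T0 A0; set q := (K * 4).+2.
pose D := kappa ^+ 2 * (T ^+ q / q`!%:R).
have D0 : 0 < D by rewrite /D mulr_gt0 ?exprn_gt0// divr_gt0 ?exprn_gt0// ltr0n fact_gt0.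
pose X := A * 4 ^+ K / D.
have X0 : 0 <= X.
  by apply: divr_ge0 (ltW D0); rewrite mulr_ge0// exprn_ge0.
pose n := (maxn n0 (Num.bound X)).+1.
have nX : X < n%:R.
  by apply: (lt_le_trans (archi_boundP X0)); rewrite ler_nat leqW// leq_maxr.
exists n; split => //; first by rewrite leqW// leq_maxl.
have n1 : 1 <= n%:R :> R by rewrite ler1n.
have nn0 : 0 < n%:R :> R by exact: lt_le_trans n1.
apply: (@le_lt_trans _ _ (A * 4 ^+ K * n%:R ^+ (K * 4).+1)).
  rewrite -[leRHS]mulrA; apply: ler_wpM2l => //.
  rewrite [in leRHS]exprS [leRHS]mulrCA; apply: ler_wpM2l; first exact: ltW.
  rewrite -exprM; apply: (@le_trans _ _ ((2 * n%:R ^+ 2) ^+ (K * 2))).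
    apply: lerXn2r; rewrite ?nnegrE ?addr_ge0 ?mulr_ge0 ?sqr_ge0//.
    have : 1 <= n%:R ^+ 2 :> R by exact: exprn_ege1.
    by lra.
  have sq : (2 * n%:R ^+ 2) ^+ 2 = 4 * n%:R ^+ 4 :> R by ring.
  by rewrite (mulnC K 2) exprM sq exprMn -exprM (mulnC 4 K).
apply: (@lt_le_trans _ _ (D * n%:R ^+ q)).
  rewrite /q [in ltRHS]exprS mulrA ltr_pM2r ?exprn_gt0//.
  by rewrite [ltRHS]mulrC -ltr_pdivrMr.
rewrite /D -mulrA; apply: ler_wpM2l; first exact: sqr_ge0.
have h : 0 <= n%:R * T by rewrite mulr_ge0 ?ltW.
rewrite lerBrDl; apply: le_trans (expR_ge1Dxn (K * 4).+1 h).
by rewrite lerD2l -/q exprMn mulrAC (mulrC (T ^+ q)).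
Qed.

Lemma cmode_lin f g k (p q : R) : (@area R).-integrable (@cell R) (EFin \o f) ->
  (@area R).-integrable (@cell R) (EFin \o g) ->
  cmode (fun x => p * f x - q * g x) k = p * cmode f k - q * cmode g k.
Proof.
move=> fi gi; rewrite cmodeB ?cmodeZ//.
  by apply: integrableZr' => //; exact: measurable_cell.
by apply: integrableZr' => //; exact: measurable_cell.
Qed.

Lemma smode_lin f g k (p q : R) : (@area R).-integrable (@cell R) (EFin \o f) ->
  (@area R).-integrable (@cell R) (EFin \o g) ->
  smode (fun x => p * f x - q * g x) k = p * smode f k - q * smode g k.
Proof.
move=> fi gi; rewrite smodeB ?smodeZ//.
  by apply: integrableZr' => //; exact: measurable_cell.
by apply: integrableZr' => //; exact: measurable_cell.
Qed.

Lemma inv_cube_le (l : nat) (X B : R) : (0 < l)%N -> 0 <= B -> l%:R ^+ 3 * X <= B ->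
  X <= B * (l%:R ^+ 2)^-1.
Proof.
move=> l0 B0 h; have l1 : 1 <= l%:R :> R by rewrite ler1n.
have l00 : 0 < l%:R :> R by exact: lt_le_trans l1.
have := h; rewrite mulrC -ler_pdivlMr ?exprn_gt0// => h'; apply: (le_trans h').
apply: ler_wpM2l => //; rewrite lef_pV2 ?posrE ?exprn_gt0//.
by rewrite exprS ler_peMl// exprn_ge0// ltW.
Qed.

(** Modes of f that are absent from f' are as small as the distance of f to f'. *)
Lemma near_coef (s e : R) f f' (l : nat) : 3 <= s -> 0 <= e -> Hs s f -> Hs s f' ->
  (Hs_norm_sq s (fun x => f x - f' x)%R <= (e ^+ 2)%:E)%E ->
  no_modes f' (l%:Z, 0) ->
  l%:R ^+ 3 * `|cmode f (l%:Z, 0)| <= (2 * pi) ^+ 2 * e /\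
  l%:R ^+ 3 * `|smode f (l%:Z, 0)| <= (2 * pi) ^+ 2 * e.
Proof.
move=> s3 e0 hf hf' hd [z1 z2]; have := coef_decay l s3 e0 hd.
have fi := Hs_integrable hf; have fi' := Hs_integrable hf'.
by rewrite cmodeB// smodeB// z1 z2 !subr0.
Qed.

Lemma near_mean (s e : R) f f' : 3 <= s -> 0 <= e -> Hs s f -> Hs s f' ->
  (Hs_norm_sq s (fun x => f x - f' x)%R <= (e ^+ 2)%:E)%E ->
  `|cmode f (0, 0) - cmode f' (0, 0)| <= (2 * pi) ^+ 2 * e.
Proof.
move=> s3 e0 hf hf' hd; have := coef0_bound s3 e0 hd.
by rewrite cmodeB//; apply: Hs_integrable; [exact: hf|exact: hf'].
Qed.

(** If f is close to a function f' without nonzero modes, and depends on one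
    variable only, then it is uniformly close to the mean of f'. *)
Lemma near_const (s e p q : R) f1 f2 f1' f2' : 3 <= s -> 0 <= e ->
  Hs s f1 -> Hs s f2 -> Hs s f1' -> Hs s f2' ->
  (Hs_norm_sq s (fun x => f1 x - f1' x)%R <= (e ^+ 2)%:E)%E ->
  (Hs_norm_sq s (fun x => f2 x - f2' x)%R <= (e ^+ 2)%:E)%E ->
  (forall k, k != (0, 0) -> no_modes f1' k /\ no_modes f2' k) ->
  (forall k, k.2 != 0 -> no_modes f1 k /\ no_modes f2 k) ->
  \forall x \ae @area R, @cell R x ->
    `|p * f1 x - q * f2 x
      - ((2 * pi) ^+ 2)^-1 * (p * cmode f1' (0, 0) - q * cmode f2' (0, 0))| <=
    9 * ((`|p| + `|q|) * e).
Proof.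
move=> s3 e0 h1 h2 h1' h2' d1 d2 nm' nm.
have i1 := Hs_integrable h1; have i2 := Hs_integrable h2.
set c := _^-1 * _.
have i12 : (@area R).-integrable (@cell R) (EFin \o (fun x => p * f1 x - q * f2 x)).
  by apply: integrableBr; [exact: measurable_cell|apply: integrableZr'|apply: integrableZr'];
    rewrite ?measurable_cell//; exact: measurable_cell.
have ic := const_integrable c.
have q0 : 0 < (2 * pi) ^+ 2 :> R by rewrite exprn_gt0// twopi_gt0.
have lin (x y z : R) : `|x| <= z -> `|y| <= z -> `|p * x - q * y| <= (`|p| + `|q|) * z.
  move=> hx hy; apply: (le_trans (ler_normB _ _)); rewrite mulrDl !normrM.
  by apply: lerD; apply: ler_wpM2l.
apply: row_ae_bound.
- by rewrite mulr_ge0// addr_ge0.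
- by apply: integrableBr => //; exact: measurable_cell.
- move=> k k2; have k0 : k != (0, 0) by apply: contra_neq k2 => ->.
  have [[a1 a2] [a3 a4]] := nm k k2; have [c1 c2] := const_modes c k0.
  split; [rewrite cmodeB// cmode_lin// a1 a3 c1|rewrite smodeB// smode_lin// a2 a4 c2];
    by rewrite !mulr0 !subr0.
- rewrite cmodeB// cmode_lin// cmode_const0 /c mulrA divff ?mul1r ?gt_eqF//.
  rewrite [X in `|X|](_ : _ = p * (cmode f1 (0, 0) - cmode f1' (0, 0)) -
    q * (cmode f2 (0, 0) - cmode f2' (0, 0))); last by ring.
  rewrite mulrCA; apply: lin.
    exact: near_mean s3 e0 h1 h1' d1.
  exact: near_mean s3 e0 h2 h2' d2.
- move=> l l0; have k0 : (l%:Z, 0) != (0, 0) :> (int * int)%type.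
    by rewrite xpair_eqE eqxx andbT eqz_nat -lt0n.
  have [n1 n2] := nm' _ k0; have [c1 c2] := const_modes c k0.
  have [b1 b2] := near_coef s3 e0 h1 h1' d1 n1.
  have [b3 b4] := near_coef s3 e0 h2 h2' d2 n2.
  have B0 : 0 <= (2 * pi) ^+ 2 * e by rewrite mulr_ge0 // ltW.
  have E : (2 * pi) ^+ 2 * ((`|p| + `|q|) * e) * (l%:R ^+ 2)^-1 =
     (`|p| + `|q|) * ((2 * pi) ^+ 2 * e * (l%:R ^+ 2)^-1) by ring.
  rewrite E cmodeB// cmode_lin// c1 smodeB// smode_lin// c2 !subr0.
  by split; apply: lin; apply: inv_cube_le.
Qed.

Lemma cosineX_integrable (l : nat) : (@area R).-integrable (@cell R) (EFin \o (fun x => cos (phase (l%:Z, 0) x))).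
Proof. by have := @integrable_wave R (l%:Z, 0) 0; apply: eq_integrable => // x _ /=; rewrite addr0. Qed.

Lemma row_eq (l j : nat) : (0 < j)%N -> ((l%:Z, 0) + (j%:Z, 0) == (0, 0) :> (int * int)%type) = false.
Proof.
move=> j0; rewrite xpair_eqE /= addr0 eqxx andbT.
by rewrite -PoszD eqz_nat addn_eq0 (gtn_eqF j0) andbF.
Qed.

Lemma rowB_eq (l j : nat) : ((l%:Z, 0) - (j%:Z, 0) == (0, 0) :> (int * int)%type) = (l == j).
Proof. by rewrite xpair_eqE /= subr0 eqxx andbT subr_eq0 eqz_nat. Qed.

Lemma wmode_row (l j : nat) (th th' : R) : (0 < j)%N ->
  wmode (fun x => cos (phase (l%:Z, 0) x + th)) (j%:Z, 0) th' =
  if l == j then 2 * pi ^+ 2 * cos (th - th') else 0.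
Proof.
move=> j0; rewrite wmode_wave /wave_mass row_eq// rowB_eq add0r.
by case: ifP => _; [field|rewrite mulr0].
Qed.

End bounds.

(** * I2 *)

Section row_trig_modes.
Context {R : realType}.
Notation mu := (@lebesgue_measure R).
Notation P2 := (measurableTypeR R * measurableTypeR R)%type.

Lemma integrable_row_trig (p q : nat -> R) N : (@area R).-integrable (@cell R) (EFin \o row_trig p q N).
Proof.
have := integrable_row_trigM p q N (@const_integrable R 1).
by apply: eq_integrable => // x _ /=; rewrite mul1r.
Qed.

Lemma wmode_row_trig (p q : nat -> R) N k th : wmode (row_trig p q N) k th =
  \sum_(1 <= j < N.+1) (p j * wmode (fun x => cos (phase (j%:Z, 0) x + 0)) k th
    + q j * wmode (fun x => cos (phase (j%:Z, 0) x - pi / 2)) k th).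
Proof.
have wi j ph : (@area R).-integrable (@cell R)
    (EFin \o (fun x => cos (phase (j%:Z, 0) x + ph) * cos (phase k x + th))).
  apply: (@integrableMb _ _ _ (@area R) _ _ _ 1 _ (integrable_wave _ ph)) => //.
    exact: measurable_wave.
  by move=> x _; exact: cos_max.
have wi' c j ph : (@area R).-integrable (@cell R)
    (EFin \o (fun x => c * (cos (phase (j%:Z, 0) x + ph) * cos (phase k x + th)))).
  by apply: integrableZr' => //; exact: measurable_cell.
transitivity (\int[@area R]_(x in @cell R) \sum_(1 <= j < N.+1)
   (p j * (cos (phase (j%:Z, 0) x + 0) * cos (phase k x + th)) +
    q j * (cos (phase (j%:Z, 0) x - pi / 2) * cos (phase k x + th)))).
  apply: eq_Rintegral => x _; rewrite /row_trig big_distrl; apply: eq_bigr => j _ /=.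
  by rewrite addr0 cosBpihalf; ring.
rewrite Rintegral_sum//; last first.
  by move=> j _; apply: (integrableDr _ (wi' (p j) j 0) (wi' (q j) j (- (pi / 2)))); exact: measurable_cell.
by apply: eq_bigr => j _; rewrite RintegralD// ?RintegralZl.
Qed.

Lemma row_trig_no_mode (p q : nat -> R) N k : (forall j : nat, (0 < j)%N -> k != (j%:Z, 0) /\ k != - (j%:Z, 0)) ->
  no_modes (row_trig p q N) k.
Proof.
move=> h; have z th : wmode (row_trig p q N) k th = 0.
  rewrite wmode_row_trig big_nat_cond big1// => j /andP[/andP[j0 _] _].
  by have [h1 h2] := h j j0; rewrite !wmode_wave0// !mulr0 addr0.
by rewrite /no_modes cmodeE smodeE !z.
Qed.

Lemma row_trig_modes (p q : nat -> R) N l : (0 < l)%N ->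
  cmode (row_trig p q N) (l%:Z, 0) = (if (l <= N)%N then 2 * pi ^+ 2 * p l else 0) /\
  smode (row_trig p q N) (l%:Z, 0) = (if (l <= N)%N then 2 * pi ^+ 2 * q l else 0).
Proof.
move=> l0.
have pick (F : nat -> R) : \sum_(1 <= j < N.+1) (if j == l then F j else 0) =
    if (l <= N)%N then F l else 0.
  have [lN|lN] := leqP l N.
    rewrite (bigD1_seq l) ?mem_index_iota ?l0 ?ltnS ?iota_uniq//= eqxx big1 ?addr0//.
    by move=> j /negbTE ->.
  rewrite big_nat_cond big1// => j /andP[/andP[_ jN] _]; rewrite ifF//.
  by apply/negbTE; rewrite neq_ltn (leq_trans jN lN).
have c0 : cos (0 - - (pi / 2)) = 0 :> R by rewrite opprK add0r cos_pihalf.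
have c1 : cos (- (pi / 2) - 0) = 0 :> R by rewrite subr0 cosN cos_pihalf.
split.
  rewrite cmodeE wmode_row_trig -(pick (fun j => 2 * pi ^+ 2 * p j)).
  apply: eq_bigr => j _; rewrite !wmode_row//; case: ifP => _; last by rewrite !mulr0 addr0.
  by rewrite c1 subrr cos0; ring.
rewrite smodeE wmode_row_trig -(pick (fun j => 2 * pi ^+ 2 * q j)).
apply: eq_bigr => j _; rewrite !wmode_row//; case: ifP => _; last by rewrite !mulr0 addr0.
by rewrite c0 subrr cos0; ring.
Qed.

(** The truncation of g at frequency N, with modes of size 1 / l^2. *)
Lemma row_trig_approx (g : R * R -> R) (e : R) N : 0 <= e -> (0 < N)%N ->
  (@area R).-integrable (@cell R) (EFin \o g) ->
  (forall k, k.2 != 0 -> no_modes g k) -> cmode g (0, 0) = 0 ->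
  (forall l, (0 < l)%N -> `|cmode g (l%:Z, 0)| <= (2 * pi) ^+ 2 * e * (l%:R ^+ 2)^-1 /\
     `|smode g (l%:Z, 0)| <= (2 * pi) ^+ 2 * e * (l%:R ^+ 2)^-1) ->
  \forall x \ae @area R, @cell R x ->
    `|g x - (2 * pi ^+ 2)^-1 * row_trig (fun l => cmode g (l%:Z, 0)) (fun l => smode g (l%:Z, 0)) N x|
    <= 4 * e / N%:R.
Proof.
move=> e0 N0 gi nm g0 dec; set p := fun l : nat => cmode g _; set q := fun l : nat => smode g _.
have ti := integrable_row_trig p q N.
have ti' : (@area R).-integrable (@cell R) (EFin \o (fun x => (2 * pi ^+ 2)^-1 * row_trig p q N x)).
  by apply: integrableZr' => //; exact: measurable_cell.
have p0 : 2 * pi ^+ 2 != 0 :> R by rewrite gt_eqF// mulr_gt0// exprn_gt0// pi_gt0.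
have cE k : cmode (fun x => g x - (2 * pi ^+ 2)^-1 * row_trig p q N x) k =
    cmode g k - (2 * pi ^+ 2)^-1 * cmode (row_trig p q N) k by rewrite cmodeB// cmodeZ.
have sE k : smode (fun x => g x - (2 * pi ^+ 2)^-1 * row_trig p q N x) k =
    smode g k - (2 * pi ^+ 2)^-1 * smode (row_trig p q N) k by rewrite smodeB// smodeZ.
apply: tail_ae_bound => //.
- by apply: integrableBr => //; exact: measurable_cell.
- move=> k k2; rewrite /no_modes cE sE; have [-> ->] := nm k k2.
  have [|-> ->] := @row_trig_no_mode p q N k; last by rewrite !mulr0 !subr0.
  by move=> j j0; split; apply: contra_neq k2 => -> //=; rewrite oppr0.
- rewrite cE g0; have [|-> _] := @row_trig_no_mode p q N (0, 0); last by rewrite mulr0 subr0.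
  move=> j j0; split; rewrite xpair_eqE /= ?oppr0 eqxx andbT eq_sym ?oppr_eq0 eqz_nat -lt0n //.
- move=> l l0; rewrite cE sE /tail_weight; have [-> ->] := row_trig_modes p q N l0.
  have [lN|lN] := leqP l N; last by rewrite !mulr0 !subr0; exact: dec.
  by rewrite !(mulKf p0) !subrr normr0 mulr0.
Qed.

Lemma shear_data_invariant (d : R) n A h : 
  (forall x : R * R, cos (phase (n%:Z, 0) x + phase (n%:Z, 0) h) = cos (phase (n%:Z, 0) x)) ->
  forall x, @cell R x -> (shear_data d n A).1 (wrap2 h x) = (shear_data d n A).1 x /\
    (shear_data d n A).2 (wrap2 h x) = (shear_data d n A).2 x.
Proof.
move=> H x _; split=> //; apply/matrixP => i j; rewrite !mxE; case: ifP => // _.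
have := phase_wrap2 h (n%:Z, 0) x 0; rewrite !addr0 => ->; by rewrite H.
Qed.

Lemma shear_data_Hs s d n (A : 'M[R]_2) : state_Hs s (shear_data d n A).
Proof.
split=> [i|i j]; last exact: const_Hs.
rewrite (_ : (fun x => _) = (fun x => if i == 0 then 0 else d * cos (phase (n%:Z, 0) x))); last first.
  by apply/funext => x; rewrite mxE.
by case: (i == 0); [exact: const_Hs|have [] := cosine_Hs s d (n%:Z, 0)].
Qed.

End row_trig_modes.

(** * I3 *)

Lemma slice_sub_norm_le (R : realType) (s e t : R) (V U : state R (R * (R * R))) : 0 <= e ->
  (state_Hs_norm s (slice (state_sub V U) t) <= e%:E)%E ->
  (forall i, (Hs_norm_sq s (fun x => (V.1 (t, x) i 0 - U.1 (t, x) i 0)%R) <= (e ^+ 2)%:E)%E) /\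
  (forall i j, (Hs_norm_sq s (fun x => (V.2 (t, x) i j - U.2 (t, x) i j)%R) <= (e ^+ 2)%:E)%E).
Proof.
move=> e0 /(state_Hs_norm_le e0)[c1 c2]; split=> [i|i j].
  by have := c1 i; congr (Hs_norm_sq _ _ <= _)%E; apply/funext => x; rewrite !mxE.
by have := c2 i j; congr (Hs_norm_sq _ _ <= _)%E; apply/funext => x; rewrite !mxE.
Qed.

Section perturbation.
Context {R : realType}.
Notation mu := (@lebesgue_measure R).
Notation P2 := (measurableTypeR R * measurableTypeR R)%type.
Variables (eps b s e T T1 d EM : R) (n N : nat) (A : 'M[R]_2) (U V : state R (R * (R * R))).
Let m : R := (eps ^+ 2)^-1.
Let V0 := shear_data d n A.
Let q := (2 * pi) ^+ 2 : R.

Hypotheses (s3 : 3 <= s) (e0 : 0 <= e) (n0 : (0 < n)%N) (nN : (n <= N)%N) (mn : m <= n%:R).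
Hypotheses (T10 : 0 <= T1) (T1T : T1 <= T) (A10 : A 1 0 = 0).
Hypothesis sol : euler_oldroyd_sol eps b s T V0 V.
Hypothesis uniq : forall V', euler_oldroyd_sol eps b s T V0 V' ->
  \forall z \ae @volume R, cylinder T z -> V'.1 z = V.1 z /\ V'.2 z = V.2 z.
Hypothesis U_Hs : \forall t \ae mu, time T t -> state_Hs s (slice U t).
Hypothesis U_modes : \forall t \ae mu, time T t -> forall k, k != (0, 0) ->
    (forall i, no_modes (fun x => U.1 (t, x) i 0) k) /\
    (forall i j, no_modes (fun x => U.2 (t, x) i j) k).
Hypothesis U_mean : \forall t \ae mu, time T1 t ->
  m + 3 <= q^-1 * ((1 + b) * cmode (fun x => U.2 (t, x) 1 1) (0, 0) -
                   (1 - b) * cmode (fun x => U.2 (t, x) 0 0) (0, 0)) <= EM.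
Hypothesis close : \forall t \ae mu, time T t ->
  (state_Hs_norm s (slice (state_sub V U) t) <= e%:E)%E.
Hypothesis EM0 : 0 <= EM.
Hypothesis e_small : 9 * ((`|1 + b| + `|1 - b|) * e) <= 1.

Let m0 : 0 <= m. Proof. by rewrite /m invr_ge0 sqr_ge0. Qed.

Let V0_Hs : state_Hs s V0. Proof. exact: shear_data_Hs. Qed.

Let V_no_y k : k.2 != 0 -> \forall t \ae mu, time T t ->
    (forall i, no_modes (fun x => V.1 (t, x) i 0) k) /\
    (forall i j, no_modes (fun x => V.2 (t, x) i j) k).
Proof.
move=> k2; apply: (unique_sol_modes (small_half_turn2 k2) V0_Hs _ sol uniq (phase_half_turn2 k2)).
apply: shear_data_invariant => x; congr cos.
by rewrite [X in _ + X]/phase /= mulr0 mul0r !addr0.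
Qed.

Let V_low (l : nat) : (0 < l < n)%N -> \forall t \ae mu, time T t ->
    (forall i, no_modes (fun x => V.1 (t, x) i 0) (l%:Z, 0)) /\
    (forall i j, no_modes (fun x => V.2 (t, x) i j) (l%:Z, 0)).
Proof.
move=> /andP[l0 ln]; have nR : 0 < n%:R :> R by rewrite ltr0n.
have nR1 : 1 <= n%:R :> R by rewrite ler1n.
have p0 := @twopi_gt0 R.
pose h : R * R := (2 * pi / n%:R, 0).
have sh : small h.
  split; rewrite /h /=; last by rewrite lexx ltW.
  by apply/andP; split; [rewrite divr_ge0// ltW|rewrite ler_pdivrMr// ler_peMr// ltW].
apply: (unique_sol_modes sh V0_Hs _ sol uniq).
  apply: shear_data_invariant => x.
  have -> : phase (n%:Z, 0) h = 1%:~R * (2 * pi).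
    by rewrite /phase /= -pmulrn mulrC divfK ?gt_eqF// mulr0 addr0 mul1r.
  exact: cos_periodZ.
have lR : 0 < l%:R :> R by rewrite ltr0n.
have phE : phase (l%:Z, 0) h = l%:R * (2 * pi / n%:R).
  by rewrite /phase /= -pmulrn mulr0 addr0.
have ph0 : 0 < l%:R * (2 * pi / n%:R) :> R by rewrite mulr_gt0// divr_gt0.
rewrite phE; apply: cos_lt1; rewrite gtr0_norm//.
by rewrite mulrCA gtr_pMr// ltr_pdivrMr// mul1r ltr_nat.
Qed.

Let V_Hs : \forall t \ae mu, time T t -> state_Hs s (slice V t).
Proof. by have [[]] := sol. Qed.

Let time1 t : time T1 t -> time T t.
Proof. by rewrite /time /= !in_itv/= => /andP[-> h]; exact: lt_le_trans h T1T. Qed.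

Let B := q * e.
Let defect := q * (2 * pi ^+ 2 * ((EM + 1) * (9 * e) * (4 * e / N%:R))).

Let q0 : 0 < q. Proof. by rewrite /q exprn_gt0// twopi_gt0. Qed.

Let B0 : 0 <= B. Proof. by rewrite mulr_ge0// ltW. Qed.

Let no_y : \forall t \ae mu, time T t -> forall k, k.2 != 0 ->
    (forall i, no_modes (fun x => V.1 (t, x) i 0) k) /\
    (forall i j, no_modes (fun x => V.2 (t, x) i j) k).
Proof.
apply: ae_forall_modes => k; have [k0|k0] := eqVneq k.2 0; first by apply: aeW => t _.
by apply: ae_imp (V_no_y k0) _ => t H tT _; exact: H.
Qed.

Let decay : \forall t \ae mu, time T t -> forall l, (0 < l)%N ->
  [/\ l%:R ^+ 3 * `|cmode (fun x => V.1 (t, x) 1 0) (l%:Z, 0)| <= B,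
      l%:R ^+ 3 * `|smode (fun x => V.1 (t, x) 1 0) (l%:Z, 0)| <= B,
      l%:R ^+ 3 * `|cmode (fun x => V.2 (t, x) 1 0) (l%:Z, 0)| <= B &
      l%:R ^+ 3 * `|smode (fun x => V.2 (t, x) 1 0) (l%:Z, 0)| <= B].
Proof.
apply: ae_imp (ae_and (ae_and close V_Hs) (ae_and U_Hs U_modes)) _.
move=> t [[cl vh] [uh um]] tT l l0.
have [v1 v2] := vh tT; have [u1 u2] := uh tT.
have [c1 c2] := slice_sub_norm_le e0 (cl tT).
have k0 : (l%:Z, 0) != (0, 0) :> (int * int)%type.
  by rewrite xpair_eqE eqxx andbT eqz_nat -lt0n.
have [z1 z2] := um tT _ k0.
have [a1 a2] := near_coef s3 e0 (v1 1) (u1 1) (c1 1) (z1 1).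
by have [a3 a4] := near_coef s3 e0 (v2 1 0) (u2 1 0) (c2 1 0) (z2 1 0).
Qed.

(** The solution with data oscillating at frequency n and of size d grows like
    expR (n T1) as long as it stays e-close to the constant background. *)
Lemma perturbed_growth :
  ((n%:R + m) * d ^+ 2 - 2 * defect * T1) * (expR (n%:R * T1) - 1) <=
  n%:R * (T1 * ((8 + 4 * (n%:R + m)) * B ^+ 2)).
Proof.
have mean0 : cmode (fun x => V0.1 x 0 0) (0, 0) = 0.
  rewrite (_ : (fun x => _) = fun _ => 0); last by apply/funext => x; rewrite mxE.
  by rewrite cmode_const0 mulr0.
have [g [w [gi wi dyn pv pc]]] := shear_dynamics V0_Hs sol V_no_y mean0.
have c0E : (fun x => V0.2 x 1 0) = (fun _ : R * R => 0 : R) by apply/funext => x; exact: A10.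
have c0c l : cmode (fun x => V0.2 x 1 0) (l%:Z, 0) = 0.
  rewrite c0E /cmode; under eq_Rintegral do rewrite mul0r; exact: Rint_cell0.
have c0s l : smode (fun x => V0.2 x 1 0) (l%:Z, 0) = 0.
  rewrite c0E /smode; under eq_Rintegral do rewrite mul0r; exact: Rint_cell0.
have ti : L1_cylinder T (fun z => V.2 z 1 0).
  by have [_ [p [ut [Dp [Du [taut [Dtau [[w1 w2 w3 w4 w5] _]]]]]]]] := sol; have [] := w2 1 0.
have N0 : (0 < N)%N by exact: leq_trans n0 nN.
have e1 : 0 <= 9 * e by rewrite mulr_ge0.
have e2 : 0 <= 4 * e / N%:R by rewrite divr_ge0// mulr_ge0.
apply: (@energy_growth R T1 m B defect d n N
  (fun l => cmode (fun x => V0.1 x 1 0) (l%:Z, 0)) (fun l => smode (fun x => V0.1 x 1 0) (l%:Z, 0))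
  (fun l t => cmode (fun x => V.1 (t, x) 1 0) (l%:Z, 0))
  (fun l t => smode (fun x => V.1 (t, x) 1 0) (l%:Z, 0))
  (fun l t => cmode (fun x => V.2 (t, x) 1 0) (l%:Z, 0))
  (fun l t => smode (fun x => V.2 (t, x) 1 0) (l%:Z, 0))
  (fun l t => cmode (fun x => w (t, x)) (l%:Z, 0))
  (fun l t => smode (fun x => w (t, x)) (l%:Z, 0))) => //.
- apply: mulr_ge0; first exact: ltW.
  apply: mulr_ge0; first by rewrite mulr_ge0// exprn_ge0// pi_ge0.
  by apply: mulr_ge0 e2; apply: mulr_ge0 e1; rewrite addr_ge0.
- by move=> l; have [h _] := pv l%:Z; have := ae_primitiveS T1T h; rewrite -pmulrn.
- by move=> l; have [_ h] := pv l%:Z; have := ae_primitiveS T1T h; rewrite -pmulrn.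
- by move=> l; have [h _] := pc (l%:Z, 0); have := ae_primitiveS T1T h; rewrite c0c.
- by move=> l; have [_ h] := pc (l%:Z, 0); have := ae_primitiveS T1T h; rewrite c0s.
- have vE : (fun x => V0.1 x 1 0) = (fun x => d * cos (phase (n%:Z, 0) x)).
    by apply/funext => x; rewrite mxE.
  have vn : cmode (fun x => V0.1 x 1 0) (n%:Z, 0) = 2 * pi ^+ 2 * d.
    rewrite vE cmodeZ; last exact: cosineX_integrable.
    rewrite mulrC; congr (_ * _).
    have := wmode_row n 0 (0 : R) n0; rewrite eqxx subrr cos0 mulr1 => <-.
    by rewrite cmodeE; congr (wmode _ _ _); apply/funext => x; rewrite addr0.
  rewrite (bigD1_seq n) ?mem_index_iota ?n0 ?ltnS ?iota_uniq//= vn.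
  have big : 1 <= 2 * pi ^+ 2 :> R.
    have := @pi_ge2 R; rewrite expr2 => p2; nra.
  apply: (@le_trans _ _ ((2 * pi ^+ 2 * d) ^+ 2)).
    by rewrite exprMn ler_peMl ?sqr_ge0// exprn_ege1.
  rewrite -addrA lerDl addr_ge0 ?sqr_ge0// sumr_ge0// => l _.
  by rewrite addr_ge0 ?sqr_ge0.
- have h : \forall t \ae mu, forall l, time T t -> (0 < l < n)%N ->
      (forall i, no_modes (fun x => V.1 (t, x) i 0) (l%:Z, 0)).
    apply: ae_foralln => l; have [ln|ln] := boolP (0 < l < n)%N; last by apply: aeW => t _ /negP.
    by apply: ae_imp (V_low ln) _ => t H tT _; have [] := H tT.
  by apply: ae_imp h _ => t H /time1 tT l ln; exact: H l tT ln 1.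
- by apply: ae_imp decay _ => t h /time1 tT l l0; exact: h.
apply: ae_imp (ae_and (ae_and (ae_and dyn decay) (ae_and V_Hs no_y))
  (ae_and (ae_and U_Hs (ae_and U_modes U_mean)) (ae_and close
   (ae_and (cylinder_section gi) (cylinder_section wi))))) _.
move=> t [[[dynt dect] [vh ny]] [[uh [um mean]] [cl [git wit]]]] tT1.
have tT := time1 tT1.
have {}gi := git tT; have {}wi := wit tT; have {}dect := dect tT; have {}ny := ny tT.
have {}um := um tT; have {mean}/andP[mean1 mean2] := mean tT1.
have [gm wE] := dynt tT; have [v1 v2] := vh tT; have [u1 u2] := uh tT.
have [c1 c2] := slice_sub_norm_le e0 (cl tT).
have ci := Hs_integrable (v2 1 0).
pose ag x := - w (t, x) - m * V.2 (t, x) 1 0.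
have agi : (@area R).-integrable (@cell R) (EFin \o ag).
  have i1 := integrableZr' (-1) measurable_cell wi.
  have i2 := integrableZr' m measurable_cell ci.
  have := integrableBr measurable_cell i1 i2; apply: eq_integrable => // x _ /=.
  by rewrite /ag mulN1r.
exists (fun l => cmode ag (l%:Z, 0)), (fun l => smode ag (l%:Z, 0)); split.
  move=> l; have wagE : (fun x => w (t, x)) = (fun x => -1 * ag x - m * V.2 (t, x) 1 0).
    by apply/funext => x; rewrite /ag; ring.
  by rewrite wagE cmode_lin// smode_lin// !mulN1r.
have gl l : l%:R * smode (fun x => V.1 (t, x) 1 0) (l%:Z, 0) = cmode (fun x => g (t, x)) (l%:Z, 0).
  by have [-> _] := gm (l%:Z, 0); rewrite /= -pmulrn.
have gl' l : - (l%:R * cmode (fun x => V.1 (t, x) 1 0) (l%:Z, 0)) = smode (fun x => g (t, x)) (l%:Z, 0).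
  by have [_ ->] := gm (l%:Z, 0); rewrite /= -pmulrn.
rewrite (eq_bigr (fun l => cmode (fun x => g (t, x)) (l%:Z, 0) ^+ 2 + smode (fun x => g (t, x)) (l%:Z, 0) ^+ 2)); last first.
  by move=> l _; rewrite gl gl'.
rewrite [leRHS](eq_bigr (fun l => cmode (fun x => g (t, x)) (l%:Z, 0) * cmode ag (l%:Z, 0) +
   smode (fun x => g (t, x)) (l%:Z, 0) * smode ag (l%:Z, 0))); last first.
  by move=> l _; rewrite gl gl'.
have gny k : k.2 != 0 -> no_modes (fun x => g (t, x)) k.
  move=> k2; rewrite /no_modes; have [-> ->] : cmode (fun x => g (t, x)) k = k.1%:~R * smode (fun x => V.1 (t, x) 1 0) k /\
     smode (fun x => g (t, x)) k = - (k.1%:~R * cmode (fun x => V.1 (t, x) 1 0) k) by exact: gm.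
  by have [h _] := ny k k2; have [-> ->] := h 1; rewrite !mulr0 oppr0.
have g00 : cmode (fun x => g (t, x)) (0, 0) = 0 by have [-> _] := gm (0, 0); rewrite mul0r.
have gdec l : (0 < l)%N -> `|cmode (fun x => g (t, x)) (l%:Z, 0)| <= B * (l%:R ^+ 2)^-1 /\
     `|smode (fun x => g (t, x)) (l%:Z, 0)| <= B * (l%:R ^+ 2)^-1.
  move=> l0; have [d1 d2 _ _] := dect l l0; rewrite -gl -gl' normrN !normrM ger0_norm//.
  have l2 : 0 < l%:R ^+ 2 :> R by rewrite exprn_gt0// ltr0n.
  by split; rewrite ler_pdivlMr// mulrC mulrA -exprSr.
have gB := row_ae_bound e0 gi gny _ gdec.
have gB' : \forall x \ae @area R, @cell R x -> `|g (t, x)| <= 9 * e.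
  by apply: gB; rewrite g00 normr0 mulr_ge0// ltW.
have rB := row_trig_approx e0 N0 gi gny g00 gdec.
have EB := near_const (1 + b) (1 - b) s3 e0 (v2 1 1) (v2 0 0) (u2 1 1) (u2 0 0) (c2 1 1) (c2 0 0).
have {}EB : \forall x \ae @area R, @cell R x ->
    `|(1 + b) * V.2 (t, x) 1 1 - (1 - b) * V.2 (t, x) 0 0 -
      q^-1 * ((1 + b) * cmode (fun x => U.2 (t, x) 1 1) (0, 0) -
                   (1 - b) * cmode (fun x => U.2 (t, x) 0 0) (0, 0))| <= 1.
  apply: ae_imp (EB _ _) _.
  - by move=> k k0; have [_ h] := um k k0; split; exact: h.
  - by move=> k k0; have [_ h] := ny k k0; split; exact: h.
  - by move=> x h xc; apply: le_trans e_small; exact: h.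
apply: (@stretching_lower R (fun x => g (t, x)) ag
  (fun x => 2^-1 * ((1 + b) * V.2 (t, x) 1 1 - (1 - b) * V.2 (t, x) 0 0 - m)) N (EM + 1) (9 * e) (4 * e / N%:R)) => //.
apply: ae_imp (ae_and (ae_and wE gB') (ae_and rB EB)) _.
move=> x [[wx gx] [rx Ex]] xc; have {}wx := wx xc; have {}Ex := Ex xc.
split; [|move: Ex mean1 mean2|exact: gx|exact: rx].
  by rewrite /ag wx -/m; ring.
move: (_^-1 * _) (_ - (1 - b) * V.2 _ _ _) => y z.
rewrite ler_norml => /andP[h1 h2] h3 h4; have := m0; have := EM0 => h5 h6.
by apply/andP; split; lra.
Qed.

End perturbation.

(** * J1 *)

Section background.
Context {R : realType}.
Notation mu := (@lebesgue_measure R).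

Lemma LinfHs_bound (s T : R) U : LinfHs s T U -> exists2 K : R, 0 <= K &
  \forall t \ae mu, time T t -> (state_Hs_norm s (slice U t) <= K%:E)%E.
Proof.
move=> [_ _ _ fin]; exists `|fine (LinfHs_norm s T U)| => //; apply: LinfHs_norm_ae.
by move: fin; case: (LinfHs_norm s T U) => [r||] //= _; rewrite ?lee_fin ?ler_norm ?leNye.
Qed.

Variables (eps b s T : R) (A : 'M[R]_2) (U : state R (R * (R * R))).
Let m : R := (eps ^+ 2)^-1.
Let U0 := shear_data 0 0 A.
Hypotheses (s3 : 3 <= s) (T0 : 0 < T).
Hypothesis sol : euler_oldroyd_sol eps b s T U0 U.
Hypothesis uniq : forall V', euler_oldroyd_sol eps b s T U0 V' ->
  \forall z \ae @volume R, cylinder T z -> V'.1 z = U.1 z /\ V'.2 z = U.2 z.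

Let U0_inv h x : @cell R x -> U0.1 (wrap2 h x) = U0.1 x /\ U0.2 (wrap2 h x) = U0.2 x.
Proof.
by move=> _; split=> //; apply/matrixP => i j; rewrite !mxE; case: ifP => // _; rewrite !mul0r.
Qed.

Lemma background_mode k : k != (0, 0) -> \forall t \ae mu, time T t ->
    (forall i, no_modes (fun x => U.1 (t, x) i 0) k) /\
    (forall i j, no_modes (fun x => U.2 (t, x) i j) k).
Proof.
move=> k0; have U0h : state_Hs s U0 := shear_data_Hs s 0 0 A.
have [k10|k10] := eqVneq k.1 0; last first.
  exact: (unique_sol_modes (small_half_turn1 k10) U0h (@U0_inv _) sol uniq (phase_half_turn1 k10)).
have k20 : k.2 != 0.
  by apply: contra_neq k0 => k20; move: k10 k20; case: k => a c /= -> ->.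
exact: (unique_sol_modes (small_half_turn2 k20) U0h (@U0_inv _) sol uniq (phase_half_turn2 k20)).
Qed.

Lemma background_modes : \forall t \ae mu, time T t -> forall k, k != (0, 0) ->
    (forall i, no_modes (fun x => U.1 (t, x) i 0) k) /\
    (forall i j, no_modes (fun x => U.2 (t, x) i j) k).
Proof.
apply: ae_forall_modes => k; have [->|k0] := eqVneq k (0, 0); first by apply: aeW => t _ /eqP.
by apply: ae_imp (background_mode k0) _ => t H tT _; exact: H.
Qed.

Lemma background_mean : (1 + b) * A 1 1 - (1 - b) * A 0 0 = m + 4 ->
  exists T1 : R, [/\ 0 < T1, T1 <= T &
  \forall t \ae mu, time T1 t ->
    m + 3 <= ((2 * pi) ^+ 2)^-1 * ((1 + b) * cmode (fun x => U.2 (t, x) 1 1) (0, 0) -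
                   (1 - b) * cmode (fun x => U.2 (t, x) 0 0) (0, 0)) <= m + 5].
Proof.
move=> AE; have [LU _] := sol; have [K K0 hK] := LinfHs_bound LU.
set q := (2 * pi) ^+ 2; have q0 : 0 < q :> R by rewrite /q exprn_gt0// twopi_gt0.
have m0 : 0 <= m by rewrite /m invr_ge0 sqr_ge0.
have C0 : 0 <= q * K by rewrite mulr_ge0// ltW.
have near i j : \forall t \ae mu, time T t ->
    `|cmode (fun x => U.2 (t, x) i j) (0, 0) - q * A i j| <= m * (q * K) * t.
  have p := constant_stress (shear_data_Hs s 0 0 A) sol i j background_mode.
  have e : cmode (fun x => U0.2 x i j) (0, 0) = q * A i j by rewrite cmode_const0.
  rewrite e in p; apply: ae_primitive_near p _ => //.
  apply: ae_imp hK _ => t h tT; have [_ h2] := state_Hs_norm_le K0 (h tT).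
  exact: (coef0_bound s3 K0 (h2 i j)).
pose c : R := `|1 + b| + `|1 - b|.
have c0 : 0 <= c * (m * K) by rewrite mulr_ge0 ?mulr_ge0// addr_ge0.
pose T1 := Num.min T (c * (m * K) + 1)^-1.
have T1T : T1 <= T by rewrite /T1 ge_min lexx.
have d0 : 0 < c * (m * K) + 1 by rewrite ltr_wpDl.
exists T1; split => //; first by rewrite /T1 lt_min T0 invr_gt0.
apply: ae_imp (ae_and (near 1 1) (near 0 0)) _ => t [h1 h2] tT1.
have /andP[t0 tT1'] : 0 < t < T1 by move: tT1; rewrite /time /= in_itv.
have tT : time T t by rewrite /time /= in_itv/= t0 (lt_le_trans tT1').
have {}h1 := h1 tT; have {}h2 := h2 tT.
have small : c * (m * K) * t <= 1.
  have tle : t <= (c * (m * K) + 1)^-1.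
    by apply: (le_trans (ltW tT1')); rewrite /T1 ge_min lexx orbT.
  have := ler_wpM2l (ltW d0) tle; rewrite divff ?gt_eqF// mulrDl mul1r; lra.
move: h1 h2; set y1 := cmode _ _; set y0 := cmode _ _ => h1 h2.
have : `|q^-1 * ((1 + b) * y1 - (1 - b) * y0) - (m + 4)| <= 1.
  rewrite -AE; rewrite [X in `|X|](_ : _ = q^-1 * ((1 + b) * (y1 - q * A 1 1) - (1 - b) * (y0 - q * A 0 0))).
    rewrite normrM gtr0_norm ?invr_gt0// mulrC ler_pdivrMr// mul1r.
    apply: (le_trans (ler_normB _ _)); rewrite !normrM.
    apply: (@le_trans _ _ (`|1 + b| * (m * (q * K) * t) + `|1 - b| * (m * (q * K) * t))).
      by apply: lerD; apply: ler_wpM2l.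
    rewrite [leLHS](_ : _ = c * (m * K) * t * q); last by rewrite /c; ring.
    by rewrite ler_piMl// ltW.
  by field; rewrite gt_eqF.
by rewrite ler_norml => /andP[g1 g2]; apply/andP; split; lra.
Qed.

End background.

Section small_data.
Context {R : realType}.

Lemma cosine_Hs_small (s kappa : R) (K n : nat) : 0 <= s -> s <= K%:R -> 0 <= kappa ->
  (Hs_norm_sq s (fun x => kappa / (1 + n%:R ^+ 2) ^+ K * cos (phase (n%:Z, 0) x))%R
    <= ((2 * kappa) ^+ 2)%:E)%E.
Proof.
move=> s0 sK k0; have [_ h] := cosine_Hs s (kappa / (1 + n%:R ^+ 2) ^+ K) (n%:Z, 0).
apply: (le_trans h); rewrite lee_fin /= -pmulrn expr0n addr0.
set a := 1 + n%:R ^+ 2; have a1 : 1 <= a by rewrite lerDl sqr_ge0.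
have a0 : 0 < a by exact: lt_le_trans a1.
have aK : 0 < a ^+ K by rewrite exprn_gt0.
rewrite [leRHS](_ : _ = 4 * (kappa ^+ 2)); last by ring.
apply: ler_wpM2l => //; rewrite expr_div_n mulrA ler_pdivrMr ?exprn_gt0// mulrC.
apply: ler_wpM2l; first exact: sqr_ge0.
apply: (@le_trans _ _ (a ^+ K)).
  by rewrite -(powR_mulrn K (ltW a0)); exact: (ler_powR a1 sK).
have aK1 : 1 <= a ^+ K by exact: exprn_ege1.
by rewrite expr2 ler_peMr// ltW.
Qed.

(** Difference, and norm, of two data that differ by the oscillation only. *)
Lemma shear_data_norm_le (s d r M : R) n (A : 'M[R]_2) : 0 <= r -> 0 <= M ->
  (Hs_norm_sq s (fun x => d * cos (phase (n%:Z, 0) x))%R <= (r ^+ 2)%:E)%E ->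
  (\sum_(i < 2) \sum_(j < 2) Hs_norm_sq s (fun _ => A i j)%R <= M%:E)%E ->
  (state_Hs_norm s (shear_data d n A) <= sqrte (r ^+ 2 + M)%:E)%E.
Proof.
move=> r0 M0 hd hA; rewrite /state_Hs_norm lee_sqrt; last by rewrite lee_fin addr_ge0 ?sqr_ge0.
rewrite EFinD; apply: leeD; last exact: hA.
rewrite sum_ord2 (_ : (fun x => _) = fun _ => 0); last by apply/funext => x; rewrite mxE.
by rewrite Hs_norm_zero add0e; move: hd; congr (Hs_norm_sq _ _ <= _)%E; apply/funext => x; rewrite mxE.
Qed.

Lemma shear_data_sub (d : R) n A : state_sub (shear_data d n A) (shear_data 0 0 A) = shear_data d n 0.
Proof.
congr pair; apply/funext => x; last by rewrite /= subrr.
by apply/matrixP => i j; rewrite !mxE; case: ifP => _; rewrite ?subrr// mul0r subr0.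
Qed.

End small_data.

(** * J2 *)

Lemma diagonal_stress (R : realType) (b c : R) : exists A : 'M[R]_2,
  A 1 0 = 0 /\ (1 + b) * A 1 1 - (1 - b) * A 0 0 = c.
Proof.
pose D : R := (1 + b) ^+ 2 + (1 - b) ^+ 2.
have D0 : D != 0.
  by rewrite gt_eqF// /D; have := sqr_ge0 b; rewrite !expr2; nra.
exists (\matrix_(i, j) if i != j then 0 else if i == 0 then - c * (1 - b) / D else c * (1 + b) / D).
by rewrite !mxE /=; split=> //; rewrite /D; field; rewrite -/D.
Qed.

Theorem theorem1 (R : realType) (eps b s : R) (eps_gt0 : 0 < eps)
  (s_ge3 : 3 <= s) : ill_posed eps b s.
Proof.
move=> wp; pose m : R := (eps ^+ 2)^-1.
have m0 : 0 <= m by rewrite /m invr_ge0 sqr_ge0.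
have s0 : 0 <= s by apply: le_trans s_ge3.
have [A [A10 AE]] := diagonal_stress b (m + 4).
pose HA : \bar R := (\sum_(i < 2) \sum_(j < 2) Hs_norm_sq s (fun _ => A i j)%R)%E.
have HA0 : (0 <= HA)%E by rewrite /HA !sum_ord2 !adde_ge0 ?Hs_norm_sq_ge0.
have HAfin : (HA < +oo)%E.
  have f i j : (Hs_norm_sq s (fun _ => A i j) < +oo)%E by have [] := const_Hs s (A i j).
  by rewrite /HA !sum_ord2 !lte_add_pinfty.
have [a aE a0] : exists2 a, HA = a%:E & 0 <= a :> R.
  by move: HA0 HAfin; case: HA => [r||] //= r0 _; exists r.
have adm d n : (Hs_norm_sq s (fun x => d * cos (phase (n%:Z, 0) x))%R <= (1 ^+ 2)%:E)%E ->
    admissible s (a + 1) (shear_data d n A).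
  move=> hd; split; [exact: shear_data_Hs|exact: shear_data_div_free|].
  have hA : (\sum_(i < 2) \sum_(j < 2) Hs_norm_sq s (fun _ => A i j)%R <= a%:E)%E by rewrite -aE.
  apply: (le_trans (shear_data_norm_le ler01 a0 hd hA)).
  rewrite /= lee_fin -[leRHS]ger0_norm ?addr_ge0// -sqrtr_sqr ler_sqrt ?sqr_ge0//.
  by rewrite expr1n; nra.
have M0 : 0 < a + 1 by rewrite ltr_wpDl.
have [T T0 [Phi [sols cont]]] := wp _ M0.
have adm0 : admissible s (a + 1) (shear_data 0 0 A).
  apply: adm; rewrite (_ : (fun x => _) = fun _ => 0); last by apply/funext => x; rewrite mul0r.
  by rewrite Hs_norm_zero lee_fin expr1n.
have [solU uniqU] := sols _ adm0; set U := Phi _ in solU uniqU.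
have [T1 [T10 T1T mean]] := background_mean s_ge3 T0 solU uniqU AE.
have modes := background_modes solU uniqU.
have [[_ _ UHs _] _] := solU.
pose c : R := `|1 + b| + `|1 - b|.
have c0 : 0 <= c by rewrite addr_ge0.
pose e : R := (9 * c + 1)^-1.
have d0 : 0 < 9 * c + 1 by rewrite ltr_wpDl// mulr_ge0.
have e0 : 0 < e by rewrite invr_gt0.
have esmall : 9 * (c * e) <= 1.
  by rewrite mulrA ler_pdivrMr// mul1r lerDl.
have [dd dd0 hcont] := cont _ adm0 e e0.
pose kappa : R := Num.min 2^-1 (dd / 4).
have k0 : 0 < kappa by rewrite lt_min invr_gt0// ltr0n/= divr_gt0.
have k1 : 2 * kappa <= 1.
  by have : kappa <= 2^-1; [rewrite ge_min lexx|lra].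
have k2 : 2 * kappa < dd.
  have : kappa <= dd / 4 by rewrite ge_min lexx orbT.
  by move: dd0; lra.
pose K := Num.bound s; have sK : s <= K%:R by exact: ltW (archi_boundP s0).
pose B : R := (2 * pi) ^+ 2 * e.
have [n [nm n0 hn]] := @exp_beats_poly R kappa T1 (24 * T1 * B ^+ 2) K (Num.bound m).+1 k0 T10
  (mulr_ge0 (mulr_ge0 (ler0n _ _) (ltW T10)) (sqr_ge0 B)).
have mn : m <= n%:R.
  by apply: (le_trans (ltW (archi_boundP m0))); rewrite ler_nat ltnW.
pose d : R := kappa / (1 + n%:R ^+ 2) ^+ K.
have d1 : 0 < d by rewrite divr_gt0// exprn_gt0// ltr_pwDl// sqr_ge0.
have hd := cosine_Hs_small n s0 sK (ltW k0).
have admn : admissible s (a + 1) (shear_data d n A).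
  by apply: adm; apply: (le_trans hd); rewrite lee_fin lerXn2r ?nnegrE ?mulr_ge0// ltW.
have [solV uniqV] := sols _ admn; set V := Phi _ in solV uniqV.
have close : (LinfHs_norm s T (state_sub V U) < e%:E)%E.
  apply: hcont => //; rewrite shear_data_sub.
  have h0 : (\sum_(i < 2) \sum_(j < 2) Hs_norm_sq s (fun _ => (0 : 'M[R]_2) i j)%R <= 0%:E)%E.
    have z i j : Hs_norm_sq s (fun _ => (0 : 'M[R]_2) i j) = 0%E.
      rewrite -[RHS](Hs_norm_zero s); congr Hs_norm_sq; apply/funext => x; by rewrite mxE.
    by rewrite !sum_ord2 !z !adde0.
  apply: (le_lt_trans (shear_data_norm_le _ (lexx 0) hd h0)); first by rewrite mulr_ge0// ltW.
  by rewrite addr0 /= sqrtr_sqr lte_fin ger0_norm// mulr_ge0// ltW.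
have closet := LinfHs_norm_ae (ltW close).
pose k : R := n%:R + m.
have n1 : 1 <= n%:R :> R by rewrite ler1n.
have kk1 : 1 <= k by rewrite /k (le_trans n1)// lerDl.
have kk0 : 0 < k by exact: lt_le_trans kk1.
pose D : R := (2 * pi) ^+ 2 * (2 * pi ^+ 2 * ((m + 5 + 1) * (9 * e) * (4 * e))).
have D0 : 0 <= D.
  have e00 := ltW e0; apply: mulr_ge0; first exact: sqr_ge0.
  apply: mulr_ge0; first by rewrite mulr_ge0// sqr_ge0.
  by rewrite !mulr_ge0// !addr_ge0.
have kd0 : 0 < k * d ^+ 2 by rewrite mulr_gt0// exprn_gt0.
have X0 : 0 <= 4 * D * T1 / (k * d ^+ 2).
  exact: divr_ge0 (mulr_ge0 (mulr_ge0 (ler0n _ _) D0) (ltW T10)) (ltW kd0).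
pose N := maxn n (Num.bound (4 * D * T1 / (k * d ^+ 2))).
have nN : (n <= N)%N by exact: leq_maxl.
have N0 : 0 < N%:R :> R by rewrite ltr0n (leq_trans n0).
have NX : 4 * D * T1 / (k * d ^+ 2) <= N%:R.
  by apply: (le_trans (ltW (archi_boundP X0))); rewrite ler_nat leq_maxr.
have m50 : 0 <= m + 5 by rewrite addr_ge0.
have := perturbed_growth s_ge3 (ltW e0) n0 nN mn (ltW T10) T1T A10 solV uniqV UHs modes mean
  closet m50 esmall.
rewrite -/m -/k -/B.
set def := (2 * pi) ^+ 2 * _; set Y := expR _ - 1 => main.
have defE : def = D / N%:R by rewrite /def /D; field; rewrite gt_eqF.
have small : 2 * def * T1 <= k * d ^+ 2 / 2.
  rewrite defE; move: NX; rewrite ler_pdivrMr// => NX.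
  rewrite [leLHS](_ : _ = 2 * D * T1 / N%:R); last by ring.
  by rewrite ler_pdivrMr//; move: NX; lra.
have Y0 : 0 <= Y by rewrite /Y subr_ge0 -expR0 ler_expR mulr_ge0// ltW.
have main2 : k * d ^+ 2 / 2 * Y <= n%:R * (T1 * ((8 + 4 * k) * B ^+ 2)).
  by apply: le_trans main; apply: ler_wpM2r => //; lra.
have main3 : k * d ^+ 2 / 2 * Y <= n%:R * (T1 * (12 * k * B ^+ 2)).
  apply: (le_trans main2); apply: ler_wpM2l => //; apply: ler_wpM2l; first exact: ltW.
  by apply: ler_wpM2r; [exact: sqr_ge0|lra].
have main4 : d ^+ 2 * Y <= 24 * T1 * B ^+ 2 * n%:R.
  rewrite -(ler_pM2l (divr_gt0 kk0 (ltr0n R 2))).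
  rewrite [leLHS](_ : _ = k * d ^+ 2 / 2 * Y); last by ring.
  by rewrite [leRHS](_ : _ = n%:R * (T1 * (12 * k * B ^+ 2)))//; field.
move: hn; rewrite ltNge => /negP; apply.
set w := (1 + n%:R ^+ 2) ^+ K; have w0 : 0 < w by rewrite exprn_gt0// ltr_pwDl// sqr_ge0.
have := ler_wpM2r (sqr_ge0 w) main4.
rewrite [leLHS](_ : _ = kappa ^+ 2 * Y); last by rewrite /d -/w; field; rewrite gt_eqF.
by rewrite -[leRHS]mulrA.
Qed.
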